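(* Let $(M,\eta,\omega)$ be a pre-cosymplectic manifold. There exist a cosymplectic manifold $(\widetilde M,\widetilde\eta,\widetilde\omega)$ and an embedding $\mathfrak i\colon M\hookrightarrow\widetilde M$ with $\mathfrak i^*\widetilde\eta=\eta$ and $\mathfrak i^*\widetilde\omega=\omega$ such that $\mathfrak i(M)$ is a coisotropic submanifold of $(\widetilde M,\widetilde\eta,\widetilde\omega)$.
   Context: All manifolds, forms and maps are smooth. A pre-cosymplectic manifold is a triple $(M,\eta,\omega)$ with $M$ a manifold of dimension $2d+1$, $\eta\in\Omega^1(M)$ closed and $\omega\in\Omega^2(M)$ closed. Standing assumptions: $\eta$ is nowhere vanishing, $\omega$ has constant rank $2r$, $\eta\wedge\omega^r$ is nowhere zero, and $\ker\eta\cap\ker\omega$ has constant rank. A cosymplectic manifold is a triple $(\widetilde M,\widetilde\eta,\widetilde\omega)$ with $\dim\widetilde M=2n+1$, $\widetilde\eta$ a closed 1-form and $\widetilde\omega$ a closed 2-form such that $\widetilde\eta\wedge\widetilde\omega^n$ is nowhere zero. For a subspace $W\subseteq T_m\widetilde M$ the cosymplectic orthogonal is $W^{\perp}=\{X\in T_m\widetilde M:\widetilde\eta(X)=0\text{ and }\widetilde\omega(X,Y)=0\ \forall Y\in W\}$. A submanifold $N$ of $\widetilde M$ is coisotropic if $(T_nN)^{\perp}\subseteq T_nN$ for every $n\in N$. *)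

(* Defs.v *)
From HB Require Import structures.
From mathcomp Require Import all_boot all_order all_fingroup all_algebra.
From mathcomp Require Import all_classical all_reals all_analysis.
Set Implicit Arguments. Unset Strict Implicit. Unset Printing Implicit Defensive.
Import Order.TTheory GRing.Theory Num.Theory.
Import numFieldNormedType.Exports.
Local Open Scope classical_set_scope.
Local Open Scope ring_scope.

(* For U open in a finite-dimensional V, existence and continuity on U of the
   iterated directional derivatives of order at most k is the usual C^k. *)
Fixpoint class_C (R : realType) (V W : normedModType R) (k : nat) (U : set V)
    (f : V -> W) : Prop :=
  (forall x, U x -> {for x, continuous f}) /\
  if k is k'.+1 then
    (forall x v, U x -> derivable f x v) /\
    (forall v, class_C k' U (fun x => 'D_v f x))
  else True.

Definition smooth_on (R : realType) (V W : normedModType R) (U : set V)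
    (f : V -> W) : Prop :=
  forall k, class_C k U f.

(* [cmap] and [cinv] are total functions; only their values on [cdom] and on
   [cmap @` cdom] are meaningful. *)
Record chart (R : realType) (n : nat) (M : topologicalType) := Chart {
  cdom : set M;
  cmap : M -> 'rV[R]_n;
  cinv : 'rV[R]_n -> M;
  cdom_open : open cdom;
  cimage_open : open (cmap @` cdom);
  cmapK : forall m, cdom m -> cinv (cmap m) = m;
  cmap_continuous : forall m, cdom m -> {for m, continuous cmap};
  cinv_continuous : forall y, (cmap @` cdom) y -> {for y, continuous cinv}
}.

(* [chart_at] is a choice of a preferred chart around each point; besides
   making [atlas] cover, it is used to coordinatize the tangent spaces. *)
Record manifold (R : realType) (n : nat) := Manifold {
  carrier :> topologicalType;
  manifold_hausdorff : hausdorff_space carrier;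
  manifold_second_countable : @second_countable carrier;
  atlas : set (chart R n carrier);
  chart_at : carrier -> chart R n carrier;
  chart_at_atlas : forall m, atlas (chart_at m);
  chart_at_dom : forall m, cdom (chart_at m) m;
  atlas_compatible : forall c c', atlas c -> atlas c' ->
    smooth_on (cmap c @` (cdom c `&` cdom c')) (cmap c' \o cinv c)
}.

(* T_m M is the space of coordinate vectors in the preferred chart
   [chart_at m]: v stands for the sum of the v_i (d/dx_i) at m. The coordinates
   of the same vector in another chart are obtained from the differential of
   the change of charts, see [chart_tangent]. *)
Definition tangent (R : realType) (n : nat) (M : manifold R n) (m : M)
    : vectType R := 'rV[R]_n.

Definition smooth_map (R : realType) (n p : nat) (M : manifold R n)
    (N : manifold R p) (f : M -> N) : Prop :=
  continuous f /\
  forall c c', atlas c -> atlas c' ->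
    smooth_on (cmap c @` (cdom c `&` f @^-1` cdom c'))
      (cmap c' \o f \o cinv c).

Definition tangent_map (R : realType) (n p : nat) (M : manifold R n)
    (N : manifold R p) (f : M -> N) (m : M) : tangent m -> tangent (f m) :=
  'd (cmap (chart_at (f m)) \o f \o cinv (chart_at m)) (cmap (chart_at m) m).
Arguments tangent_map {R n p M N} f m _.

(* The differential at y of the parametrization [cinv c]. *)
Definition chart_tangent (R : realType) (n : nat) (M : manifold R n)
    (c : chart R n M) (y : 'rV[R]_n) : 'rV[R]_n -> tangent (cinv c y) :=
  'd (cmap (chart_at (cinv c y)) \o cinv c) y.

Definition embedding (R : realType) (n p : nat) (M : manifold R n)
    (N : manifold R p) (f : M -> N) : Prop :=
  [/\ smooth_map f,
      injective f,
      forall m, injective (tangent_map f m) &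
      forall U : set M, open U -> exists2 V : set N, open V & U = f @^-1` V].

Section Covectors.
Variables (R : realType) (V : lmodType R).

Definition multilinear (k : nat) (a : ('I_k -> V) -> R) : Prop :=
  forall (v : 'I_k -> V) (i : 'I_k) (t : R) (x y : V),
    a [eta v with i |-> t *: x + y] =
    t * a [eta v with i |-> x] + a [eta v with i |-> y].

Definition alternating (k : nat) (a : ('I_k -> V) -> R) : Prop :=
  forall (v : 'I_k -> V) (i j : 'I_k), i != j -> v i = v j -> a v = 0.

Definition wedge (p q : nat) (a : ('I_p -> V) -> R) (b : ('I_q -> V) -> R)
    : ('I_(p + q) -> V) -> R :=
  fun v => (p`!%:R * q`!%:R)^-1 *
    \sum_(s : 'S_(p + q)) (-1) ^+ s *
      a (fun i => v (s (lshift q i))) * b (fun j => v (s (rshift p j))).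

Fixpoint wedge_pow (w : ('I_2 -> V) -> R) (r : nat) : ('I_r.*2 -> V) -> R :=
  match r return ('I_r.*2 -> V) -> R with
  | 0 => fun=> 1
  | r'.+1 => wedge w (@wedge_pow w r')
  end.

Definition ker1 (a : ('I_1 -> V) -> R) : set V :=
  [set X | a (tnth [tuple X]) = 0].

Definition ker2 (w : ('I_2 -> V) -> R) : set V :=
  [set X | forall Y, w (tnth [tuple X; Y]) = 0].

End Covectors.
Arguments wedge_pow {R V} w r _.

(* The rank of the map X |-> w (X, _) from V to its dual. *)
Definition rank2 (R : realType) (V : vectType R) (w : ('I_2 -> V) -> R) : nat :=
  let e := vbasis {:V} in
  \rank (\matrix_(i, j) w (tnth [tuple tnth e i; tnth e j])
         : 'M[R]_(\dim {:V}, \dim {:V})).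

Definition has_dim (R : realType) (V : vectType R) (A : set V) (k : nat) :=
  exists2 U : {vspace V}, [set X | X \in U] = A & \dim U = k.

(* The expression of a in the coordinates of c, i.e. its pullback by
   [cinv c]. *)
Definition local_form (R : realType) (n : nat) (M : manifold R n) (k : nat)
    (a : forall m : M, ('I_k -> tangent m) -> R) (c : chart R n M)
    (y : 'rV[R]_n) (v : 'I_k -> 'rV[R]_n) : R :=
  a (cinv c y) (fun j => chart_tangent c y (v j)).

Record kform (R : realType) (n : nat) (M : manifold R n) (k : nat) := Kform {
  form_val :> forall m : M, ('I_k -> tangent m) -> R;
  form_multilinear : forall m, multilinear (@form_val m);
  form_alternating : forall m, alternating (@form_val m);
  form_smooth : forall c (v : 'I_k -> 'rV[R]_n), atlas c ->
    smooth_on (cmap c @` cdom c) (fun y => local_form (@form_val) c y v)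
}.
Arguments form_val {R n M k} _ m _.

(* (da)(v_0, ..., v_k) is the alternating sum of the derivatives along v_i of
   a(v_0, ..., omit v_i, ..., v_k), for constant vector fields v_j in the
   coordinates of [chart_at m]. *)
Definition ext_d (R : realType) (n : nat) (M : manifold R n) (k : nat)
    (a : kform M k) (m : M) (v : 'I_k.+1 -> tangent m) : R :=
  \sum_(i < k.+1) (-1) ^+ i *
    'D_(v i : 'rV[R]_n)
      (fun y => local_form a (chart_at m) y (fun j => v (lift i j)))
      (cmap (chart_at m) m).

Definition closed_form (R : realType) (n : nat) (M : manifold R n) (k : nat)
    (a : kform M k) : Prop :=
  forall (m : M) (v : 'I_k.+1 -> tangent m), ext_d a v = 0.

Definition nowhere_zero (R : realType) (n : nat) (M : manifold R n) (k : nat)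
    (a : forall m : M, ('I_k -> tangent m) -> R) : Prop :=
  forall m : M, exists v : 'I_k -> tangent m, a m v != 0.

Definition pullback (R : realType) (n p k : nat) (M : manifold R n)
    (N : manifold R p) (f : M -> N) (a : kform N k)
    (m : M) (v : 'I_k -> tangent m) : R :=
  a (f m) (fun j => tangent_map f m (v j)).

Definition pre_cosymplectic (R : realType) (d r : nat)
    (M : manifold R (2 * d).+1) (eta : kform M 1) (omega : kform M 2) : Prop :=
  [/\ closed_form eta /\ closed_form omega,
      nowhere_zero eta,
      forall m, rank2 (omega m) = (2 * r)%N,
      nowhere_zero (fun m => wedge (eta m) (wedge_pow (omega m) r)) &
      exists k, forall m, has_dim (ker1 (eta m) `&` ker2 (omega m)) k].

Definition cosymplectic (R : realType) (n : nat)
    (M : manifold R (2 * n).+1) (eta : kform M 1) (omega : kform M 2) : Prop :=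
  [/\ closed_form eta, closed_form omega &
      nowhere_zero (fun m => wedge (eta m) (wedge_pow (omega m) n))].

Definition cosymplectic_orthogonal (R : realType) (n : nat) (M : manifold R n)
    (eta : kform M 1) (omega : kform M 2) (m : M) (W : set (tangent m))
    : set (tangent m) :=
  [set X | eta m (tnth [tuple X]) = 0 /\
           forall Y, W Y -> omega m (tnth [tuple X; Y]) = 0].

(* The image of an embedding f is a submanifold whose tangent space at f m is
   the range of the differential of f at m. *)
Definition coisotropic_image (R : realType) (n p : nat) (M : manifold R n)
    (N : manifold R p) (eta : kform N 1) (omega : kform N 2) (f : M -> N)
    : Prop :=
  forall m : M,
    cosymplectic_orthogonal eta omega (range (tangent_map f m))
      `<=` range (tangent_map f m).

(* Main.v *)
From HB Require Import structures.
Require Import Defs.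
From mathcomp Require Import all_boot all_order all_fingroup all_algebra.
From mathcomp Require Import all_classical all_reals all_analysis.
From mathcomp Require Import zify ring lra.
Set Implicit Arguments. Unset Strict Implicit. Unset Printing Implicit Defensive.
Import Order.TTheory GRing.Theory Num.Theory.
Import numFieldNormedType.Exports.
Local Open Scope classical_set_scope.
Local Open Scope ring_scope.

(** Let K = ker eta /\ ker omega. Since K has constant rank k, it is a subbundle
    of TM, and the model space is the total space of its dual bundle K^*, with
    projection pi onto M. Choose a smooth projection Pi of TM onto K and let
    theta be the one-form X |-> a (Pi (d pi X)) at the point (m, a) of K^*. The
    forms
      eta' = pi^* eta,   omega' = pi^* omega + d theta
    are closed, and theta vanishes along the zero section, so that the zero
    section pulls them back to eta and omega.

    At a point m of the zero section the tangent space is T_m M + K_m^*, and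
      omega' ((v, b), (w, c)) = omega (v, w) + b (Pi w) - c (Pi v).
    A basis Y_j of K_m and the dual basis X_j of K_m^* form k hyperbolic pairs,
    and omega' (v, Y_j) = 0 for v in T_m M. Expanding the alternating sum of
    eta' /\ omega'^(r + k), each pair only contributes a nonzero factor
    ([alt_hyperbolic], [wedge_hyperbolic_iter]), so this form is nonzero on the
    zero section because eta /\ omega^r is nonzero on M. The manifold wanted is
    the open set of the points of K^* where eta' /\ omega'^(r + k) does not
    vanish. The zero section is coisotropic: if (v, b) is orthogonal to T_m M,
    then b (Pi w) = - omega (v, w) for all w; for w in K_m the right hand side
    is 0, hence b = 0 and (v, b) is tangent to the zero section. The rank of
    omega enters through the dimension: it forces dim M = 2 r + 1 + k
    ([presymplectic_dim]), so that dim K^* = 2 (r + k) + 1.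

    Everything is expressed by matrices acting on row vectors of coordinates.
    Around each point, K is the left kernel of a matrix of locally constant
    rank, and Gauss elimination at the point provides a basis of this kernel
    that depends smoothly on nearby points ([kernel_frame]). This gives the
    cocycle of K^* ([dual_cocycle]), from which K^* is glued ([gluing],
    [thickening]), as well as local projections onto K, which a partition of
    unity ([partition_of_unity]) combines into Pi ([kernel_proj]).

    The calculus starts from the definition of smoothness by iterated
    directional derivatives: C^1 functions are differentiable
    ([C1_differentiable]), whence the chain rule ([class_C_comp]), and second
    derivatives are symmetric ([schwarz]), which is what makes d theta closed
    ([ext1_closed]) and independent of coordinates ([ext1_natural]). *)

(** * Functions of class C^k *)

Section ClassC.
Context {R : realType}.
Implicit Types V W : normedModType R.

Lemma near_open_eq V W (U : set V) (f g : V -> W) x :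
  open U -> (forall y, U y -> f y = g y) -> U x -> \near x, f x = g x.
Proof. by move=> oU fg Ux; apply: filterS (open_nbhs_nbhs (conj oU Ux)). Qed.

Lemma near_eq_continuous (T : topologicalType) W (f g : T -> W) x :
  (\near x, f x = g x) -> {for x, continuous f} -> {for x, continuous g}.
Proof.
move=> fg; rewrite /prop_for /continuous_at -(nbhs_singleton fg) => h.
apply: cvg_trans h; exact: near_eq_cvg.
Qed.

Lemma class_CW V W k (U : set V) (f : V -> W) :
  class_C k.+1 U f -> class_C k U f.
Proof.
elim: k f => [|k IH] f [cf [df Df]]; split=> //.
by split=> // v; apply: IH.
Qed.

Lemma class_C_le V W k l (U : set V) (f : V -> W) :
  (k <= l)%N -> class_C l U f -> class_C k U f.
Proof.
move=> /subnK <-; elim: (l - k)%N => // p IH; rewrite addSn => /class_CW.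
exact: IH.
Qed.

Lemma class_C_continuous V W k (U : set V) (f : V -> W) x :
  class_C k U f -> U x -> {for x, continuous f}.
Proof. by case: k => [|k] [cf _] /cf. Qed.

(** Every clause of [class_C] speaks about one point of the set at a time. *)
Lemma class_C_cover V W k (U : set V) (f : V -> W) :
  (forall x, U x -> exists2 U' : set V, U' x & class_C k U' f) ->
  class_C k U f.
Proof.
elim: k f => [|k IH] f H; split=> //.
- by move=> x /H[U' Ux [cf _]]; exact: (cf x Ux).
- by move=> x /H[U' Ux [cf _]]; exact: (cf x Ux).
split=> [x v /H[U' Ux [_ [df _]]]|v]; first exact: (df x v Ux).
by apply: IH => x /H[U' Ux [_ [_ Df]]]; exists U'; last exact: (Df v).
Qed.

Lemma class_C_sub V W k (U U' : set V) (f : V -> W) :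
  U `<=` U' -> class_C k U' f -> class_C k U f.
Proof. by move=> s H; apply: class_C_cover => x /s ?; exists U'. Qed.

(** Openness makes the two functions agree near each point of U, so that they
    have the same directional derivatives. *)
Lemma eq_class_C V W k (U : set V) (f g : V -> W) :
  open U -> (forall y, U y -> f y = g y) -> class_C k U f -> class_C k U g.
Proof.
move=> oU; elim: k f g => [|k IH] f g fg [cf Hf].
  by split=> // x Ux; apply: near_eq_continuous (cf x Ux); exact: near_open_eq Ux.
split.
  by move=> x Ux; apply: near_eq_continuous (cf x Ux); exact: near_open_eq Ux.
case: Hf => df Df; split.
  move=> x v Ux; apply: near_eq_derivable (df x v Ux).
  exact: near_open_eq Ux.
move=> v; apply: IH (Df v) => x Ux; apply: near_eq_derive.
exact: near_open_eq Ux.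
Qed.

Lemma class_C_cst V W k (U : set V) (c : W) : class_C k U (fun=> c).
Proof.
elim: k c => [|k IH] c; split=> //.
- by move=> x _; exact: cvg_cst.
- by move=> x _; exact: cvg_cst.
split=> [x v _|v]; first exact: derivable_cst.
suff -> : (fun x => 'D_v (fun=> c) x) = fun=> 0 :> W by exact: (IH 0).
by apply/funext => x; exact: derive_cst.
Qed.

Lemma class_CD V W k (U : set V) (f g : V -> W) : open U ->
  class_C k U f -> class_C k U g -> class_C k U (fun x => f x + g x).
Proof.
move=> oU; elim: k f g => [|k IH] f g [cf Hf] [cg Hg].
  by split=> // x Ux; apply: continuousD (cf x Ux) (cg x Ux).
split; first by move=> x Ux; apply: continuousD (cf x Ux) (cg x Ux).
case: Hf => df Df; case: Hg => dg Dg; split.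
  by move=> x v Ux; apply: (derivableD (df x v Ux) (dg x v Ux)).
move=> v; apply: (@eq_class_C _ _ _ _ (fun x => 'D_v f x + 'D_v g x)) => //.
  by move=> y Uy; rewrite -(deriveD (df y v Uy) (dg y v Uy)).
exact: (IH _ _ (Df v) (Dg v)).
Qed.

Lemma class_CM V k (U : set V) (f g : V -> R) : open U ->
  class_C k U f -> class_C k U g -> class_C k U (fun x => f x * g x).
Proof.
move=> oU; elim: k f g => [|k IH] f g [cf Hf] [cg Hg].
  by split=> // x Ux; apply: continuousM (cf x Ux) (cg x Ux).
split; first by move=> x Ux; apply: continuousM (cf x Ux) (cg x Ux).
have Cf : class_C k U f by apply: class_CW; split.
have Cg : class_C k U g by apply: class_CW; split.
case: Hf => df Df; case: Hg => dg Dg; split.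
  by move=> x v Ux; apply: (derivableM (df x v Ux) (dg x v Ux)).
move=> v.
apply: (@eq_class_C _ _ _ _ (fun x => f x * 'D_v g x + g x * 'D_v f x)) => //.
  by move=> y Uy; rewrite -(deriveM (df y v Uy) (dg y v Uy)).
apply: class_CD => //; first exact: (IH _ _ Cf (Dg v)).
exact: (IH _ _ Cg (Df v)).
Qed.

Lemma class_C_sum V W k (U : set V) I (r : seq I) (P : pred I)
    (F : I -> V -> W) : open U ->
  (forall i, P i -> class_C k U (F i)) ->
  class_C k U (fun x => \sum_(i <- r | P i) F i x).
Proof.
move=> oU H; elim: r => [|i r IH].
  apply: (eq_class_C oU _ (class_C_cst k U (0 : W))).
  by move=> y _; rewrite big_nil.
have [Pi|nPi] := boolP (P i); last first.
  apply: eq_class_C oU _ IH => y _; by rewrite big_cons (negbTE nPi).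
apply: (eq_class_C oU _ (class_CD oU (H i Pi) IH)) => y _.
by rewrite big_cons Pi.
Qed.

Lemma class_C_prod V k (U : set V) I (r : seq I) (P : pred I)
    (F : I -> V -> R) : open U ->
  (forall i, P i -> class_C k U (F i)) ->
  class_C k U (fun x => \prod_(i <- r | P i) F i x).
Proof.
move=> oU H; elim: r => [|i r IH].
  apply: (eq_class_C oU _ (class_C_cst k U (1 : R))).
  by move=> y _; rewrite big_nil.
have [Pi|nPi] := boolP (P i); last first.
  apply: eq_class_C oU _ IH => y _; by rewrite big_cons (negbTE nPi).
apply: (eq_class_C oU _ (class_CM oU (H i Pi) IH)) => y _.
by rewrite big_cons Pi.
Qed.

(** The derivative of 1 / f is - f' / f^2, where 1 / f is of the lower class by
    induction. *)
Lemma class_CV V k (U : set V) (f : V -> R) : open U ->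
  (forall x, U x -> f x != 0) ->
  class_C k U f -> class_C k U (fun x => (f x)^-1).
Proof.
move=> oU f0; have cV : (forall x, U x -> {for x, continuous f}) ->
    forall x, U x -> {for x, continuous (fun x => (f x)^-1)}.
  by move=> cf x Ux; apply: continuousV; [exact: f0 | exact: cf].
elim: k => [|k IH] [cf Hf]; split=> //; [exact: cV|exact: cV|].
have Cf : class_C k U f by apply: class_CW; split.
case: Hf => df Df; split.
  by move=> x v Ux; apply: (derivableV (f0 x Ux) (df x v Ux)).
move=> v.
apply: (@eq_class_C _ _ _ _
  (fun x => -1 * (((f x)^-1 * (f x)^-1) * 'D_v f x))) => //.
  move=> y Uy; rewrite (deriveV (f0 y Uy) (df y v Uy)) /=.
  by rewrite mulN1r scaleNr -exprVn expr2.
have CV := IH Cf.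
apply: class_CM => //; first exact: class_C_cst.
by apply: (class_CM oU (class_CM oU CV CV)); exact: (Df v).
Qed.

Lemma continuous_mxP (T : topologicalType) m n (f : T -> 'M[R]_(m, n)) x :
  {for x, continuous f} <-> forall i j, {for x, continuous (fun y => f y i j)}.
Proof.
split=> [cf i j|cf].
  apply: (@continuous_comp _ _ _ f (fun M : 'M[R]_(m,n) => M i j)) => //.
  exact: coord_continuous.
apply/cvgrPdist_le => /= e e0; near=> y.
rewrite [leLHS]/Num.Def.normr/= mx_normrE (bigmax_le _ (ltW e0))//= => i _.
rewrite !mxE/=.
move: i; near: y; apply: filter_forall => /= i.
exact: ((cvgrPdist_le _ _).1 (cf i.1 i.2) e e0).
Unshelve. all: by end_near. Qed.

(** Reduces matrix-valued maps to scalar functions, for which products are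
    available. *)
Lemma class_C_mxP V m n k (U : set V) (f : V -> 'M[R]_(m, n)) : open U ->
  class_C k U f <-> forall i j, class_C k U (fun x => f x i j).
Proof.
move=> oU; elim: k f => [|k IH] f.
  split=> [[cf _] i j|H]; split=> // x Ux.
    exact: ((continuous_mxP _ _).1 (cf x Ux) i j).
  apply/(continuous_mxP f) => i j; exact: class_C_continuous (H i j) Ux.
split=> [[cf [df Df]] i j|H].
  split; first by move=> x Ux; exact: ((continuous_mxP _ _).1 (cf x Ux) i j).
  split; first by move=> x v Ux; exact: ((derivable_mxP _ _ _).1 (df x v Ux) i j).
  move=> v; apply: (@eq_class_C _ _ _ _ (fun x => 'D_v f x i j)) => //.
    by move=> y Uy; rewrite (derive_mx (df y v Uy)) mxE.
  exact: ((IH _).1 (Df v) i j).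
have df x v : U x -> derivable f x v.
  move=> Ux; apply/(derivable_mxP f) => i j.
  by case: (H i j) => _ [dfij _]; exact: (dfij x v Ux).
split.
  move=> x Ux; apply/(continuous_mxP f) => i j.
  exact: class_C_continuous (H i j) Ux.
split=> // v; apply/IH => i j.
case: (H i j) => _ [_ /(_ v)]; apply: eq_class_C => // y Uy.
by rewrite (derive_mx (df y v Uy)) mxE.
Qed.

End ClassC.

(** * Mean values along segments and symmetry of second derivatives *)

Section Lines.
Context {R : realType}.
Implicit Types V W : normedModType R.

(** Reduces directional derivatives to derivatives in one real variable. *)
Lemma derive_lineE V W (f : V -> W) x v :
  'D_v f x = 'D_1 (fun h : R => f (h *: v + x)) 0.
Proof.
rewrite /derive; set g1 := fun h => h^-1 *: _; set g2 := fun h => h^-1 *: _.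
suff -> : g1 = g2 by [].
by apply/funext => h; rewrite /g1 /g2 /= addr0 scale0r add0r [_%:A]mulr1.
Qed.

Lemma is_derive_line V W (f : V -> W) y w (c : R) :
  derivable f (y + c *: w) w ->
  is_derive c 1 (fun s : R => f (y + s *: w)) ('D_w f (y + c *: w)).
Proof.
have E : (fun h : R => h^-1 *: (((fun s : R => f (y + s *: w)) \o shift c) (h *: 1)
            - f (y + c *: w))) =
         (fun h : R => h^-1 *: ((f \o shift (y + c *: w)) (h *: w)
            - f (y + c *: w))).
  apply/funext => h /=; congr (_ *: (f _ - _)).
  by rewrite [_%:A]mulr1 scalerDl addrCA.
move=> df; apply: DeriveDef; first by rewrite /derivable E.
by rewrite /derive E.
Qed.

(** The inner map is only derivable in the direction v: the differential chain
    rule is applied to its restriction to the line through x. *)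
Lemma derivable_comp_dir V (W W' : normedModType R) (f : V -> W) (g : W -> W') x v :
  derivable f x v -> differentiable g (f x) ->
  derivable (g \o f) x v /\ 'D_v (g \o f) x = 'd g (f x) ('D_v f x).
Proof.
move=> /derivable1P/derivable1_diffP.
set p := fun h : R => f (h *: v + x) => dp dg.
have p0 : p 0 = f x by rewrite /p scale0r add0r.
have dgp : differentiable g (p 0) by rewrite p0.
have dc : differentiable (g \o p) 0 by exact: differentiable_comp.
split; first by apply/derivable1P; exact: diff_derivable.
rewrite derive_lineE -/(g \o p) (deriveE _ dc) (diff_comp dp dgp) /= p0.
by rewrite [in RHS]derive_lineE (deriveE _ dp).
Qed.

(** Only the derivative along v is at hand, so the rule comes from the chain
    rule for h |-> t h on the line, not from the linearity of a differential. *)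
Lemma deriveZv V W (f : V -> W) x v (t : R) :
  derivable f x v -> derivable f x (t *: v) /\ 'D_(t *: v) f x = t *: 'D_v f x.
Proof.
move=> df; have dp := df; move: dp => /derivable1P/derivable1_diffP.
set p := fun h : R => f (h *: v + x) => dp.
have [] := @derivable_comp_dir R R W (fun h => t * h) p 0 1.
- by apply/derivable1_diffP; apply: differentiableM.
- by rewrite mulr0.
have -> : p \o [eta *%R t] = fun h => f (h *: (t *: v) + x).
  by apply/funext => h; rewrite /p /= scalerA mulrC.
move=> dt dE; split; first exact/derivable1P.
rewrite derive_lineE dE /= mulr0 [in RHS]derive_lineE (deriveE _ dp).
have -> : 'D_1 [eta *%R t] 0 = t *: 1 :> R.
  have /deriveMl-> : derivable (@id R) 0 1 by exact: derivable_id.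
  by rewrite derive_id.
by rewrite linearZ.
Qed.

Lemma MVT_line V (f : V -> R) y w :
  (forall c : R, 0 <= c <= 1 -> derivable f (y + c *: w) w) ->
  exists2 c : R, 0 <= c <= 1 & f (y + w) - f y = 'D_w f (y + c *: w).
Proof.
move=> df.
have H (c : R) : c \in `[0, 1] -> is_derive c 1 (fun s : R => f (y + s *: w))
  ('D_w f (y + c *: w)).
  by move=> /itvP c01; apply: is_derive_line; apply: df; rewrite !c01.
pose F (s : R) : R := f (y + s *: w); pose dF (c : R) : R := 'D_w f (y + c *: w).
have cF : {within `[0, 1], continuous F}.
  by apply: derivable_within_continuous => c cin; have [] := H c cin.
have dF1 (c : R) : c \in `]0, 1[ -> is_derive c 1 F (dF c).
  by move=> cin; apply: H; exact: subset_itv_oo_cc cin.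
have [c /itvP c01 E] := MVT_segment ler01 dF1 cF.
exists c; first by rewrite !c01.
by move: E; rewrite /F /dF scale1r scale0r addr0 subr0 mulr1.
Qed.

End Lines.

Section Schwarz.
Context {R : realType} {V : normedModType R}.

(** Two applications of the mean value theorem: along u to y |-> f (y + v) - f y,
    then along v to 'D_u f. *)
Lemma second_difference (f : V -> R) (U : set V) x u v :
  class_C 2 U f ->
  (forall a b : R, 0 <= a <= 1 -> 0 <= b <= 1 -> U (x + a *: u + b *: v)) ->
  exists a b : R, [/\ 0 <= a <= 1, 0 <= b <= 1 &
   f (x + u + v) - f (x + u) - (f (x + v) - f x) =
   'D_v (fun y => 'D_u f y) (x + a *: u + b *: v)].
Proof.
move=> [_ [df Df]] HU; pose g y := f (y + v) - f y.
have dgu (a b : R) y : 0 <= a <= 1 -> 0 <= b <= 1 -> y = x + a *: u + b *: v ->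
    derivable f y u.
  by move=> a01 b01 ->; apply: df; apply: HU.
have dshift y : derivable f (y + v) u -> is_derive y u (fun z => f (z + v)) ('D_u f (y + v)).
  have E : (fun h : R => h^-1 *: (((fun z => f (z + v)) \o shift y) (h *: u)
            - f (y + v))) =
         (fun h : R => h^-1 *: ((f \o shift (y + v)) (h *: u)
            - f (y + v))).
    by apply/funext => h /=; rewrite addrA.
  by move=> dd; apply: DeriveDef; rewrite /derivable /derive E.
have D0 (a : R) : 0 <= a <= 1 -> is_derive (x + a *: u) u g
    ('D_u f (x + a *: u + v) - 'D_u f (x + a *: u)).
  move=> a01; apply: is_deriveB.
    by apply: dshift; apply: (dgu a 1); rewrite ?scale1r // ler01 lexx.
  by apply: DeriveDef => //; apply: (dgu a 0); rewrite ?scale0r ?addr0 // ler01 lexx.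
have [a a01] := @MVT_line R V g x u (fun c c01 => @ex_derive _ _ _ _ _ _ _ (D0 c c01)).
have [_ ->] := D0 a a01 => E.
have [|b b01 Eb] := @MVT_line R V (fun y => 'D_u f y) (x + a *: u) v.
  move=> b b01; case: (Df u) => _ [d2 _].
  by exact: (d2 _ v (HU a b a01 b01)).
by exists a, b; split=> //; rewrite -Eb -E /g.
Qed.

(** The second difference of f over the parallelogram spanned by h u and h v is
    symmetric in u and v, and by [second_difference] it equals h^2 times a value
    of either mixed derivative at a point close to x. *)
Lemma schwarz (f : V -> R) (U : set V) x u v :
  open U -> class_C 2 U f -> U x ->
  'D_v (fun y => 'D_u f y) x = 'D_u (fun y => 'D_v f y) x.
Proof.
move=> oU Cf Ux; apply/eqP; rewrite -subr_eq0 -normr_le0; apply/ler_addgt0Pr => e e0.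
rewrite add0r.
have [_ [df Df]] := Cf.
have cc w w' : {for x, continuous (fun y => 'D_w' (fun y => 'D_w f y) y)}.
  case: (Df w) => _ [_ /(_ w') D2].
  exact: (D2.1 x Ux).
have e2 : 0 < e / 2 by rewrite divr_gt0.
have tri (A B C : R) : `|A - C| <= e / 2 -> `|B - C| <= e / 2 -> `|A - B| <= e.
  move=> k1 k2; have -> : A - B = (A - C) - (B - C) by ring.
  by apply: le_trans (ler_normB _ _) _; rewrite [e]splitr lerD.
have ncc w w' : \forall y \near x, `|'D_w' (fun y => 'D_w f y) x - 'D_w' (fun y =>
  'D_w f y) y| <= e / 2.
  exact: (@cvgrPdist_le _ _ _ _ _ (fun y => 'D_w' (fun y => 'D_w f y) y) ('D_w' (fun y =>
    'D_w f y) x)).1 (cc w w') _ e2.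
have near_box : \forall h \near (0:R), forall a b : R, 0 <= a <= 1 -> 0 <= b <= 1 ->
   let y := x + a *: (h *: u) + b *: (h *: v) in
   [/\ U y, `|'D_v (fun y => 'D_u f y) x - 'D_v (fun y => 'D_u f y) y| <= e / 2 &
   `|'D_u (fun y => 'D_v f y) x - 'D_u (fun y => 'D_v f y) y| <= e / 2].
  have : \forall y \near x, [/\ U y,
    `|'D_v (fun y => 'D_u f y) x - 'D_v (fun y => 'D_u f y) y| <= e / 2 &
    `|'D_u (fun y => 'D_v f y) x - 'D_u (fun y => 'D_v f y) y| <= e / 2].
    apply: filterS3 (ncc u v) (ncc v u) (open_nbhs_nbhs (conj oU Ux)) => y.
    by split.
  move=> /nbhs_ballP[d /= d0 dP].
  have dd0 : 0 < d / (`|u| + `|v| + 1) by rewrite divr_gt0 // ltr_wpDl // addr_ge0.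
  near=> h => a b /andP[a0 a1] /andP[b0 b1]; apply: dP.
  rewrite -ball_normE /= -addrA opprD addrA subrr add0r normrN.
  apply: le_lt_trans (ler_normD _ _) _; rewrite !normrZ.
  have h1 : `|h| * (`|u| + `|v| + 1) < d.
    rewrite -ltr_pdivlMr; last by rewrite ltr_wpDl // addr_ge0.
    near: h; apply/nbhs_ballP; exists (d / (`|u| + `|v| + 1)) => //= z;
      by rewrite -ball_normE /= sub0r normrN.
  apply: le_lt_trans h1; rewrite (ger0_norm a0) (ger0_norm b0).
  have hu : 0 <= `|h| * `|u| by rewrite mulr_ge0.
  have hv : 0 <= `|h| * `|v| by rewrite mulr_ge0.
  have hh : 0 <= `|h| by [].
  nra.
have [h [h0 Hh]] : exists h : R, h != 0 /\ forall a b : R, 0 <= a <= 1 -> 0 <= b <= 1 ->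
   let y := x + a *: (h *: u) + b *: (h *: v) in
   [/\ U y, `|'D_v (fun y => 'D_u f y) x - 'D_v (fun y => 'D_u f y) y| <= e / 2 &
   `|'D_u (fun y => 'D_v f y) x - 'D_u (fun y => 'D_v f y) y| <= e / 2].
  case/nbhs_ballP: near_box => d /= d0 dP; exists (d / 2); split.
    by rewrite gt_eqF // divr_gt0.
  apply: dP; rewrite -ball_normE /= add0r normrN ger0_norm; last by rewrite divr_ge0 // ltW.
  by rewrite ltr_pdivrMr // ltr_pMr // ltr1n.
have HU (a b : R) : 0 <= a <= 1 -> 0 <= b <= 1 -> U (x + a *: (h *: u) + b *: (h *: v)).
  by move=> a01 b01; have [] := Hh a b a01 b01.
have HU' (a b : R) : 0 <= a <= 1 -> 0 <= b <= 1 -> U (x + a *: (h *: v) + b *: (h *: u)).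
  by move=> a01 b01; rewrite addrAC; apply: HU.
have DD (a b : R) w w' : U (x + a *: (h *: u) + b *: (h *: v)) ->
   'D_(h *: w') (fun y => 'D_(h *: w) f y) (x + a *: (h *: u) + b *: (h *: v)) =
   h * (h * 'D_w' (fun y => 'D_w f y) (x + a *: (h *: u) + b *: (h *: v))).
  set y := x + _ + _ => Uy.
  have d1 : derivable (fun y => 'D_w f y) y w'.
    by case: (Df w) => _ [+ _]; exact.
  have -> : 'D_(h *: w') (fun y => 'D_(h *: w) f y) y =
            'D_(h *: w') (fun y => h *: 'D_w f y) y.
    apply: near_eq_derive; apply: near_open_eq Uy => // z Uz.
    by have [] := deriveZv h (df z w Uz).
  have [d2 E2] := deriveZv h d1.
  by rewrite (deriveZ _ d2) E2.
have [a [b [a01 b01 E]]] := second_difference Cf HU.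
have [a' [b' [a01' b01' E']]] := second_difference Cf HU'.
have {E'}E' : 'D_(h *: u) (fun y => 'D_(h *: v) f y) (x + b' *: (h *: u) + a' *: (h *: v)) =
   'D_(h *: v) (fun y => 'D_(h *: u) f y) (x + a *: (h *: u) + b *: (h *: v)).
  rewrite addrAC -E' -E [x + _ + _]addrAC; ring.
have [Uy k1 _] := Hh _ _ a01 b01; have [Uy' _ k2] := Hh _ _ b01' a01'.
have D1 := DD a b u v Uy; have D2 := DD b' a' v u Uy'.
move: k1 k2; rewrite /=.
have {E' D1 D2} <- := mulfI h0 (mulfI h0 (etrans (esym D2) (etrans E' D1))).
exact: (tri).
Unshelve. all: by end_near. Qed.

End Schwarz.

(** * Differentiability of C^1 functions *)

Section C1Differentiable.
Context {R : realType} {n : nat}.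

Lemma norm_coord (h : 'rV[R]_n) i : `|h 0 i| <= `|h|.
Proof.
by rewrite [leRHS]/Num.Def.normr/= mx_normrE (le_bigmax _ _ (0, i)).
Qed.

Lemma rV_norm_le (h : 'rV[R]_n) (e : R) : 0 <= e ->
  (forall i, `|h 0 i| <= e) -> `|h| <= e.
Proof.
move=> e0 H; rewrite [leLHS]/Num.Def.normr/= mx_normrE (bigmax_le _ e0)//=.
by move=> [i j] _ /=; rewrite ord1.
Qed.

(** The candidate for the differential of f at x. *)
Definition partial_sum_form (f : 'rV[R]_n -> R) (x h : 'rV[R]_n) : R :=
  \sum_i h 0 i * 'D_(delta_mx 0 i) f x.

Lemma partial_sum_form_is_linear f x : linear (partial_sum_form f x).
Proof.
move=> t u v; rewrite /partial_sum_form scaler_sumr -big_split /=.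
by apply: eq_bigr => i _; rewrite !mxE mulrDl -mulrA.
Qed.

HB.instance Definition _ f x :=
  GRing.isLinear.Build R 'rV[R]_n R *:%R (partial_sum_form f x)
    (partial_sum_form_is_linear f x).

Lemma partial_sum_form_continuous f x : continuous (partial_sum_form f x).
Proof.
move=> y; rewrite /partial_sum_form.
have -> : (fun h : 'rV[R]_n => \sum_i h 0 i * 'D_(delta_mx 0 i) f x) =
    \sum_i (fun h : 'rV[R]_n => h 0 i * 'D_(delta_mx 0 i) f x).
  by apply/funext => h; rewrite fct_sumE.
apply: (big_ind (fun g : 'rV[R]_n -> R => {for y, continuous g})).
- exact: (@cst_continuous _ R 0 y).
- by move=> g g' cg cg'; apply: continuousD.
- move=> i _; apply: continuousM; [exact: coord_continuous|exact: (@cst_continuous _ R _ y)].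
Qed.

(** The way from x to x + h is walked one coordinate at a time. The mean value
    theorem turns each step into a partial derivative at a nearby point, which
    differs by at most e from the one at x. *)
Lemma C1_estimate (f : 'rV[R]_n -> R) U x (e : R) :
  open U -> class_C 1 U f -> U x -> 0 < e ->
  \forall h \near (0 : 'rV[R]_n),
    `|f (x + h) - f x - partial_sum_form f x h| <= n%:R * (e * `|h|).
Proof.
move=> oU [_ [df Df]] Ux e0.
have : \forall y \near x, U y /\ forall i,
    `|'D_(delta_mx 0 i) f x - 'D_(delta_mx 0 i) f y| <= e.
  near=> y; split; first by near: y; apply: open_nbhs_nbhs.
  near: y; apply: filter_forall => i.
  by apply: (cvgrPdist_le _ _).1 ((Df (delta_mx 0 i)).1 x Ux) _ e0.
move=> /nbhs_ballP[d /= d0 dP]; near=> h.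
have hd : `|h| < d.
  by near: h; apply/nbhs_ballP; exists d => //= z; rewrite -ball_normE /= sub0r normrN.
pose tr (j : nat) : 'rV[R]_n := \row_i (if (i < j)%N then h 0 i else 0).
have trS (j : 'I_n) : tr j.+1 = tr j + h 0 j *: delta_mx 0 j.
  apply/rowP => i; rewrite !mxE ltnS leq_eqVlt eqxx /=.
  have [->|ij] := eqVneq i j; first by rewrite eqxx ltnn /= mulr1 add0r.
  by rewrite val_eqE (negbTE ij) /= mulr0 addr0.
have trn : tr n = h by apply/rowP => i; rewrite !mxE ltn_ord.
have tr0 : tr 0%N = 0 by apply/rowP => i; rewrite !mxE.
have step (j : 'I_n) :
    `|f (x + tr j.+1) - f (x + tr j) - h 0 j * 'D_(delta_mx 0 j) f x| <= e * `|h|.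
  have inb (c : R) : 0 <= c <= 1 -> ball x d (x + tr j + c *: (h 0 j *: delta_mx 0 j)).
    move=> /andP[c0 c1]; rewrite -ball_normE /= -addrA opprD addrA subrr add0r normrN.
    apply: le_lt_trans hd; apply: rV_norm_le => // i; rewrite !mxE eqxx /=.
    have [->|ij] := eqVneq i j.
      rewrite ltnn add0r mulr1 normrM ger0_norm //.
      by apply: le_trans (norm_coord h j); rewrite ler_piMl.
    rewrite mulr0 mulr0 addr0; case: ifP => _; first exact: norm_coord.
    by rewrite normr0.
  have dl c : 0 <= c <= 1 -> derivable f (x + tr j + c *: (h 0 j *: delta_mx 0 j))
      (h 0 j *: delta_mx 0 j).
    by move=> /inb/dP[Uc _]; exact: df.
  have [c c01 Ec] := MVT_line dl.
  have [Uc /(_ j) dc] := dP _ (inb c c01).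
  rewrite trS addrA Ec.
  have [_ ->] := deriveZv (h 0 j) (df _ (delta_mx 0 j) Uc).
  rewrite -mulrBr normrM mulrC ler_pM // ?norm_coord //.
  by rewrite distrC.
have -> : f (x + h) - f x - partial_sum_form f x h =
    \sum_(j < n) (f (x + tr j.+1) - f (x + tr j) - h 0 j * 'D_(delta_mx 0 j) f x).
  rewrite sumrB; congr (_ - _).
  have := @telescope_sumr R 0 n (fun j => f (x + tr j)) (leq0n n).
  by rewrite big_mkord => ->; rewrite trn tr0 addr0.
apply: le_trans (ler_norm_sum _ _ _) _.
rewrite [leRHS](_ : _ = \sum_(j < n) (e * `|h|)); last first.
  by rewrite sumr_const card_ord mulr_natl.
by apply: ler_sum => j _; exact: step.
Unshelve. all: by end_near. Qed.

(** Makes differentials, hence the chain rule and Jacobians, available for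
    functions whose smoothness is given by directional derivatives. *)
Lemma C1_differentiable (f : 'rV[R]_n -> R) U x :
  open U -> class_C 1 U f -> U x ->
  differentiable f x /\ forall v, 'D_v f x = \sum_i v 0 i * 'D_(delta_mx 0 i) f x.
Proof.
move=> oU Cf Ux.
have E : f \o shift x = cst (f x) + partial_sum_form f x +o_ 0 id.
  apply/eqaddoP => e e0.
  have e1 : 0 < e / n.+1%:R by rewrite divr_gt0.
  apply: filterS (C1_estimate oU Cf Ux e1) => h.
  have -> : (f \o shift x - (cst (f x) + partial_sum_form f x)) h =
     f (x + h) - f x - partial_sum_form f x h.
    by rewrite !fctE /= [h + x]addrC opprD addrA.
  move=> /le_trans; apply; rewrite mulrA ler_wpM2r // mulrCA ger_pMr //.
  by rewrite ler_pdivrMr // mul1r ler_nat.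
have D := diff_unique (@partial_sum_form_continuous f x) E.
have df : differentiable f x.
  apply/diff_locallyP; rewrite D; split=> //.
  exact: partial_sum_form_continuous.
by split=> // v; rewrite (deriveE _ df) D.
Qed.

End C1Differentiable.

(** * The chain rule and smooth matrix-valued maps *)

Section Composition.
Context {R : realType}.
Implicit Types V W : normedModType R.

(** A directional derivative of g o f is the sum over j of (D_v f)_j times
    (D_j g) o f, and the induction hypothesis applies to D_j g. *)
Lemma class_C_comp V m k (U : set V) (U' : set 'rV[R]_m) (f : V -> 'rV[R]_m)
    (g : 'rV[R]_m -> R) : open U -> open U' -> (forall x, U x -> U' (f x)) ->
  class_C k U f -> class_C k U' g -> class_C k U (fun x => g (f x)).
Proof.
move=> oU oU' fU; elim: k f g fU => [|k IH] f g fU Cf Cg.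
  split=> // x Ux; apply: continuous_comp; first exact: class_C_continuous Cf Ux.
  exact: class_C_continuous Cg (fU x Ux).
have Cg1 : class_C 1 U' g by apply: class_C_le Cg.
have D x v : U x -> derivable (g \o f) x v /\ 'D_v (g \o f) x =
    \sum_j 'D_v f x 0 j * 'D_(delta_mx 0 j) g (f x).
  move=> Ux; have [_ [df _]] := Cf.
  have [dg Dg] := C1_differentiable oU' Cg1 (fU x Ux).
  have [dgf Dgf] := derivable_comp_dir (df x v Ux) dg.
  by split=> //; rewrite Dgf -(deriveE _ dg) Dg.
split.
  move=> x Ux; apply: continuous_comp; first exact: class_C_continuous Cf Ux.
  exact: class_C_continuous Cg (fU x Ux).
split; first by move=> x v Ux; have [] := D x v Ux.
move=> v; apply: (@eq_class_C _ _ _ _ _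
  (fun x => \sum_j 'D_v f x 0 j * 'D_(delta_mx 0 j) g (f x))) => //.
  by move=> x Ux; have [] := D x v Ux.
apply: class_C_sum => // j _; apply: class_CM => //.
  have [_ [_ Df]] := Cf.
  exact: ((class_C_mxP k _ oU).1 (Df v) 0 j).
have [_ [_ Dg]] := Cg.
exact: (IH _ _ fU (class_CW Cf) (Dg (delta_mx 0 j))).
Qed.

(** The analogue of [class_C_comp] for an inner function with values in R, which
    is not literally a space of row vectors. *)
Lemma class_C_comp1 V k (U : set V) (f : V -> R)
    (g : R -> R) : open U ->
  class_C k U f -> class_C k setT g -> class_C k U (fun x => g (f x)).
Proof.
move=> oU; elim: k f g => [|k IH] f g Cf Cg.
  split=> // x Ux; apply: continuous_comp; first exact: class_C_continuous Cf Ux.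
  by apply: class_C_continuous Cg _.
have [cg [dg Dg]] := Cg; have [cf [df Df]] := Cf.
have D x v : U x -> derivable (g \o f) x v /\ 'D_v (g \o f) x =
    'D_v f x * 'D_1 g (f x).
  move=> Ux; have dg1 : differentiable g (f x) by apply/derivable1_diffP; exact: dg.
  have [dgf Dgf] := derivable_comp_dir (df x v Ux) dg1.
  split=> //; rewrite Dgf -(deriveE _ dg1).
  have [_] := deriveZv ('D_v f x) (dg (f x) 1 I).
  by rewrite [_ *: 1]mulr1.
split; first by move=> x Ux; apply: continuous_comp; [exact: cf|exact: cg].
split; first by move=> x v Ux; have [] := D x v Ux.
move=> v; apply: (@eq_class_C _ _ _ _ _
  (fun x => 'D_v f x * 'D_1 g (f x))) => //.
  by move=> x Ux; have [] := D x v Ux.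
apply: class_CM => //; first exact: (Df v).
exact: (IH _ _ (class_CW Cf) (Dg 1)).
Qed.

Lemma class_C_id V k (U : set V) : class_C k U (fun x => x).
Proof.
case: k => [|k]; split=> //.
- by move=> x _; exact: cvg_id.
- by move=> x _; exact: cvg_id.
split=> [x v _|v]; first exact: derivable_id.
suff -> : (fun x => 'D_v (fun x => x) x) = fun=> v :> V by exact: class_C_cst.
by apply/funext => x; exact: derive_id.
Qed.

End Composition.

Section SmoothOn.
Context {R : realType}.
Implicit Types V W : normedModType R.

Lemma smooth_cover V W (U : set V) (f : V -> W) :
  (forall x, U x -> exists2 U' : set V, U' x & smooth_on U' f) ->
  smooth_on U f.
Proof.
move=> H k; apply: class_C_cover => x /H[U' U'x Hf]; exists U' => //.
Qed.

Lemma smooth_set0 V W (f : V -> W) : smooth_on set0 f.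
Proof. by apply: smooth_cover. Qed.

Lemma smooth_sub V W (U U' : set V) (f : V -> W) :
  U `<=` U' -> smooth_on U' f -> smooth_on U f.
Proof. by move=> s H k; exact: class_C_sub s (H k). Qed.

Lemma eq_smooth V W (U : set V) (f g : V -> W) :
  open U -> (forall y, U y -> f y = g y) -> smooth_on U f -> smooth_on U g.
Proof. by move=> oU fg H k; exact: eq_class_C (H k). Qed.

Lemma smooth_cst V W (U : set V) (c : W) : smooth_on U (fun=> c).
Proof. by move=> k; exact: class_C_cst. Qed.

Lemma smooth_id V (U : set V) : smooth_on U (fun x => x).
Proof. by move=> k; exact: class_C_id. Qed.

Lemma smoothD V W (U : set V) (f g : V -> W) : open U ->
  smooth_on U f -> smooth_on U g -> smooth_on U (fun x => f x + g x).
Proof. by move=> oU Hf Hg k; exact: class_CD. Qed.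

Lemma smoothM V (U : set V) (f g : V -> R) : open U ->
  smooth_on U f -> smooth_on U g -> smooth_on U (fun x => f x * g x).
Proof. by move=> oU Hf Hg k; exact: class_CM. Qed.

Lemma smooth_sum V W (U : set V) I (r : seq I) (P : pred I)
    (F : I -> V -> W) : open U -> (forall i, P i -> smooth_on U (F i)) ->
  smooth_on U (fun x => \sum_(i <- r | P i) F i x).
Proof. by move=> oU H k; apply: class_C_sum => // i Pi; exact: H. Qed.

Lemma smooth_prod V (U : set V) I (r : seq I) (P : pred I)
    (F : I -> V -> R) : open U -> (forall i, P i -> smooth_on U (F i)) ->
  smooth_on U (fun x => \prod_(i <- r | P i) F i x).
Proof. by move=> oU H k; apply: class_C_prod => // i Pi; exact: H. Qed.

Lemma smoothV V (U : set V) (f : V -> R) : open U ->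
  (forall x, U x -> f x != 0) ->
  smooth_on U f -> smooth_on U (fun x => (f x)^-1).
Proof. by move=> oU f0 H k; exact: class_CV. Qed.

Lemma smooth_mxP V m n (U : set V) (f : V -> 'M[R]_(m, n)) : open U ->
  smooth_on U f <-> forall i j, smooth_on U (fun x => f x i j).
Proof.
move=> oU; split=> [H i j k|H k]; first exact: ((class_C_mxP k f oU).1 (H k)).
by apply/(class_C_mxP k f oU) => i j; exact: H.
Qed.

Lemma smooth_derive V W (U : set V) (f : V -> W) v :
  smooth_on U f -> smooth_on U (fun x => 'D_v f x).
Proof. by move=> H k; have [_ [_ /(_ v)]] := H k.+1. Qed.

Lemma smooth_continuous V W (U : set V) (f : V -> W) x :
  smooth_on U f -> U x -> {for x, continuous f}.
Proof. by move=> /(_ 0%N)[+ _]; exact. Qed.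

Lemma smooth_derivable V W (U : set V) (f : V -> W) x v :
  smooth_on U f -> U x -> derivable f x v.
Proof. by move=> /(_ 1%N)[_ [H _]] Ux; exact: (H x v Ux). Qed.

Lemma smooth_comp V m p q (U : set V) (U' : set 'rV[R]_m) (f : V -> 'rV[R]_m)
    (g : 'rV[R]_m -> 'M[R]_(p, q)) :
  open U -> open U' -> (forall x, U x -> U' (f x)) ->
  smooth_on U f -> smooth_on U' g -> smooth_on U (fun x => g (f x)).
Proof.
move=> oU oU' fU Hf /(smooth_mxP _ oU') Hg.
apply/(smooth_mxP _ oU) => i j k.
exact: (class_C_comp oU oU' fU (Hf k) (Hg i j k)).
Qed.

Lemma smooth_comp_scalar V m (U : set V) (U' : set 'rV[R]_m) (f : V -> 'rV[R]_m)
    (g : 'rV[R]_m -> R) :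
  open U -> open U' -> (forall x, U x -> U' (f x)) ->
  smooth_on U f -> smooth_on U' g -> smooth_on U (fun x => g (f x)).
Proof.
by move=> oU oU' fU Hf Hg k; exact: (class_C_comp oU oU' fU (Hf k) (Hg k)).
Qed.

Lemma smooth_mulmx V m n p (U : set V) (A : V -> 'M[R]_(m, n))
    (B : V -> 'M[R]_(n, p)) : open U ->
  smooth_on U A -> smooth_on U B -> smooth_on U (fun x => A x *m B x).
Proof.
move=> oU /(smooth_mxP _ oU) HA /(smooth_mxP _ oU) HB.
apply/(smooth_mxP _ oU) => i j.
apply: (@eq_smooth _ _ _ (fun x => \sum_k A x i k * B x k j)) => //.
  by move=> x _; rewrite mxE.
by apply: smooth_sum => // k _; apply: smoothM.
Qed.

Lemma smooth_scalemx V m n (U : set V) (a : V -> R) (B : V -> 'M[R]_(m, n)) :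
  open U -> smooth_on U a -> smooth_on U B -> smooth_on U (fun x => a x *: B x).
Proof.
move=> oU Ha /(smooth_mxP _ oU) HB; apply/(smooth_mxP _ oU) => i j.
apply: (@eq_smooth _ _ _ (fun x => a x * B x i j)) => //.
  by move=> x _; rewrite mxE.
exact: smoothM.
Qed.

Lemma smooth_row_mx V m n p (U : set V) (A : V -> 'M[R]_(m, n))
    (B : V -> 'M[R]_(m, p)) : open U ->
  smooth_on U A -> smooth_on U B -> smooth_on U (fun x => row_mx (A x) (B x)).
Proof.
move=> oU /(smooth_mxP _ oU) HA /(smooth_mxP _ oU) HB.
apply/(smooth_mxP _ oU) => i j; case: (split_ordP j) => k ->.
  by apply: eq_smooth (HA i k) => // x _; rewrite row_mxEl.
by apply: eq_smooth (HB i k) => // x _; rewrite row_mxEr.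
Qed.

Lemma smooth_tr V m n (U : set V) (A : V -> 'M[R]_(m, n)) : open U ->
  smooth_on U A -> smooth_on U (fun x => (A x)^T).
Proof.
move=> oU /(smooth_mxP _ oU) HA; apply/(smooth_mxP _ oU) => i j.
by apply: eq_smooth (HA j i) => // x _; rewrite mxE.
Qed.

Lemma smooth_lsubmx V m n p (U : set V) (A : V -> 'M[R]_(m, n + p)) : open U ->
  smooth_on U A -> smooth_on U (fun x => lsubmx (A x)).
Proof.
move=> oU /(smooth_mxP _ oU) HA; apply/(smooth_mxP _ oU) => i j.
by apply: eq_smooth (HA i (lshift p j)) => // x _; rewrite mxE.
Qed.

Lemma smooth_rsubmx V m n p (U : set V) (A : V -> 'M[R]_(m, n + p)) : open U ->
  smooth_on U A -> smooth_on U (fun x => rsubmx (A x)).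
Proof.
move=> oU /(smooth_mxP _ oU) HA; apply/(smooth_mxP _ oU) => i j.
by apply: eq_smooth (HA i (rshift n j)) => // x _; rewrite mxE.
Qed.

Lemma smooth_det V n (U : set V) (A : V -> 'M[R]_n) : open U ->
  smooth_on U A -> smooth_on U (fun x => \det (A x)).
Proof.
move=> oU /(smooth_mxP _ oU) HA; apply: smooth_sum => // s _.
apply: smoothM => //; first exact: smooth_cst.
by apply: smooth_prod => // i _.
Qed.

(** By Cramer's rule the inverse is a rational expression of the entries. *)
Lemma smooth_invmx V n (U : set V) (A : V -> 'M[R]_n) : open U ->
  (forall x, U x -> A x \in unitmx) ->
  smooth_on U A -> smooth_on U (fun x => invmx (A x)).
Proof.
move=> oU uA HA.
apply: (@eq_smooth _ _ _ (fun x => (\det (A x))^-1 *: \adj (A x))) => //.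
  by move=> x /uA ux; rewrite /invmx ux.
apply: smooth_scalemx => //.
  apply: smoothV => //; last exact: smooth_det.
  by move=> x /uA; rewrite unitmxE unitfE.
apply/(smooth_mxP _ oU) => i j.
apply: (@eq_smooth _ _ _ (fun x => (-1) ^+ (j + i) * \det (row' j (col' i (A x))))) => //.
  by move=> x _; rewrite mxE.
apply: smoothM => //; first exact: smooth_cst.
apply: smooth_det => //; apply/(smooth_mxP _ oU) => a b.
apply: eq_smooth (((smooth_mxP _ oU).1 HA) (lift j a) (lift i b)) => // x _.
by rewrite !mxE.
Qed.

Lemma open_neq0 (T : topologicalType) (U : set T) (f : T -> R) : open U ->
  (forall x, U x -> {for x, continuous f}) -> open (U `&` [set x | f x != 0]).
Proof.
move=> oU cf; rewrite openE => x [Ux /= fx]; change (nbhs x (U `&` [set x | f x != 0])).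
apply: filterI; first exact: open_nbhs_nbhs.
apply: (cf x Ux [set y | y != 0]); exact: open_nbhs_nbhs.
Qed.

Lemma smooth_differentiable n m (U : set 'rV[R]_n) (f : 'rV[R]_n -> 'rV[R]_m) x :
  open U -> smooth_on U f -> U x -> differentiable f x.
Proof.
move=> oU /(smooth_mxP _ oU) Hf Ux.
have -> : f = \sum_j (fun y => f y 0 j *: delta_mx 0 j).
  apply/funext => y; rewrite fct_sumE [LHS]row_sum_delta.
  by [].
apply: differentiable_sum => j; apply: differentiableZl.
by have [] := C1_differentiable oU (Hf 0 j 1%N) Ux.
Qed.

Lemma jacobianE n m (f : 'rV[R]_n -> 'rV[R]_m) x v : 'd f x v = v *m 'J f x.
Proof. by rewrite /jacobian mul_rV_lin1. Qed.

Lemma smooth_jacobian n m (U : set 'rV[R]_n) (f : 'rV[R]_n -> 'rV[R]_m) :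
  open U -> smooth_on U f -> smooth_on U (fun x => 'J f x).
Proof.
move=> oU Hf; apply/(smooth_mxP _ oU) => i j.
apply: (@eq_smooth _ _ _ (fun x => 'D_(delta_mx 0 i) f x 0 j)) => //.
  move=> x Ux; rewrite (deriveE _ (smooth_differentiable oU Hf Ux)) jacobianE.
  by rewrite -rowE mxE.
exact: ((smooth_mxP _ oU).1 (smooth_derive (delta_mx 0 i) Hf) 0 j).
Qed.

Lemma jacobian_comp n m p (f : 'rV[R]_n -> 'rV[R]_m) (g : 'rV[R]_m -> 'rV[R]_p) x :
  differentiable f x -> differentiable g (f x) ->
  'J (g \o f) x = 'J f x *m 'J g (f x).
Proof.
move=> df dg; apply/row_matrixP => i.
by rewrite !rowE mulmxA -(jacobianE f) -(jacobianE g) -(jacobianE (g \o f)) diff_comp.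
Qed.

Lemma near_eq_jacobian n m (U : set 'rV[R]_n) (f g : 'rV[R]_n -> 'rV[R]_m) x :
  open U -> smooth_on U f -> (forall y, U y -> f y = g y) -> U x ->
  'J f x = 'J g x.
Proof.
move=> oU Hf fg Ux; have Hg := eq_smooth oU fg Hf.
have d v : 'd f x v = 'd g x v.
  rewrite -[LHS](deriveE _ (smooth_differentiable oU Hf Ux)).
  rewrite -[RHS](deriveE _ (smooth_differentiable oU Hg Ux)).
  by apply: near_eq_derive; exact: near_open_eq Ux.
apply/matrixP => i j.
transitivity (('d f x (delta_mx 0 i)) 0 j).
  by rewrite [LHS]mxE.
rewrite (d (delta_mx 0 i)).
by rewrite [RHS]mxE.
Qed.

Lemma jacobian_id n (x : 'rV[R]_n) : 'J (fun y => y) x = 1%:M.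
Proof.
apply/row_matrixP => i; rewrite !rowE -(jacobianE (fun y => y)) mulmx1.
by rewrite (@diff_val _ _ _ _ _ _ _ (is_diff_id _)).
Qed.

End SmoothOn.

(** * Smooth bump functions *)

Section Bump.
Context {R : realType}.
Implicit Types (p : {poly R}) (x t : R).

(** Raise t / (i + 1) <= exp (t / (i + 1)) to the power i + 1. *)
Lemma exprn_expRN_le i t : 0 < t -> t ^+ i * expR (- t) <= i.+1%:R ^+ i.+1 / t.
Proof.
move=> t0; have m0 : 0 < i.+1%:R :> R by [].
have H : (t / i.+1%:R) ^+ i.+1 <= expR t.
  have -> : expR t = expR (t / i.+1%:R) ^+ i.+1.
    by rewrite -expRM_natl mulrC divfK // gt_eqF.
  have h : t / i.+1%:R <= expR (t / i.+1%:R).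
    by apply: le_trans (expR_ge1Dx _); rewrite lerDr.
  by apply: lerXn2r => //; rewrite nnegrE ?expR_ge0 // divr_ge0 // ltW.
rewrite expRN ler_pdivlMr // mulrAC ler_pdivrMr ?expR_gt0 // -exprSr.
rewrite exprMn exprVn ler_pdivrMr ?exprn_gt0 // in H.
by rewrite mulrC.
Qed.

Lemma horner_expRN_le p : exists2 C, 0 <= C &
  forall t, 0 < t -> `|p.[t] * expR (- t)| <= C / t.
Proof.
exists (\sum_(i < size p) `|p`_i| * i.+1%:R ^+ i.+1).
  by apply: sumr_ge0 => i _; rewrite mulr_ge0 // exprn_ge0.
move=> t t0; rewrite horner_coef mulr_suml mulr_suml.
apply: le_trans (ler_norm_sum _ _ _) _; apply: ler_sum => i _.
rewrite -mulrA normrM -mulrA ler_wpM2l // ger0_norm ?exprn_expRN_le //.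
by rewrite mulr_ge0 ?exprn_ge0 ?expR_ge0 // ltW.
Qed.

(** The functions p (1 / x) exp (- 1 / x), extended by 0 to x <= 0. Allowing a
    polynomial p makes the family closed under derivation, so that smoothness
    follows by induction. *)
Definition flat p x : R := if 0 < x then p.[x^-1] * expR (- x^-1) else 0.

Lemma flat_le p : exists2 C, 0 <= C & forall x, `|flat p x| <= C * `|x|.
Proof.
have [C C0 H] := horner_expRN_le p; exists C => // x; rewrite /flat.
case: ltrP => x0; last by rewrite normr0 mulr_ge0.
by have := H x^-1; rewrite invrK invr_gt0 (gtr0_norm x0); apply.
Qed.

Lemma flat_cvg0 p : flat p x @[x --> 0] --> 0.
Proof.
have [C C0 H] := flat_le p; apply/cvgrPdist_le => e e0.
have C1 : 0 < C + 1 by rewrite ltr_wpDl.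
apply/nbhs_ballP; exists (e / (C + 1)); rewrite /= ?divr_gt0 // => x.
rewrite /ball_ /= !sub0r !normrN ltr_pdivlMr // => xe.
apply: le_trans (H x) _; apply: le_trans (ltW xe).
by rewrite mulrC ler_wpM2l // lerDl.
Qed.

Definition flat_next p : {poly R} := 'X^2 * (p - p^`()).

(** At 0 the difference quotient of [flat p] is [flat ('X * p)], which tends to
    0 because the exponential beats every power. *)
Lemma is_derive_flat p x : is_derive x 1 (flat p) (flat (flat_next p) x).
Proof.
have [x0|x0|->] := ltrgtP x 0.
- rewrite [X in is_derive _ _ _ X](_ : _ = 0); last by rewrite /flat ltNge (ltW x0).
  have dc := is_derive_cst (0 : R) x (1 : R); apply: near_eq_is_derive dc.
  near=> y; rewrite /flat (_ : (0 < y) = false) //; apply/negbTE; rewrite -leNgt ltW //.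
  by near: y; apply: open_nbhs_nbhs; split; [exact: open_lt|].
- have E : {near x, (fun y => p.[y^-1] * expR (- y^-1)) =1 flat p}.
    near=> y; rewrite /flat (_ : (0 < y) = true) //.
    by near: y; apply: open_nbhs_nbhs; split; [exact: open_gt|].
  apply: near_eq_is_derive E _.
  have xn0 : x != 0 by rewrite gt_eqF.
  have dV : is_derive x 1 (fun y : R => y^-1) (- x ^- 2).
    apply: DeriveDef; first exact: derivableV.
    by rewrite deriveV // derive_id; rewrite [_ *: 1]mulr1.
  have dp (y : R) : is_derive y 1 (fun y => p.[y]) p^`().[y].
    apply: DeriveDef; first exact: derivable_horner.
    by rewrite -derive1E -derivE.
  have d1 : is_derive x 1 (fun y : R => p.[y^-1]) (p^`().[x^-1] * - x ^- 2).
    by apply: (@is_derive1_comp _ (fun y => p.[y]) (fun y : R => y^-1)).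
  have d2 : is_derive x 1 (fun y : R => expR (- y^-1)) (expR (- x^-1) * x ^- 2).
    have dN : is_derive x 1 (fun y : R => - y^-1) (x ^- 2).
      by rewrite -[X in is_derive _ _ _ X]opprK; apply: is_deriveN.
    by apply: (@is_derive1_comp _ expR (fun y : R => - y^-1)).
  have -> : flat (flat_next p) x = p.[x^-1] *: (expR (- x^-1) * x ^- 2) +
      expR (- x^-1) *: (p^`().[x^-1] * - x ^- 2).
    rewrite /flat x0 /flat_next !hornerE /= /GRing.scale /= exprVn; ring.
  exact: (is_deriveM d1 d2).
- rewrite [X in is_derive _ _ _ X](_ : _ = 0); last by rewrite /flat ltxx.
  have f00 : flat p 0 = 0 by rewrite /flat ltxx.
  have L : h^-1 *: ((flat p \o shift 0) (h *: 1) - flat p 0) @[h --> 0^'] --> (0:R).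
    have C : flat ('X * p) h @[h --> (0:R)^'] --> (0:R).
      exact: cvg_within_filter (flat_cvg0 _).
    apply: cvg_trans C; apply: near_eq_cvg; near=> h.
    rewrite /= addr0 [_ *: 1]mulr1 f00 subr0 /flat /GRing.scale /=.
    case: ifP => _; rewrite ?mulr0 // hornerM hornerX.
    by rewrite -mulrA.
  by apply: DeriveDef; [apply/cvg_ex; exists 0 | exact: cvg_lim L].
Unshelve. all: by end_near. Qed.

Lemma smooth_flat p : smooth_on setT (flat p).
Proof.
move=> k; elim: k p => [|k IH] p.
  split=> // x _; apply: differentiable_continuous; apply/derivable1_diffP.
  by have [] := is_derive_flat p x.
split.
  move=> x _; apply: differentiable_continuous; apply/derivable1_diffP.
  by have [] := is_derive_flat p x.
have D x v : derivable (flat p) x v /\ 'D_v (flat p) x = v * flat (flat_next p) x.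
  have [d1 D1] := is_derive_flat p x.
  have [d2 D2] := deriveZv v d1; move: d2 D2.
  by rewrite [v *: 1]mulr1 D1.
split; first by move=> x v _; have [] := D x v.
move=> v; apply: (@eq_class_C _ _ _ _ _ (fun x => v * flat (flat_next p) x)).
- exact: openT.
- by move=> x _; have [_ ->] := D x v.
- by apply: class_CM; [exact: openT|exact: class_C_cst|exact: IH].
Qed.

(** The denominator is positive since x and 1 - x are not both nonpositive. *)
Definition smooth_step x : R := flat 1 x / (flat 1 x + flat 1 (1 - x)).

Lemma flat1_gt0 x : 0 < x -> 0 < flat 1 x.
Proof. by move=> x0; rewrite /flat x0 hornerE mul1r expR_gt0. Qed.

Lemma flat1_ge0 x : 0 <= flat 1 x.
Proof. by rewrite /flat; case: ifP => // _; rewrite hornerE mul1r expR_ge0. Qed.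

Lemma smooth_smooth_step : smooth_on setT smooth_step.
Proof.
have f1 : smooth_on setT (fun x => flat 1 (1 - x)).
  move=> k; apply: (@class_C_comp1 _ _ _ _ (fun x => 1 - x));
    [exact: openT| |exact: smooth_flat].
  apply: (@eq_class_C _ _ _ _ _ (fun x => 1 + -1 * x)); first exact: openT.
    by move=> y _; rewrite mulN1r.
  apply: class_CD; [exact: openT|exact: class_C_cst|].
  by apply: class_CM; [exact: openT|exact: class_C_cst|exact: class_C_id].
apply: smoothM; [exact: openT|exact: smooth_flat|].
apply: smoothV; [exact: openT| |apply: smoothD => //; [exact: openT|exact: smooth_flat]].
move=> x _; rewrite gt_eqF //; have [x0|x0] := ltrP 0 x.
  by rewrite ltr_pwDl ?flat1_gt0 ?flat1_ge0.
by rewrite ltr_wpDl ?flat1_ge0 // flat1_gt0 // subr_gt0 (le_lt_trans x0).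
Qed.

Lemma smooth_step0 x : x <= 0 -> smooth_step x = 0.
Proof. by move=> x0; rewrite /smooth_step {1}/flat ltNge x0 mul0r. Qed.

Lemma smooth_step1 x : 1 <= x -> smooth_step x = 1.
Proof.
move=> x1; rewrite /smooth_step [X in _ + X]/flat subr_gt0 ltNge x1 addr0 divff //.
by rewrite gt_eqF // flat1_gt0 // (lt_le_trans ltr01).
Qed.

(** The product over the coordinates suits the norm of row vectors, which is the
    maximum of the coordinates; the one-variable bumps are functions of the
    squares because the absolute value is not smooth. *)
Lemma bump_exists n (c : 'rV[R]_n) (e : R) : 0 < e ->
  exists chi : 'rV[R]_n -> R, [/\ smooth_on setT chi,
    forall x : 'rV[R]_n, `|x - c| <= e / 2 -> chi x = 1 &
    forall x : 'rV[R]_n, e <= `|x - c| -> chi x = 0].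
Proof.
(* The argument of [smooth_step] is 1 at |t| = e / 2 and 0 at |t| = e. *)
move=> e0; pose b (t : R) := smooth_step ((e ^+ 2 - t * t) * (4 / 3 / e ^+ 2)).
have e20 : 0 < e ^+ 2 by rewrite exprn_gt0.
have b1 t : `|t| <= e / 2 -> b t = 1.
  move=> te; apply: smooth_step1; rewrite mulrA ler_pdivlMr // mul1r.
  have : `|t| * `|t| <= (e / 2) * (e / 2) by rewrite ler_pM.
  by rewrite -normrM ger0_norm -?expr2 ?sqr_ge0 //; lra.
have b0 t : e <= `|t| -> b t = 0.
  move=> te; apply: smooth_step0; apply: mulr_le0_ge0; last first.
    by rewrite !divr_ge0 // ltW.
  rewrite subr_le0 -expr2 -[t ^+ 2]real_normK ?num_real //.
  by apply: lerXn2r; rewrite // ?nnegrE // ltW.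
exists (fun x : 'rV[R]_n => \prod_i b (x 0 i - c 0 i)); split.
- apply: smooth_prod; [exact: openT|move=> i _ k].
  apply: (@class_C_comp1 _ _ _ _ (fun x : 'rV[R]_n => (e ^+ 2 - (x 0 i - c 0 i)
    * (x 0 i - c 0 i)) * (4 / 3 / e ^+ 2)));
    [exact: openT| |exact: smooth_smooth_step].
  have Cc : class_C k [set: 'rV[R]_n] (fun x : 'rV[R]_n => x 0 i - c 0 i).
    apply: class_CD; [exact: openT| |exact: class_C_cst].
    by apply: (class_C_mxP _ _ _).1 (class_C_id _ _) 0 i; exact: openT.
  apply: class_CM; [exact: openT| |exact: class_C_cst].
  apply: (@eq_class_C _ _ _ _ _ (fun x : 'rV[R]_n => e ^+ 2 + -1 * ((x 0 i - c 0 i)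
    * (x 0 i - c 0 i)))).
  + exact: openT.
  + by move=> y _; rewrite mulN1r.
  + apply: class_CD; [exact: openT|exact: class_C_cst|].
    apply: class_CM; [exact: openT|exact: class_C_cst|].
    by apply: class_CM; [exact: openT| |].
- move=> x xc; apply: big1 => i _; apply: b1; apply: le_trans xc.
  by have := norm_coord (x - c) i; rewrite !mxE.
move=> x xc; have [i ie] : exists i, e <= `|x 0 i - c 0 i|.
  apply: contrapT => /forallNP H.
  suff : `|x - c| < e by rewrite ltNge xc.
  rewrite [ltLHS]/Num.Def.normr/= mx_normrE; apply: bigmax_lt => // -[j i] _ /=.
  by rewrite ltNge; apply/negP => h; apply: (H i); move: h; rewrite !mxE ord1.
by rewrite (bigD1 i) //= b0 // mul0r.
Qed.

End Bump.

(** * Wedge products as alternations of tensor products *)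

Section Tensor.
Context {R : realType} {V : lmodType R}.

Definition tens p q (a : ('I_p -> V) -> R) (b : ('I_q -> V) -> R)
    (v : 'I_(p + q) -> V) : R :=
  a (fun i => v (lshift q i)) * b (fun j => v (rshift p j)).

(** No division by k!, which keeps the expansions of iterated products free of
    factorials; the constants are restored by [wedge_alt_tens]. *)
Definition alt k (a : ('I_k -> V) -> R) (v : 'I_k -> V) : R :=
  \sum_(s : 'S_k) (-1) ^+ s * a (fun i => v (s i)).

Fixpoint tens_pow (w : ('I_2 -> V) -> R) (r : nat) : ('I_r.*2 -> V) -> R :=
  match r return ('I_r.*2 -> V) -> R with
  | 0 => fun=> 1
  | r'.+1 => tens w (@tens_pow w r')
  end.

Arguments tens_pow w r _ : clear implicits.

Lemma lift_perm_block p q (t : 'S_q) : exists s : 'S_(p + q),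
  [/\ forall i, s (lshift q i) = lshift q i,
      forall j, s (rshift p j) = rshift p (t j) & odd_perm s = odd_perm t].
Proof.
elim: p => [|p [s [sl sr so]]].
  have E k : (rshift 0 k : 'I_q) = k by exact: val_inj.
  by exists t; split=> // [[]//|j]; rewrite !E.
exists (@lift_perm (p + q) ord0 ord0 s); split.
- move=> i; have [j ->|->] := unliftP ord0 i.
    have -> : lshift q (lift ord0 j) = lift ord0 (lshift q j) by exact: val_inj.
    by rewrite lift_perm_lift sl; apply: val_inj.
  have -> : lshift q ord0 = ord0 :> 'I_(p.+1 + q) by exact: val_inj.
  by rewrite lift_perm_id.
- move=> j.
  have E k : rshift p.+1 k = lift ord0 (rshift p k) :> 'I_(p + q).+1 by exact: val_inj.
  by rewrite !E lift_perm_lift sr.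
- by rewrite odd_lift_perm so.
Qed.

(** A permutation of the last q arguments is absorbed by reindexing the outer
    sum, so the inner alternation contributes q! equal terms. *)
Lemma alt_tens_alt p q (a : ('I_p -> V) -> R) (b : ('I_q -> V) -> R) v :
  alt (tens a (alt b)) v = q`!%:R * alt (tens a b) v.
Proof.
rewrite /alt /tens.
under eq_bigr do rewrite !mulr_sumr.
rewrite exchange_big /=.
transitivity (\sum_(t : 'S_q) alt (tens a b) v); last first.
  by rewrite sumr_const card_Sn mulr_natl.
apply: eq_bigr => t _; have [t' [tl tr to]] := lift_perm_block p t.
rewrite /alt /tens [RHS](reindex_inj (mulgI t')) /=; apply: eq_bigr => s _.
have Ea : (fun i => v ((t' * s)%g (lshift q i))) = (fun i => v (s (lshift q i))).
  by apply/funext => i; rewrite permM tl.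
have Eb : (fun j => v ((t' * s)%g (rshift p j))) = (fun j => v (s (rshift p (t j)))).
  by apply/funext => j; rewrite permM tr.
rewrite Ea Eb odd_permM signr_addb to.
by move: (a _) (b _) ((-1) ^+ s) ((-1) ^+ t) => A B S T; ring.
Qed.

Lemma wedge_alt_tens p q (a : ('I_p -> V) -> R) (b : ('I_q -> V) -> R) v :
  wedge a b v = (p`!%:R * q`!%:R)^-1 * alt (tens a b) v.
Proof.
by rewrite /wedge /alt /tens; congr (_ * _); apply: eq_bigr => s _; rewrite mulrA.
Qed.

Lemma alt_tensZr p q (a : ('I_p -> V) -> R) (b : ('I_q -> V) -> R) c v :
  alt (tens a (fun u => c * b u)) v = c * alt (tens a b) v.
Proof.
rewrite /alt /tens mulr_sumr; apply: eq_bigr => s _.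
by move: (a _) (b _) ((-1) ^+ s) => A B S; ring.
Qed.

Lemma wedge_alt p q (a : ('I_p -> V) -> R) (b : ('I_q -> V) -> R) c v :
  wedge a (fun u => c * alt b u) v = c / p`!%:R * alt (tens a b) v.
Proof.
rewrite wedge_alt_tens alt_tensZr alt_tens_alt.
have f0 k : k`!%:R != 0 :> R by rewrite pnatr_eq0 -lt0n fact_gt0.
move: (alt _ _) (f0 p) (f0 q) => A; move: (p`!%:R) (q`!%:R) => P Q P0 Q0.
by field; rewrite P0 Q0.
Qed.

Lemma wedge_pow_alt w r : exists2 c : R, c != 0 &
  forall v, wedge_pow w r v = c * alt (tens_pow w r) v.
Proof.
elim: r => [|r [c c0 IH]].
  exists 1; rewrite ?oner_neq0 // => v; rewrite /= /alt mul1r.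
  rewrite (big_pred1 1%g) ?odd_perm1 ?mulr1 // => s; apply/esym/eqP.
  by apply/permP => -[].
exists (c / 2`!%:R).
  by rewrite mulf_neq0 // invr_eq0 pnatr_eq0.
move=> v; transitivity (@wedge R V 2 r.*2 w (fun u => c * alt (tens_pow w r) u) v).
  by rewrite /=; congr (@wedge _ _ 2 r.*2 w _ v); apply/funext => u; rewrite IH.
exact: wedge_alt.
Qed.

(** A wedge product with a wedge power divides by factorials at each factor. Up
    to a nonzero constant it is a single alternation, which is all that matters
    for its vanishing. *)
Lemma wedge_wedge_pow p (e : ('I_p -> V) -> R) w r : exists2 c : R, c != 0 &
  forall v, wedge e (wedge_pow w r) v = c * alt (tens e (tens_pow w r)) v.
Proof.
have [c c0 H] := wedge_pow_alt w r; exists (c / p`!%:R).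
  by rewrite mulf_neq0 // invr_eq0 pnatr_eq0 -lt0n fact_gt0.
move=> v; rewrite -wedge_alt.
by congr (@wedge _ _ p r.*2 e _ v); apply/funext => u; rewrite H.
Qed.

Lemma tens_multilinear p q (a : ('I_p -> V) -> R) (b : ('I_q -> V) -> R) :
  multilinear a -> multilinear b -> multilinear (tens a b).
Proof.
move=> ma mb v i t x y; rewrite /tens.
case: (split_ordP i) => k ->.
  have E z : (fun i => [eta v with lshift q k |-> z] (lshift q i)) =
             [eta (fun i => v (lshift q i)) with k |-> z].
    by apply/funext => j /=; rewrite (inj_eq (@lshift_inj _ _)).
  have E' z : (fun j => [eta v with lshift q k |-> z] (rshift p j)) = (fun j => v (rshift p j)).
    by apply/funext => j /=; rewrite eq_rlshift.
  by rewrite !E !E' ma mulrDl mulrA.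
have E z : (fun i => [eta v with rshift p k |-> z] (rshift p i)) =
           [eta (fun i => v (rshift p i)) with k |-> z].
  by apply/funext => j /=; rewrite (inj_eq (@rshift_inj _ _)).
have E' z : (fun j => [eta v with rshift p k |-> z] (lshift q j)) = (fun j => v (lshift q j)).
  by apply/funext => j /=; rewrite eq_lrshift.
by rewrite !E !E' mb mulrDr mulrCA.
Qed.

Lemma alt_multilinear k (a : ('I_k -> V) -> R) :
  multilinear a -> multilinear (alt a).
Proof.
move=> ma v i t x y; rewrite /alt mulr_sumr -big_split /=; apply: eq_bigr => s _.
have E z : (fun j => [eta v with i |-> z] (s j)) =
           [eta (fun j => v (s j)) with (s^-1)%g i |-> z].
  by apply/funext => j /=; rewrite -(inj_eq (@perm_inj _ s) j) permKV.
by rewrite !E ma mulrDr mulrCA.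
Qed.

Lemma alt_alternating k (a : ('I_k -> V) -> R) : Defs.alternating (alt a).
Proof.
move=> v i j ij vij; have E : alt a v = - alt a v.
  rewrite {1}/alt (reindex_inj (mulIg (tperm i j))) /= /alt -sumrN.
  apply: eq_bigr => s _; rewrite odd_permM odd_tperm ij addbT signrN mulNr.
  congr (- (_ * a _)); apply/funext => l; rewrite permM.
  by case: tpermP => [->|->|//].
by move/eqP: E; rewrite -subr_eq0 opprK -mulr2n mulrn_eq0 => /eqP.
Qed.

Definition kills (Z : V -> Prop) k (a : ('I_k -> V) -> R) :=
  forall v i, Z (v i) -> a v = 0.

Lemma tens_kills Z p q (a : ('I_p -> V) -> R) (b : ('I_q -> V) -> R) :
  kills Z a -> kills Z b -> kills Z (tens a b).
Proof.
move=> ka kb v i; rewrite /tens; case: (split_ordP i) => k -> Zk.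
  by rewrite (ka _ k) ?mul0r.
by rewrite (kb _ k) ?mulr0.
Qed.

Lemma alt_kills Z k (a : ('I_k -> V) -> R) : kills Z a -> kills Z (alt a).
Proof.
move=> ka v i Zi; apply: big1 => s _.
by rewrite (ka _ ((s^-1)%g i)) ?mulr0 // permKV.
Qed.

Lemma tens_pow_kills Z w r : kills Z w -> kills Z (tens_pow w r).
Proof.
by move=> kw; elim: r => [v []//|r IH]; exact: (@tens_kills Z 2 r.*2).
Qed.

Lemma tens_pow_multilinear w r : multilinear w -> multilinear (tens_pow w r).
Proof.
by move=> mw; elim: r => [v []//|r IH]; exact: (@tens_multilinear 2 r.*2).
Qed.

Lemma multilinear0 k (a : ('I_k -> V) -> R) v i :
  multilinear a -> a [eta v with i |-> 0] = 0.
Proof.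
move=> /(_ v i (-1) 0 0) ma; move: ma; by rewrite scaler0 addr0 => ->; rewrite mulN1r addNr.
Qed.

Lemma multilinear_sum k (a : ('I_k -> V) -> R) v i (c : 'I_k -> R) (x : 'I_k -> V) :
  multilinear a -> a [eta v with i |-> \sum_j c j *: x j] =
    \sum_j c j * a [eta v with i |-> x j].
Proof.
move=> ma; elim: (index_enum _) => [|j s IH]; rewrite ?big_nil ?multilinear0 //.
by rewrite !big_cons ma IH.
Qed.

(** Substituting for v_i the combination of the v_j multiplies the value by c_i,
    the other terms having a repeated argument; and the combination lies in Z. *)
Lemma alternating_dependent k (a : ('I_k -> V) -> R) (Z : V -> Prop) v (c : 'I_k -> R) i :
  multilinear a -> Defs.alternating a -> kills Z a -> c i != 0 ->
  Z (\sum_j c j *: v j) -> a v = 0.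
Proof.
move=> ma aa ka ci Zc.
have := multilinear_sum v i c v ma; rewrite (ka _ i); last by rewrite /= eqxx.
rewrite (bigD1 i) //= big1 ?addr0; last first.
  move=> j ji; rewrite [X in _ * X](_ : _ = 0) ?mulr0 //.
  by apply: (aa _ i j) => /=; rewrite ?eqxx ?(negbTE ji) // eq_sym.
have -> : ([eta v with i |-> v i] : 'I_k -> V) = v.
  by apply/funext => j /=; case: eqP => // ->.
by move/esym/eqP; rewrite mulf_eq0 (negbTE ci) => /eqP.
Qed.

End Tensor.
Arguments tens_pow {R V} w r _.

(** * Top forms and hyperbolic pairs *)

Lemma sum_perm_fix_max (R : realType) n (F : 'S_n.+1 -> R) :
  \sum_(s : 'S_n.+1 | s ord_max == ord_max) F s =
  \sum_(t : 'S_n) F (lift_perm ord_max ord_max t).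
Proof.
have inj : injective (@lift_perm n ord_max ord_max).
  move=> t t' E; apply/permP => k; apply: (@lift_inj _ ord_max).
  by rewrite -(lift_perm_lift ord_max ord_max t) E lift_perm_lift.
transitivity (\sum_(t in [pred t : 'S_n | true]) F (lift_perm ord_max ord_max t)); last first.
  by apply: eq_bigl.
rewrite -(big_imset (h := @lift_perm n ord_max ord_max) F); last first.
  by move=> t t' _ _ E; exact: inj E.
apply: eq_bigl => s; apply/eqP/imsetP => [sm|[t _ ->]]; last exact: lift_perm_id.
pose f k := odflt k (unlift ord_max (s (lift ord_max k))).
have fE k : lift ord_max (f k) = s (lift ord_max k).
  rewrite /f; case: unliftP => [j -> //|E].
  by move: E; rewrite -[RHS]sm => /perm_inj/esym/eqP; rewrite (negbTE (neq_lift _ _)).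
have fi : injective f.
  by move=> k k' /(congr1 (lift ord_max)); rewrite !fE => /perm_inj/lift_inj.
exists (perm fi) => //; apply/permP => k; case: (unliftP ord_max k) => [j|] ->.
  by rewrite lift_perm_lift permE fE.
by rewrite lift_perm_id sm.
Qed.

Section Hyperbolic.
Context {R : realType} {V : lmodType R}.
Variables (e : ('I_1 -> V) -> R) (w : ('I_2 -> V) -> R).
Let e1 X := e (tnth [tuple X]).
Let w2 X Y := w (tnth [tuple X; Y]).

(** Arguments are indexed by natural numbers here, to keep the positions 2 i and
    2 i + 1 of the i-th factor free of ordinal bounds. *)
Lemma tens_powE n (U : nat -> V) :
  tens_pow w n (fun i : 'I_n.*2 => U i) = \prod_(i < n) w2 (U i.*2) (U i.*2.+1).
Proof.
elim: n U => [|n IH] U /=; first by rewrite big_ord0.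
rewrite big_ord_recl; congr (_ * _).
  rewrite /w2; congr w; apply/funext => i.
  by rewrite (tnth_nth 0); case: i => -[|[|[]]].
by rewrite -(IH (fun k => U k.+2)).
Qed.

Lemma topE n (U : nat -> V) :
  tens e (tens_pow w n) (fun i : 'I_(1 + n.*2) => U i) =
  e1 (U 0%N) * \prod_(i < n) w2 (U i.*2.+1) (U i.*2.+2).
Proof.
rewrite /tens /=; congr (_ * _).
  by rewrite /e1; congr e; apply/funext => i; rewrite !ord1.
exact: (tens_powE n (fun k => U k.+1)).
Qed.

Hypothesis w_skew : forall X Y, w2 Y X = - w2 X Y.

Section Step.
Variables (n : nat).
Notation N := n.*2.+1.
Notation term v s := (e1 (v (s (inord 0))) *
   \prod_(i < n.+1) w2 (v (s (inord i.*2.+1))) (v (s (inord i.*2.+2)))).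

Lemma alt_topE (v : 'I_N.+2 -> V) :
  alt (tens e (tens_pow w n.+1)) v = \sum_(s : 'S_N.+2) (-1) ^+ s * term v s.
Proof.
apply: eq_bigr => s _; congr (_ * _).
rewrite -(topE n.+1 (fun k => v (s (inord k)))).
by congr tens; apply/funext => i; rewrite inord_val.
Qed.

Let io k : 'I_N.+2 := inord k.
Let ioE k l : (k < N.+2)%N -> (l < N.+2)%N -> (io k == io l) = (k == l).
Proof. by move=> kN lN; rewrite -val_eqE /= !inordK. Qed.

Lemma term_swap v (s : 'S_N.+2) :
  term v (tperm (io N) (io N.+1) * s)%g = - term v s.
Proof.
have fx k : (k < N)%N -> (tperm (io N) (io N.+1) * s)%g (io k) = s (io k).
  by move=> kN; rewrite permM tpermD //; rewrite ioE; lia.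
rewrite fx // !big_ord_recr /= -mulrN; congr (_ * _); rewrite -mulrN; congr (_ * _).
  by apply: eq_bigr => i _; rewrite !fx //; have := ltn_ord i; lia.
by rewrite -!/(io _) !permM tpermL tpermR w_skew.
Qed.

(** Exchanging the last two arguments with those of the i-th factor w only
    permutes the factors of the product. *)
Lemma term_block v (s : 'S_N.+2) (i : 'I_n.+1) :
  term v (tperm (io i.*2.+1) (io N) * tperm (io i.*2.+2) (io N.+1) * s)%g =
  term v s.
Proof.
have iN := ltn_ord i.
set p := (tperm _ _ * tperm _ _)%g.
have p0 : (p * s)%g (inord 0) = s (inord 0).
  by rewrite -!/(io _) !permM !tpermD //; rewrite ioE; lia.
rewrite p0; congr (_ * _).
rewrite [RHS](reindex_inj (@perm_inj _ (tperm i ord_max))) /=.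
apply: eq_bigr => j _; have jN := ltn_ord j.
rewrite -!/(io _) !permM.
have [->|ji] := eqVneq j i.
  rewrite tpermL !tpermL; congr (w2 (v (s _)) (v (s _))).
    by rewrite tpermD //; rewrite ioE; lia.
  rewrite [X in tperm _ _ X]tpermD.
  - by rewrite tpermL.
  - by rewrite ioE; lia.
  - by rewrite ioE; lia.
have [->|jm] := eqVneq j ord_max.
  rewrite [in RHS]tpermR; congr (w2 (v (s _)) (v (s _))).
    rewrite [X in tperm _ _ X]tpermR tpermD //.
    - by rewrite ioE; lia.
    - by rewrite ioE; lia.
  rewrite [X in tperm _ _ X]tpermD.
  - by rewrite tpermR.
  - by rewrite ioE /=; lia.
  - by rewrite ioE /=; lia.
have jn : (j : nat) != n by move: jm; apply: contraNneq => E; apply/eqP/val_inj.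
have jin : (j : nat) != i by move: ji; apply: contraNneq => E; apply/eqP/val_inj.
rewrite (@tpermD _ i ord_max j) 1?eq_sym //.
have out k : (k < N.+2)%N -> k != i.*2.+1 -> k != i.*2.+2 -> k != N -> k != N.+1 ->
    tperm (io i.*2.+2) (io N.+1) (tperm (io i.*2.+1) (io N) (io k)) = io k.
  move=> kN k1 k2 k3 k4; rewrite [X in tperm _ _ X]tpermD; first rewrite tpermD //.
  - by rewrite ioE; lia.
  - by rewrite ioE; lia.
  - by rewrite ioE; lia.
  - by rewrite ioE; lia.
by congr (w2 (v (s _)) (v (s _))); apply: out; lia.
Qed.

(** Shows that the sum over the permutations with s p = ord_max does not depend
    on p, as long as p is an argument of some factor w: an exchange of factors
    brings p into the last factor, and a swap inside this factor changes both
    the sign of the permutation and that of the term. *)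
Lemma term_transport v (p : 'I_N.+2) : p != io 0 ->
  exists2 q : 'S_N.+2, q p = ord_max &
    forall s, (-1) ^+ (q * s)%g * term v (q * s)%g = (-1) ^+ s * term v s.
Proof.
have om : io N.+1 = ord_max by apply: val_inj; rewrite /= inordK.
move=> p0; have pN := ltn_ord p.
have p0' : (p : nat) != 0 by move: p0; rewrite -{1}[p]inord_val ioE.
have [i Ei] : exists i : 'I_n.+1, p = io i.*2.+1 \/ p = io i.*2.+2.
  have iP : (p.-1./2 < n.+1)%N by lia.
  exists (Ordinal iP) => /=.
  have [E|E] : (p : nat) = (p.-1./2).*2.+1 \/ (p : nat) = (p.-1./2).*2.+2 by lia.
    by left; apply: val_inj; rewrite /= inordK -?E.
  by right; apply: val_inj; rewrite /= inordK -?E.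
have iN := ltn_ord i.
pose b := (tperm (io i.*2.+1) (io N) * tperm (io i.*2.+2) (io N.+1))%g.
have ob : odd_perm b = false.
  by rewrite odd_permM !odd_tperm !ioE; lia.
case: Ei => ->; last first.
  exists b => [|s]; last by rewrite term_block odd_permM ob.
  rewrite permM (@tpermD _ (io i.*2.+1)) ?tpermL //; last by rewrite ioE; lia.
  by rewrite ioE; lia.
exists (b * tperm (io N) (io N.+1))%g => [|s].
  rewrite !permM tpermL.
  have -> : tperm (io i.*2.+2) (io N.+1) (io N) = io N.
    by rewrite tpermD //; rewrite ioE; lia.
  by rewrite tpermL om.
rewrite -mulgA term_block term_swap (odd_permM b) ob odd_permM odd_tperm.
by rewrite ioE // (_ : (N == N.+1) = false) ?signrN ?mulrNN //; lia.
Qed.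

Variables (u : 'I_N -> V) (X Y : V).
Hypothesis eY : e1 Y = 0.
Hypothesis uY : forall i, w2 (u i) Y = 0.

Definition extend_pair (i : 'I_N.+2) : V :=
  if (i < N)%N then u (inord i) else if i == N :> nat then X else Y.

(** Sort the permutations by the position of Y. In the argument of e it
    contributes 0, and the other 2 n + 2 positions contribute equally. With Y in
    the last position its partner has to be X, because w (u_i, Y) = 0; what is
    left is the alternation over u. *)
Lemma alt_hyperbolic :
  alt (tens e (tens_pow w n.+1)) extend_pair =
  n.*2.+2%:R * (w2 X Y * alt (tens e (tens_pow w n)) u).
Proof.
set v := extend_pair.
have om : io N.+1 = ord_max by apply: val_inj; rewrite /= inordK.
have vY : v ord_max = Y.
  by rewrite /v /extend_pair /= !ifF //; lia.
have vX : v (io N) = X.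
  by rewrite /v /extend_pair /= inordK ?ltnn ?eqxx //; lia.
have vu (i : 'I_N) : v (lift ord_max (lift ord_max i)) = u i.
  have E : lift ord_max (lift ord_max i) = i :> nat.
    by rewrite !lift_max.
  by rewrite /v /extend_pair E ltn_ord inord_val.
have w0 : w2 Y Y = 0 by have := w_skew Y Y; lra.
rewrite alt_topE.
set F := fun s : 'S_N.+2 => (-1) ^+ s * term v s.
rewrite -/F.
pose S0 := \sum_(s : 'S_N.+2 | s ord_max == ord_max) F s.
have part p : p != io 0 -> \sum_(s : 'S_N.+2 | s p == ord_max) F s = S0.
  move=> /(term_transport v)[q qp Fq].
  rewrite /S0 (reindex_inj (mulgI q)) /=; apply: eq_big => s.
    by rewrite permM qp.
  by move=> _; rewrite /F Fq.
have part0 : \sum_(s : 'S_N.+2 | s (io 0) == ord_max) F s = 0.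
  by apply: big1 => s /eqP s0; rewrite /F -/(io _) s0 vY eY mul0r mulr0.
have -> : \sum_s F s = n.*2.+2%:R * S0.
  rewrite (partition_big (fun s : 'S_N.+2 => (s^-1)%g ord_max) xpredT) //=.
  rewrite (bigD1 (io 0)) //=.
  have cond p (s : 'S_N.+2) : ((s^-1)%g ord_max == p) = (s p == ord_max).
    by rewrite -(inj_eq (@perm_inj _ s)) permKV eq_sym.
  under eq_bigl do rewrite cond.
  rewrite part0 add0r.
  under eq_bigr => p hp.
    under eq_bigl do rewrite cond.
    rewrite part //; over.
  rewrite sumr_const mulr_natl; congr (_ *+ _).
  have := cardC1 (io 0); rewrite card_ord => C1.
  by transitivity (n.*2.+3.-1) => //; rewrite -C1; apply: eq_card.
congr (_ * _); rewrite /S0 sum_perm_fix_max.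
rewrite (bigID (fun t : 'S_N.+1 => t ord_max == ord_max)) /=.
have ioNE : io N = lift ord_max ord_max :> 'I_N.+2.
  by apply: ord_inj; rewrite lift_max inordK.
rewrite [X in _ + X]big1 ?addr0; last first.
  move=> t tm; rewrite /F big_ord_recr /= -/(io N) -/(io N.+1) om lift_perm_id vY.
  rewrite ioNE lift_perm_lift.
  case: (unliftP ord_max (t ord_max)) tm => [j ->|->]; last by rewrite eqxx.
  by move=> _; rewrite vu uY !mulr0.
rewrite sum_perm_fix_max /alt mulr_sumr; apply: eq_bigr => t _.
rewrite /F !odd_lift_perm !addbb !addFb [RHS]mulrCA; congr (_ * _).
have big2 k : (k < N)%N -> v (lift_perm ord_max ord_max (lift_perm ord_max ord_max t)
  (inord k)) =
    u (t (inord k)).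
  move=> kN.
  have -> : inord k = lift ord_max (lift ord_max (inord k : 'I_N)) :> 'I_N.+2.
    by apply: ord_inj; rewrite !lift_max !inordK //; lia.
  by rewrite !lift_perm_lift vu.
rewrite big2 // big_ord_recr /=.
rewrite -/(io N) -/(io N.+1) om lift_perm_id vY ioNE lift_perm_lift lift_perm_id.
rewrite -ioNE vX mulrA mulrC; congr (_ * _).
have := topE n (fun k => u (t (inord k))).
have -> : (fun i : 'I_(1 + n.*2) => u (t (inord i))) = (fun i => u (t i)).
  by apply/funext => i; rewrite inord_val.
move=> ->; congr (_ * _); apply: eq_bigr => i _; have := ltn_ord i => iN.
by rewrite !big2 //; lia.
Qed.

End Step.

End Hyperbolic.

(** The pairs are added one at a time. The vectors listed so far must remain
    orthogonal to the Y_j still to come, for [alt_hyperbolic] to apply again. *)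
Lemma wedge_hyperbolic_iter (R : realType) (V : lmodType R)
    (e : ('I_1 -> V) -> R) (w : ('I_2 -> V) -> R) n k
    (u : 'I_(1 + n.*2) -> V) (X Y : 'I_k -> V) :
  (forall A B, w (tnth [tuple B; A]) = - w (tnth [tuple A; B])) ->
  (forall j, e (tnth [tuple Y j]) = 0) ->
  (forall i j, w (tnth [tuple X i; Y j]) = (i == j)%:R) ->
  (forall i j, w (tnth [tuple Y i; Y j]) = 0) ->
  (forall i j, w (tnth [tuple u i; Y j]) = 0) ->
  wedge e (wedge_pow w n) u != 0 ->
  exists v, wedge e (wedge_pow w (n + k)) v != 0.
Proof.
move=> skew eY XY YY uY.
have [c c0 ->] := wedge_wedge_pow e w n; rewrite mulf_eq0 (negbTE c0) /= => u0.
have [c' c'0 wE] := wedge_wedge_pow e w (n + k).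
suff [v v0] : exists v, alt (tens e (tens_pow w (n + k))) v != 0.
  by exists v; rewrite wE mulf_neq0.
have H l : (l <= k)%N -> exists2 v : 'I_(1 + (n + l).*2) -> V,
    alt (tens e (tens_pow w (n + l))) v != 0 &
    forall i (j : 'I_k), (l <= j)%N -> w (tnth [tuple v i; Y j]) = 0.
  elim: l => [_|l IH lk]; first by rewrite addn0; exists u.
  have [v v0 vY] := IH (ltnW lk).
  pose j0 := Ordinal lk.
  rewrite addnS; exists (extend_pair v (X j0) (Y j0)).
    rewrite alt_hyperbolic //; last by move=> i; exact: vY.
    by rewrite XY eqxx mul1r mulf_neq0 // pnatr_eq0.
  move=> i j lj; rewrite /extend_pair; case: ifP => _; first by apply: vY; exact: ltnW.
  by case: ifP => _; rewrite ?YY // XY -val_eqE /= (ltn_eqF lj).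
by have [v v0 _] := H k (leqnn k); exists v.
Qed.

(** * Forms on row vectors and their matrices *)

Section MatrixForms.
Context {R : realType} {n : nat}.
Implicit Types (c : 'cV[R]_n) (W : 'M[R]_n).

Definition form1 c (v : 'I_1 -> 'rV[R]_n) : R := (v ord0 *m c) 0 0.

Definition form2 W (v : 'I_2 -> 'rV[R]_n) : R :=
  (v ord0 *m W *m (v ord_max)^T) 0 0.

Lemma form1_multilinear c : multilinear (form1 c).
Proof.
by move=> v i t x y; rewrite /form1 (ord1 i) /= mulmxDl -scalemxAl !mxE.
Qed.

Lemma form1_alternating c : Defs.alternating (form1 c).
Proof. by move=> v i j; rewrite !ord1 eqxx. Qed.

Lemma form2_multilinear W : multilinear (form2 W).
Proof.
move=> v i t x y; rewrite /form2.
have [->|->] : i = ord0 \/ i = ord_max.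
  by case: i => -[|[|//]] iP; [left|right]; apply: val_inj.
  by rewrite /= !mulmxDl -!scalemxAl !mxE.
by rewrite /= linearD linearZ /= mulmxDr -scalemxAr !mxE.
Qed.

Lemma form2_skew W (u v : 'rV[R]_n) : W^T = - W -> (v *m W *m u^T) 0 0 = - (u *m W *m v^T) 0 0.
Proof.
move=> WT; rewrite -[in LHS](trmxK (v *m W *m u^T)) [LHS]mxE.
by rewrite !trmx_mul trmxK WT mulNmx mulmxN mulmxA mxE.
Qed.

Lemma form2_alternating W : W^T = - W -> Defs.alternating (form2 W).
Proof.
move=> WT v i j ij vij.
have {ij vij}E : v ord0 = v ord_max.
  move: ij vij; case: i => -[|[|//]] iP; case: j => -[|[|//]] jP // _.
    by move=> E; rewrite [ord0](_ : _ = Ordinal iP) ?E; [congr v|]; apply: val_inj.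
  by move=> E; rewrite [ord0](_ : _ = Ordinal jP) -?E; [congr v|]; apply: val_inj.
rewrite /form2 E; have := form2_skew (v ord_max) (v ord_max) WT.
move: (fun_of_matrix _ _ _) => x; lra.
Qed.

Lemma form1_mul m (J : 'M[R]_(m, n)) c (v : 'I_1 -> 'rV[R]_m) :
  form1 c (fun j => v j *m J) = (v ord0 *m (J *m c)) 0 0.
Proof. by rewrite /form1 mulmxA. Qed.

Lemma form2_mul m (J : 'M[R]_(m, n)) W (v : 'I_2 -> 'rV[R]_m) :
  form2 W (fun j => v j *m J) = (v ord0 *m (J *m W *m J^T) *m (v ord_max)^T) 0 0.
Proof. by rewrite /form2 trmx_mul !mulmxA. Qed.

Definition form1_mx (a : ('I_1 -> 'rV[R]_n) -> R) : 'cV[R]_n :=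
  \col_i a (tnth [tuple delta_mx 0 i]).

Definition form2_mx (a : ('I_2 -> 'rV[R]_n) -> R) : 'M[R]_n :=
  \matrix_(i, j) a (tnth [tuple delta_mx 0 i; delta_mx 0 j]).

Lemma tnth1E (T : Type) (v : 'I_1 -> T) : v = tnth [tuple v ord0].
Proof. by apply/funext => i; rewrite !ord1. Qed.

Lemma tnth2E (T : Type) (v : 'I_2 -> T) : v = tnth [tuple v ord0; v ord_max].
Proof.
apply/funext => i; rewrite (tnth_nth (v ord0)).
by case: i => -[|[|//]] iP /=; congr v; apply: val_inj.
Qed.

Lemma form1_mxE a v : multilinear a -> a v = form1 (form1_mx a) v.
Proof.
move=> ma; have lin : linear (fun x : 'rV[R]_n => a (tnth [tuple x]) : R^o).
  have E z : ([eta tnth [tuple 0] with ord0 |-> z] : 'I_1 -> 'rV[R]_n) = tnth [tuple z].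
    exact: (tnth1E [eta tnth [tuple 0] with ord0 |-> z]).
  by move=> t x y; have := ma (tnth [tuple 0]) ord0 t x y; rewrite !E.
rewrite [v in LHS]tnth1E /form1 mxE.
pose f : {linear 'rV[R]_n -> R^o} := HB.pack (fun x : 'rV[R]_n => a (tnth [tuple x]) : R^o)
   (GRing.isLinear.Build _ _ _ _ _ lin).
rewrite -[LHS]/(f (v ord0)) [v ord0 in LHS]row_sum_delta linear_sum.
by apply: eq_bigr => i _; rewrite linearZ mxE.
Qed.

Lemma form2_mxE a v : multilinear a -> a v = form2 (form2_mx a) v.
Proof.
move=> ma.
have linl y : linear (fun x : 'rV[R]_n => a (tnth [tuple x; y]) : R^o).
  have E z : ([eta tnth [tuple 0; y] with ord0 |-> z] : 'I_2 -> 'rV[R]_n) = tnth [tuple z; y].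
    exact: (tnth2E [eta tnth [tuple 0; y] with ord0 |-> z]).
  by move=> t x x'; have := ma (tnth [tuple 0; y]) ord0 t x x'; rewrite !E.
have linr x : linear (fun y : 'rV[R]_n => a (tnth [tuple x; y]) : R^o).
  have E z : ([eta tnth [tuple x; 0] with ord_max |-> z] : 'I_2 -> 'rV[R]_n) =
    tnth [tuple x; z].
    exact: (tnth2E [eta tnth [tuple x; 0] with ord_max |-> z]).
  by move=> t y y'; have := ma (tnth [tuple x; 0]) ord_max t y y'; rewrite !E.
pose f y : {linear 'rV[R]_n -> R^o} := HB.pack (fun x : 'rV[R]_n => a (tnth [tuple x; y]) : R^o)
   (GRing.isLinear.Build _ _ _ _ _ (linl y)).
pose g x : {linear 'rV[R]_n -> R^o} := HB.pack (fun y : 'rV[R]_n => a (tnth [tuple x; y]) : R^o)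
   (GRing.isLinear.Build _ _ _ _ _ (linr x)).
rewrite [v in LHS]tnth2E /form2 mxE.
rewrite -[LHS]/(g (v ord0) (v ord_max)) [v ord_max in LHS]row_sum_delta linear_sum.
apply: eq_bigr => j _; rewrite linearZ /= -[X in _ *: X]/(f (delta_mx 0 j) (v ord0)).
rewrite [v ord0 in LHS]row_sum_delta linear_sum !mxE mulrC; congr (_ * _).
by apply: eq_bigr => i _; rewrite linearZ mxE.
Qed.

Lemma form2_mx_skew a : multilinear a -> Defs.alternating a ->
  (form2_mx a)^T = - form2_mx a.
Proof.
move=> ma aa; apply/matrixP => i j; rewrite !mxE.
have alt0 x : a (tnth [tuple x; x]) = 0 by apply: (aa _ ord0 ord_max).
have B x y : a (tnth [tuple x; y]) = (x *m form2_mx a *m y^T) 0 0.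
  by rewrite form2_mxE.
set x := delta_mx 0 i; set y := delta_mx 0 j.
have Bl u v z : a (tnth [tuple u + v; z]) = a (tnth [tuple u; z]) + a (tnth [tuple v; z]).
  by rewrite !B !mulmxDl mxE.
have Br u v z : a (tnth [tuple z; u + v]) = a (tnth [tuple z; u]) + a (tnth [tuple z; v]).
  by rewrite !B raddfD /= mulmxDr mxE.
have := alt0 (x + y); rewrite Bl !Br !alt0 addr0 add0r => E.
by apply/eqP; rewrite -addr_eq0 addrC E.
Qed.

End MatrixForms.

(** * The dimension of the common kernel *)

Section Dimension.
Context {R : realType} {n : nat}.

Definition vbasis_mx (U : {vspace 'rV[R]_n}) : 'M[R]_(\dim U, n) :=
  \matrix_i tnth (vbasis U) i.

Lemma vbasis_mx_free U : row_free (vbasis_mx U).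
Proof.
apply: inj_row_free => v v0; apply/rowP => i; rewrite [RHS]mxE.
have /freeP := basis_free (vbasisP U); apply.
rewrite -[RHS]v0 mulmx_sum_row; apply: eq_bigr => j _.
by rewrite rowK (tnth_nth 0).
Qed.

Lemma mem_vbasis_mx (U : {vspace 'rV[R]_n}) (x : 'rV[R]_n) : (x \in U) = (x <= vbasis_mx U)%MS.
Proof.
apply/idP/submxP => [/coord_vbasis->|[D ->]].
  exists (\row_i coord (vbasis U) i x); rewrite mulmx_sum_row.
  by apply: eq_bigr => i _; rewrite rowK mxE (tnth_nth 0).
rewrite mulmx_sum_row; apply: memv_suml => i _; apply: memvZ.
by rewrite rowK; apply: vbasis_mem; exact: mem_tnth.
Qed.

(** [rank2] refers to the basis [vbasis]; passing to the canonical basis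
    multiplies the matrix by invertible ones on both sides. *)
Lemma rank2_form2_mx (w : ('I_2 -> 'rV[R]_n) -> R) : multilinear w ->
  rank2 w = \rank (form2_mx w).
Proof.
move=> mw; pose B := vbasis_mx fullv.
have dimE : \dim {: 'rV[R]_n} = n by rewrite dimvf /dim /= mul1n.
have rB : \rank B = n by rewrite -[RHS]dimE; apply/eqP; exact: vbasis_mx_free.
have fB : row_free B^T by rewrite /row_free mxrank_tr rB.
transitivity (\rank (B *m form2_mx w *m B^T)).
  congr mxrank; apply/matrixP => i j; rewrite mxE form2_mxE // /form2 /=.
  have Bi (l : 'I_(\dim (fullv : {vspace 'rV[R]_n}))) : (vbasis fullv)`_l = row l B.
    by rewrite rowK (tnth_nth 0).
  rewrite !(tnth_nth 0) /= !Bi -row_mul tr_row mxE [RHS]mxE.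
  by apply: eq_bigr => l _; rewrite ![row _ _ _ _]mxE ![col _ _ _ _]mxE.
rewrite mxrankMfree // -mxrank_tr trmx_mul mxrankMfree //.
by rewrite mxrank_tr.
Qed.

Section Kernel.
Variables (e : ('I_1 -> 'rV[R]_n) -> R) (w : ('I_2 -> 'rV[R]_n) -> R).
Hypotheses (me : multilinear e) (mw : multilinear w).

Definition pair_mx : 'M[R]_(n, n + 1) := row_mx (form2_mx w) (form1_mx e).

Lemma ker2E X : ker2 w X <-> X *m form2_mx w = 0.
Proof.
split=> [kX|X0 Y]; last by rewrite form2_mxE // /form2 /= X0 mul0mx mxE.
apply/rowP => j; have := kX (delta_mx 0 j).
by rewrite form2_mxE // /form2 /= trmx_delta -colE !mxE.
Qed.

Lemma ker1E X : ker1 e X <-> X *m form1_mx e = 0.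
Proof.
rewrite /ker1 /= form1_mxE // /form1 /=; split=> [E|->]; last by rewrite mxE.
by apply/rowP => j; rewrite !ord1 E mxE.
Qed.

Lemma ker12E X : (ker1 e `&` ker2 w)%classic X <-> X *m pair_mx = 0.
Proof.
rewrite mul_mx_row; split=> [[/ker1E-> /ker2E->]|]; first exact: row_mx0.
by rewrite -row_mx0 => /eq_row_mx[X2 X1]; split; [exact/ker1E|exact/ker2E].
Qed.

Lemma pair_mx_rank k : has_dim (ker1 e `&` ker2 w)%classic k ->
  (\rank pair_mx + k = n)%N.
Proof.
move=> [U UK dU].
have E : (vbasis_mx U :=: kermx pair_mx)%MS.
  apply/eqmxP/andP; split.
    apply/row_subP => i; rewrite sub_kermx; apply/eqP/ker12E.
    rewrite -UK /= mem_vbasis_mx; exact: row_sub.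
  apply/row_subP => i; rewrite -mem_vbasis_mx.
  have : (ker1 e `&` ker2 w)%classic (row i (kermx pair_mx)).
    by apply/ker12E/eqP; rewrite -sub_kermx row_sub.
  by rewrite -UK.
have := mxrank_ker pair_mx; rewrite -E (eqP (vbasis_mx_free U)) dU => ->.
by rewrite subnKC // rank_leq_row.
Qed.

(** The matrix [pair_mx] has rank at most 2 r + 1. If its rank were smaller,
    ker w would be contained in ker e. Among 2 r + 1 vectors a nontrivial
    combination lies in ker w, as w has rank 2 r, hence in the common kernel;
    but e /\ w^r vanishes when an argument lies in this kernel, so it would
    vanish identically. *)
Lemma presymplectic_dim r k : rank2 w = (2 * r)%N -> Defs.alternating w ->
  (exists v, wedge e (wedge_pow w r) v != 0) ->
  has_dim (ker1 e `&` ker2 w)%classic k -> n = ((2 * r).+1 + k)%N.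
Proof.
move=> rw aw [v v0] /pair_mx_rank; rewrite (rank2_form2_mx mw) in rw.
suff -> : \rank pair_mx = (2 * r).+1 by [].
have le1 : (\rank pair_mx <= (2 * r).+1)%N.
  rewrite -rw -[X in (_ <= X)%N]addn1; apply: leq_trans (leq_add (leqnn _)
    (rank_leq_col (form1_mx e))).
  rewrite -[X in (X <= _)%N]mxrank_tr tr_row_mx -addsmxE.
  by apply: leq_trans (mxrank_adds_leqif _ _) _; rewrite !mxrank_tr.
apply/eqP; rewrite eqn_leq le1 /= ltnNge; apply/negP => le2.
have kerE : (kermx (form2_mx w) <= kermx pair_mx)%MS.
  have sub : (kermx pair_mx <= kermx (form2_mx w))%MS.
    rewrite sub_kermx; have := mulmx_ker pair_mx.
    by rewrite {2}/pair_mx mul_mx_row -row_mx0 => /eq_row_mx[-> _].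
  rewrite -(geq_leqif (mxrank_leqif_sup sub)) !mxrank_ker rw.
  by rewrite leq_sub2l.
have [c c0 wE] := wedge_wedge_pow e w r.
move: v0; rewrite wE mulf_eq0 (negbTE c0) /= => /negP; apply; apply/eqP.
pose Z (x : 'rV[R]_n) := x *m pair_mx = 0.
have killw : kills Z w.
  move=> u i /ker12E[_ kw]; rewrite (tnth2E u).
  have [Ei|Ei] : i = ord0 \/ i = ord_max.
    by case: i {kw} => -[|[|//]] iP; [left|right]; apply: val_inj.
  - by rewrite -Ei kw.
  - have B x y : w (tnth [tuple x; y]) = (x *m form2_mx w *m y^T) 0 0.
      by rewrite form2_mxE.
    by rewrite B form2_skew ?form2_mx_skew // -B -Ei kw oppr0.
have kille : kills Z e.
  by move=> u i; rewrite (ord1 i) => /ker12E[ke _]; rewrite (tnth1E u); exact: ke.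
pose Vm : 'M[R]_(1 + r.*2, n) := \matrix_i v i.
have [d dn0 dV] : exists2 d : 'rV[R]_(1 + r.*2), d != 0 & d *m Vm *m form2_mx w = 0.
  pose K := kermx (Vm *m form2_mx w).
  have : K != 0.
    rewrite -mxrank_eq0 mxrank_ker subn_eq0 -ltnNge.
    apply: leq_ltn_trans (mxrankM_maxr _ _) _; rewrite rw mul2n; lia.
  case/rowV0Pn => d dK d0; exists d => //.
  by apply/eqP; rewrite -mulmxA -sub_kermx.
have [i di] : exists i, d 0 i != 0.
  apply/existsP; apply: contraR dn0 => /existsPn H; apply/eqP/rowP => i.
  by rewrite mxE; apply/eqP; have := H i; rewrite negbK.
have mtop : multilinear (alt (tens e (tens_pow w r))).
  apply: alt_multilinear; apply: tens_multilinear => //.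
  exact: tens_pow_multilinear.
apply: (@alternating_dependent _ _ _ _ Z v (fun j => d 0 j) i) => //.
- exact: alt_alternating.
- by apply: alt_kills; apply: tens_kills => //; apply: tens_pow_kills.
have -> : \sum_j d 0 j *: v j = d *m Vm.
  by rewrite mulmx_sum_row; apply: eq_bigr => j _; rewrite rowK.
apply/eqP; rewrite /Z -sub_kermx; apply: submx_trans kerE.
by rewrite sub_kermx dV.
Qed.

End Kernel.
End Dimension.

(** * Charts and partitions of unity *)

Lemma open_nearP (T : topologicalType) (A : set T) :
  (forall x, A x -> nbhs x A) -> open A.
Proof. by move=> H; rewrite openE => x /H. Qed.

Lemma preimage_open_in (T T' : topologicalType) (f : T -> T') (D : set T) (A : set T') :
  open D -> (forall x, D x -> {for x, continuous f}) -> open A ->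
  open (D `&` f @^-1` A).
Proof.
move=> oD cf oA; apply: open_nearP => x [Dx Afx]; apply: filterI.
  exact: open_nbhs_nbhs.
by apply: (cf x Dx); apply: open_nbhs_nbhs.
Qed.

Section ChartTopology.
Context {R : realType} {n : nat} {M : topologicalType}.
Implicit Types c : chart R n M.

(** Describes the image as a preimage under [cinv], whose continuity then makes
    images of open sets open. *)
Lemma chart_imageE c (W : set M) :
  cmap c @` (cdom c `&` W) = (cmap c @` cdom c) `&` (cinv c @^-1` W).
Proof.
apply/seteqP; split=> [_ [m [mc Wm] <-]|y [[m mc <-]]] /=.
  by rewrite cmapK //; split=> //; exists m.
by rewrite cmapK // => Wm; exists m.
Qed.

Lemma chart_image_open c (W : set M) : open W -> open (cmap c @` (cdom c `&` W)).
Proof.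
move=> oW; rewrite chart_imageE; apply: preimage_open_in => //.
  exact: cimage_open.
exact: cinv_continuous.
Qed.

Lemma cinvK c y : (cmap c @` cdom c) y -> cmap c (cinv c y) = y.
Proof. by move=> [m mc <-]; rewrite cmapK. Qed.

Lemma chart_imageP c (W : set M) y : (cmap c @` cdom c) y -> W (cinv c y) ->
  (cmap c @` (cdom c `&` W)) y.
Proof. by move=> cy Wy; rewrite chart_imageE. Qed.

Lemma chart_image_sub c (W : set M) : cmap c @` (cdom c `&` W) `<=` cmap c @` cdom c.
Proof. by rewrite chart_imageE => y []. Qed.

End ChartTopology.

Section PartitionOfUnity.
Context {R : realType} {n : nat} (M : manifold R n).

Definition smooth_fun (f : M -> R) :=
  forall c, @atlas R n M c -> smooth_on (cmap c @` cdom c) (f \o cinv c).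

Lemma smooth_funM f g : smooth_fun f -> smooth_fun g ->
  smooth_fun (fun m => f m * g m).
Proof. by move=> sf sg c ac; apply: smoothM (sf c ac) (sg c ac); exact: cimage_open. Qed.

Lemma closed_ball_compact (y : 'rV[R]_n) (e : R) : 0 < e -> compact [set z | `|z - y| <= e].
Proof.
move=> e0; apply: bounded_closed_compact.
  exists (`|y| + e); split; first by rewrite num_real.
  move=> N yN z /= ze; apply: ltW; apply: le_lt_trans yN.
  by rewrite -{1}(subrK y z) addrC (le_trans (ler_normD _ _)) // lerD2l.
have -> : [set z | `|z - y| <= e] = closed_ball y e.
  by rewrite closed_ballE //; apply/seteqP; split=> z; rewrite /closed_ball_ /= distrC.
exact: closed_ball_closed.
Qed.

(** A bump in the chart, extended by 0. The extension is smooth because the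
    support is the image of a closed ball, which is compact and therefore closed
    in the Hausdorff space M. *)
Lemma manifold_bump (c : chart R n M) m (U : set M) : atlas c ->
  open U -> U m -> U `<=` cdom c ->
  exists (chi : M -> R) (V C : set M),
    [/\ smooth_fun chi, open V /\ V m, forall m', V m' -> chi m' = 1,
        closed C /\ C `<=` U & forall m', ~ C m' -> chi m' = 0].
Proof.
move=> ac oU Um Uc; have mc := Uc _ Um.
have : nbhs (cmap c m) (cmap c @` (cdom c `&` U)).
  by apply: open_nbhs_nbhs; split; [exact: chart_image_open|exists m].
case/nbhs_ballP => d /= d0 dP; pose e := d / 2.
have e0 : 0 < e by rewrite divr_gt0.
have eP z : `|z - cmap c m| <= e -> (cmap c @` (cdom c `&` U)) z.
  move=> ze; apply: dP; rewrite -ball_normE /= distrC; apply: le_lt_trans ze _.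
  by rewrite /e ltr_pdivrMr // ltr_pMr // ltr1n.
have [b [sb b1 b0]] := bump_exists (cmap c m) e0.
pose K := [set z | `|z - cmap c m| <= e].
pose C := cinv c @` K.
pose chi m' := if m' \in cdom c then b (cmap c m') else 0.
have chi_in m' : cdom c m' -> chi m' = b (cmap c m').
  by move=> h; rewrite /chi mem_set.
have CU : C `<=` U.
  by move=> _ [z /eP[m' [m'c Um'] <-] <-]; rewrite cmapK.
have clC : closed C.
  apply: (compact_closed (@manifold_hausdorff R n M)).
  apply: continuous_compact; last exact: closed_ball_compact.
  apply: continuous_in_subspaceT => z /set_mem /eP Kz.
  by apply: cinv_continuous; exact: chart_image_sub Kz.
have chi_out m' : ~ C m' -> chi m' = 0.
  move=> nC; rewrite /chi; case: ifPn => // /set_mem m'c; apply: b0.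
  rewrite leNgt; apply/negP => h; apply: nC; exists (cmap c m'); last by rewrite cmapK.
  exact: ltW.
exists chi, (cdom c `&` cmap c @^-1` [set z | `|z - cmap c m| < e / 2]), C; split=> //.
- move=> c' ac'; pose O1 := cmap c' @` (cdom c' `&` cdom c).
  pose O2 := cmap c' @` (cdom c' `&` ~` C).
  have oO1 : open O1 by apply: chart_image_open; exact: cdom_open.
  have oO2 : open O2 by apply: chart_image_open; exact: closed_openC.
  apply: smooth_cover => y yc'.
  have [yC|yC] := pselect (C (cinv c' y)).
    exists O1; first by apply: chart_imageP => //; apply: Uc; exact: CU.
    apply: (@eq_smooth _ _ _ _ (fun z => b (cmap c (cinv c' z)))) => //.
      by move=> _ [m' [m'c' m'c] <-]; rewrite /= cmapK // chi_in.
    apply: (smooth_comp_scalar (U' := setT)) => //; first exact: openT.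
    exact: atlas_compatible ac' ac.
  exists O2; first exact: chart_imageP.
  apply: (@eq_smooth _ _ _ _ (fun=> 0)) => //; last exact: smooth_cst.
  by move=> _ [m' [m'c' nC] <-]; rewrite /= cmapK // chi_out.
- split; last by split=> //=; rewrite subrr normr0 divr_gt0.
  apply: preimage_open_in; [exact: cdom_open|exact: cmap_continuous|].
  apply: open_nearP => z /= ze.
  near=> t; rewrite /=.
  near: t; apply: (@open_nbhs_nbhs _ z [set t | `|t - cmap c m| < e / 2]); split=> //.
  have -> : [set t | `|t - cmap c m| < e / 2] = ball (cmap c m) (e / 2).
    by apply/seteqP; split=> t; rewrite -ball_normE /= distrC.
  by apply: ball_open; rewrite divr_gt0.
- by move=> m' [m'c /= m'e]; rewrite chi_in // b1 // ltW.
Unshelve. all: by end_near. Qed.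

(** For each member of a countable base that is contained in some V m, keep one
    such m. *)
Lemma countable_subcover (V : M -> set M) (m0 : M) :
  (forall m, open (V m) /\ V m m) -> exists s : nat -> M, forall m, exists j, V (s j) m.
Proof.
move=> HV; have [B cB [Bo Bb]] := @manifold_second_countable R n M.
have [f fP] : exists f : nat -> set M, forall b, B b -> exists j, f j = b.
  have /countable_injP[g gi] := cB.
  exists (fun j => if pselect (exists b, B b /\ g b = j) is left e
                   then projT1 (cid e) else set0).
  move=> b Bb'; exists (g b); case: pselect => [e|]; last by case; exists b.
  by have [Be ge] := projT2 (cid e); apply: gi; rewrite ?inE.
pose P j m := f j `<=` V m.
pose s j := if pselect (exists m, P j m) is left e then projT1 (cid e) else m0.
exists s => m; have [oV Vm] := HV m.
have [b [Bb' bm] bV] := Bb m _ (open_nbhs_nbhs (conj oV Vm)).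
have [j fj] := fP b Bb'; exists j; rewrite /s; case: pselect => [e|]; last first.
  by case; exists m; rewrite /P fj.
by apply: (projT2 (cid e)); rewrite fj.
Qed.

(** With bumps chi_j equal to 1 on the sets V_j of a countable cover, take
      rho_i = chi_i * prod_(j < i) (1 - chi_j).
    The partial sums are 1 - prod_(j < i) (1 - chi_j). On V_j all terms after
    the j-th vanish and the first j + 1 add up to 1. *)
Lemma partition_of_unity (U : M -> set M) (m0 : M) :
  (forall m, [/\ open (U m), U m m & U m `<=` cdom (chart_at m)]) ->
  exists (ctr : nat -> M) (rho : nat -> M -> R) (C : nat -> set M),
   [/\ forall j, smooth_fun (rho j),
       forall j, closed (C j) /\ C j `<=` U (ctr j),
       forall j m, ~ C j m -> rho j m = 0 &
       forall m, exists i (V : set M), [/\ open V, V m & forall m', V m' ->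
         (forall j, (i <= j)%N -> rho j m' = 0) /\ \sum_(j < i) rho j m' = 1]].
Proof.
move=> HU.
have /choice[chi /choice[V /choice[C H]]] : forall m, exists (chi : M -> R) (V C : set M),
    [/\ smooth_fun chi, open V /\ V m, forall m', V m' -> chi m' = 1,
        closed C /\ C `<=` U m & forall m', ~ C m' -> chi m' = 0].
  move=> m; have [oU Um Uc] := HU m.
  exact: (@manifold_bump (chart_at m) m (U m) (chart_at_atlas m) oU Um Uc).
have [s sP] : exists s : nat -> M, forall m, exists j, V (s j) m.
  by apply: (countable_subcover m0) => m; have [_ []] := H m.
pose rest i m := \prod_(j < i) (1 - chi (s j) m).
pose rho i m := chi (s i) m * rest i m.
have sum1 i m : \sum_(j < i) rho j m = 1 - rest i m.
  elim: i => [|i IH]; first by rewrite /rest !big_ord0 subrr.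
  by rewrite big_ord_recr /= IH /rho /rest [in RHS]big_ord_recr /=; ring.
have srest i : smooth_fun (rest i).
  elim: i => [|i IH] c ac.
    apply: (@eq_smooth _ _ _ _ (fun=> (1 : R))); [exact: cimage_open| |exact: smooth_cst].
    by move=> y _; rewrite /= /rest big_ord0.
  apply: (@eq_smooth _ _ _ _ (fun y => (rest i \o cinv c) y * (1 + -1 * (chi (s i)
    \o cinv c) y))).
  - exact: cimage_open.
  - by move=> y _; rewrite /= /rest big_ord_recr /= mulN1r.
  - apply: smoothM; [exact: cimage_open|exact: IH|].
    apply: smoothD; [exact: cimage_open|exact: smooth_cst|].
    apply: smoothM; [exact: cimage_open|exact: smooth_cst|].
    by have [sc _ _ _ _] := H (s i); exact: sc.
exists s, rho, (fun j => C (s j)); split.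
- by move=> j; apply: smooth_funM => //; have [] := H (s j).
- by move=> j; have [] := H (s j).
- by move=> j m nC; have [_ _ _ _ h] := H (s j); rewrite /rho h ?mul0r.
move=> m; have [j Vj] := sP m.
exists j.+1, (V (s j)); have [_ [oV _] V1 _ _] := H (s j).
split=> // m' Vm'.
have r0 i : (j < i)%N -> rest i m' = 0.
  by move=> ji; rewrite /rest (bigD1 (Ordinal ji)) //= V1 // subrr mul0r.
split=> [i ji|]; first by rewrite /rho r0 ?mulr0.
by rewrite sum1 r0 // subr0.
Qed.

End PartitionOfUnity.

(** * Manifolds glued from coordinate pieces *)

Section Rational.
Context {R : realType} {n : nat}.

Definition rat_ball (q : 'rV[rat]_n * nat) : set 'rV[R]_n :=
  ball (map_mx ratr q.1 : 'rV[R]_n) q.2.+1%:R^-1.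

Lemma rat_ball_open q : open (rat_ball q).
Proof. by apply: ball_open; rewrite invr_gt0. Qed.

Lemma rat_ball_basis (x : 'rV[R]_n) (A : set 'rV[R]_n) : nbhs x A ->
  exists q, rat_ball q x /\ rat_ball q `<=` A.
Proof.
case/nbhs_ballP => e /= e0 eA.
pose N := Num.trunc (2 / e).
have Ne : N.+1%:R^-1 < e / 2.
  rewrite -[e / 2]invrK ltf_pV2 ?posrE ?invr_gt0 ?divr_gt0 //.
  by rewrite invfM invrK mulrC; exact: truncnS_gt.
have d0 : 0 < (N.+1%:R^-1 : R) by rewrite invr_gt0.
have /choice[q qP] i : exists q : rat, ratr q \in `](x 0 i - N.+1%:R^-1 / 2), (x 0 i)[.
  by apply: rat_in_itvoo; rewrite ltrBlDr ltrDl divr_gt0.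
pose Q : 'rV[rat]_n := \row_i q i.
have xQ : `|x - map_mx ratr Q| < N.+1%:R^-1.
  apply: (@le_lt_trans _ _ (N.+1%:R^-1 / 2)); last first.
    by rewrite ltr_pdivrMr // ltr_pMr // ltr1n.
  apply: rV_norm_le => [|i]; first by rewrite divr_ge0 // ltW.
  rewrite !mxE; have := qP i; rewrite in_itv /= => /andP[q1 q2].
  rewrite ger0_norm ?subr_ge0 ?(ltW q2) // lerBlDr -lerBlDl; exact: ltW.
exists (Q, N); split; rewrite /rat_ball /=.
  by rewrite -ball_normE /= distrC.
move=> y; rewrite -ball_normE /= => yQ; apply: eA; rewrite -ball_normE /=.
rewrite -(subrKA (map_mx ratr Q)); apply: le_lt_trans (ler_normD _ _) _.
by apply: lt_trans (ltrD xQ yQ) _; rewrite [e]splitr ltrD.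
Qed.

End Rational.

Section Gluing.
Context {R : realType} {p : nat}.

(** A set covered by pieces with coordinates. Distinct points of a common piece
    are separated in the coordinates; [gseparated] asks for disjoint open sets
    only for the other pairs. The piece [gcov t] provides the preferred chart
    at t. *)
Record gluing := Gluing {
  gpt : Type;
  gidx : Type;
  gdom : gidx -> set gpt;
  gmap : gidx -> gpt -> 'rV[R]_p;
  ginv : gidx -> 'rV[R]_p -> gpt;
  gcov : gpt -> gidx;
  gcov_dom : forall t, gdom (gcov t) t;
  gmapK : forall i t, gdom i t -> ginv i (gmap i t) = t;
  goverlap : forall i j, open (gmap i @` (gdom i `&` gdom j));
  gtransition : forall i j,
    smooth_on (gmap i @` (gdom i `&` gdom j)) (gmap j \o ginv i);
  gseparated : forall s t, s <> t -> (exists i, gdom i s /\ gdom i t) \/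
    (exists A B : set gpt, [/\ forall i, open (gmap i @` (gdom i `&` A)),
       forall i, open (gmap i @` (gdom i `&` B)), A s, B t & A `&` B = set0]);
  gcountable : exists s : nat -> gidx, forall t, exists k, gdom (s k) t
}.

Variable G : gluing.

(** A copy of the point set, to carry the topology of the pieces. *)
Definition glued : Type := gpt G.

HB.instance Definition _ := gen_eqMixin glued.
HB.instance Definition _ := gen_choiceMixin glued.

Definition glued_open (A : set glued) :=
  forall i, open (gmap i @` (gdom i `&` A)).

Lemma glued_imageE i (A : set glued) : gmap i @` (gdom i `&` A) =
  gmap i @` (gdom i `&` gdom i) `&` (ginv i @^-1` A).
Proof.
apply/seteqP; split=> [_ [t [ti At] <-]|y [[t [ti _] <-]]] /=.
  by rewrite gmapK //; split=> //; exists t.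
by rewrite gmapK // => At; exists t.
Qed.

Lemma glued_openT : glued_open setT.
Proof.
move=> i; have -> : gdom i `&` setT = gdom i `&` gdom i :> set (gpt G).
  by rewrite setIT setIid.
exact: goverlap.
Qed.

Lemma glued_openI : setI_closed glued_open.
Proof.
move=> A B oA oB i.
have -> : gmap i @` (gdom i `&` (A `&` B)) =
    (gmap i @` (gdom i `&` A)) `&` (gmap i @` (gdom i `&` B)).
  rewrite (glued_imageE i (A `&` B)) (glued_imageE i A) (glued_imageE i B).
  by rewrite preimage_setI setIACA !setIid.
exact: openI (oA i) (oB i).
Qed.

Lemma glued_open_bigU (I : Type) (f : I -> set glued) :
  (forall i, glued_open (f i)) -> glued_open (\bigcup_i f i).
Proof.
move=> of_ i.
have -> : gmap i @` (gdom i `&` \bigcup_j f j) =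
    \bigcup_j (gmap i @` (gdom i `&` f j)).
  apply/seteqP; split=> [_ [t [ti [j _ fj]] <-]|_ [j _ [t [ti fj] <-]]].
    by exists j => //; exists t.
  by exists t => //; split=> //; exists j.
by apply: bigcup_open => j _; exact: of_.
Qed.

HB.instance Definition _ := isOpenTopological.Build glued
  glued_openT glued_openI glued_open_bigU.

Lemma glued_openE (A : set glued) : open A = glued_open A.
Proof. by []. Qed.

Lemma gdom_open i : open (gdom i : set glued).
Proof. by rewrite glued_openE => j; exact: goverlap. Qed.

Lemma gimage_open i : open (gmap i @` (gdom i : set glued)).
Proof. by have := @goverlap G i i; rewrite setIid. Qed.

Lemma gmap_preimage_open i (A : set 'rV[R]_p) : open A ->
  open ((gdom i `&` gmap i @^-1` A) : set glued).
Proof.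
move=> oA; rewrite glued_openE => j.
have -> : gmap j @` (gdom j `&` (gdom i `&` gmap i @^-1` A)) =
   (gmap j @` (gdom j `&` gdom i)) `&` ((gmap i \o ginv j) @^-1` A).
  apply/seteqP; split=> [_ [t [tj [ti At]] <-]|y [[t [tj ti] <-]]] /=.
    by rewrite gmapK //; split=> //; exists t.
  by rewrite gmapK // => At; exists t.
apply: (@preimage_open_in _ _ (gmap i \o ginv j) (gmap j @` (gdom j `&` gdom i)) A).
- exact: goverlap.
- by move=> y; exact: smooth_continuous (@gtransition G j i).
- exact: oA.
Qed.

Lemma gmap_continuous i (t : glued) : gdom i t -> {for t, continuous (gmap i : glued -> _)}.
Proof.
move=> ti A; rewrite nbhsE => -[B [oB Bt] BA].
have N : nbhs (t : glued) (gdom i `&` gmap i @^-1` B).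
  by apply: open_nbhs_nbhs; split=> //; exact: gmap_preimage_open.
have FF : Filter (nbhs (t : glued)) := @nbhs_filter glued t.
by apply: (@filterS _ _ FF _ _ _ N) => s [_ /BA].
Qed.

Lemma ginv_continuous i y : (gmap i @` (gdom i : set glued)) y ->
  {for y, continuous (ginv i : _ -> glued)}.
Proof.
move=> [t ti <-] A; rewrite gmapK // nbhsE => -[B [oB Bt] BA].
apply: (@filterS _ _ _ (gmap i @` (gdom i `&` B))) => [_ [s [si Bs] <-]|].
  by apply: BA; rewrite gmapK.
by apply: open_nbhs_nbhs; split; [exact: oB|exists t].
Qed.

Definition glued_chart i : chart R p glued :=
  @Chart R p glued (gdom i) (gmap i) (ginv i) (@gdom_open i) (@gimage_open i)
    (@gmapK G i) (@gmap_continuous i) (@ginv_continuous i).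

Lemma glued_hausdorff : hausdorff_space glued.
Proof.
rewrite open_hausdorff => s t /eqP st.
have [[i [si ti]]|[A [B [oA oB As Bt AB]]]] := gseparated st; last first.
  by exists (A, B); rewrite ?inE //; split=> //; exact/eqP.
have : gmap i s != gmap i t.
  by apply/eqP => E; apply: st; rewrite -(gmapK si) E gmapK.
have := @norm_hausdorff R 'rV[R]_p; rewrite open_hausdorff => H /H.
move=> [[A B] /= []]; rewrite !inE => As Bt [oA oB AB].
have E : (gdom i `&` gmap i @^-1` A) `&` (gdom i `&` gmap i @^-1` B) = set0 :> set glued.
  rewrite -subset0 => u [[_ Au] [_ Bu]].
  by have : (A `&` B) (gmap i u) by []; rewrite AB.
exists (gdom i `&` gmap i @^-1` A, gdom i `&` gmap i @^-1` B); rewrite /= ?inE //.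
split; [exact: gmap_preimage_open|exact: gmap_preimage_open|].
exact: E.
Qed.

Lemma glued_second_countable : @second_countable glued.
Proof.
have [s sP] := gcountable G.
pose W (kq : nat * ('rV[rat]_p * nat)) : set glued :=
  gdom (s kq.1) `&` gmap (s kq.1) @^-1` (rat_ball kq.2).
exists (range W).
  by apply: sub_countable (card_image_le _ _) _; exact: countableP.
split=> [_ [kq _ <-]|t A]; first by apply: gmap_preimage_open; exact: rat_ball_open.
rewrite nbhsE => -[B [oB Bt] BA].
have [k kt] := sP t.
have [q [qt qB]] : exists q, rat_ball q (gmap (s k) t) /\
    rat_ball q `<=` gmap (s k) @` (gdom (s k) `&` B).
  apply: rat_ball_basis; apply: open_nbhs_nbhs; split; [exact: oB|by exists t].
exists (W (k, q)); first by split=> //; exists (k, q).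
move=> u [/= uk /qB[v [vk Bv] E]]; apply: BA.
by rewrite -(gmapK uk) -E gmapK.
Qed.

Definition glued_manifold : manifold R p :=
  @Manifold R p glued glued_hausdorff glued_second_countable
    (range glued_chart) (fun t => glued_chart (gcov t))
    (fun t => ex_intro2 _ _ (gcov t) I erefl)
    (@gcov_dom G)
    (fun c c' ac ac' => match ac, ac' with
       ex_intro2 i _ E, ex_intro2 j _ E' =>
         match E in _ = c, E' in _ = c' return
           smooth_on (cmap c @` (cdom c `&` cdom c')) (cmap c' \o cinv c) with
         erefl, erefl => @gtransition G i j end end).

End Gluing.

(** * The exterior derivative of a one-form *)

Section ExteriorDerivative.
Context {R : realType}.

Lemma smooth_entry (V : normedModType R) m n (U : set V) (f : V -> 'M[R]_(m, n)) i j :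
  open U -> smooth_on U f -> smooth_on U (fun x => f x i j).
Proof. by move=> oU Hf; exact: ((smooth_mxP _ oU).1 Hf i j). Qed.

Lemma derive_entry (V : normedModType R) m n (U : set V) (f : V -> 'M[R]_(m, n)) x v i j :
  open U -> smooth_on U f -> U x -> ('D_v f x) i j = 'D_v (fun z => f z i j) x.
Proof.
by move=> oU Hf Ux; rewrite (derive_mx (smooth_derivable (v:=v) Hf Ux)) mxE.
Qed.

Lemma jacobian_derive n m (U : set 'rV[R]_n) (f : 'rV[R]_n -> 'rV[R]_m) x v :
  open U -> smooth_on U f -> U x -> v *m 'J f x = 'D_v f x.
Proof.
move=> oU Hf Ux; rewrite (deriveE _ (smooth_differentiable oU Hf Ux)).
by rewrite jacobianE.
Qed.

Lemma jacobian_entry n m (U : set 'rV[R]_n) (f : 'rV[R]_n -> 'rV[R]_m) x i j :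
  open U -> smooth_on U f -> U x ->
  'J f x i j = 'D_(delta_mx 0 i) (fun z => f z 0 j) x.
Proof.
move=> oU Hf Ux; rewrite -(derive_entry _ _ _ oU Hf Ux).
by rewrite -(jacobian_derive _ oU Hf Ux) -rowE [RHS]mxE.
Qed.

Lemma derive_sum_smooth (V : normedModType R) (U : set V) m (F : 'I_m -> V -> R) x v :
  open U -> (forall i, smooth_on U (F i)) -> U x ->
  'D_v (fun z => \sum_i F i z) x = \sum_i 'D_v (F i) x.
Proof.
move=> oU HF Ux; have -> : (fun z => \sum_i F i z) = \sum_i F i.
  by apply/funext => z; rewrite fct_sumE.
by rewrite derive_sum // => i; exact: smooth_derivable (HF i) Ux.
Qed.

Lemma deriveM_smooth (V : normedModType R) (U : set V) (f g : V -> R) x v :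
  smooth_on U f -> smooth_on U g -> U x ->
  'D_v (fun z => f z * g z) x = f x * 'D_v g x + g x * 'D_v f x.
Proof.
move=> Hf Hg Ux.
exact: (deriveM (smooth_derivable (v:=v) Hf Ux) (smooth_derivable (v:=v) Hg Ux)).
Qed.

Lemma derive_near (V W : normedModType R) (U : set V) (f g : V -> W) x v :
  open U -> (forall z, U z -> f z = g z) -> U x -> 'D_v f x = 'D_v g x.
Proof. by move=> oU fg Ux; apply: near_eq_derive; exact: near_open_eq Ux. Qed.

Lemma schwarz_smooth (V : normedModType R) (U : set V) (f : V -> R) x u v :
  open U -> smooth_on U f -> U x ->
  'D_v (fun y => 'D_u f y) x = 'D_u (fun y => 'D_v f y) x.
Proof. by move=> oU Hf; exact: schwarz oU (Hf 2%N). Qed.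

(** The matrix of d th, for the one-form with coefficients th; see
    [form2_ext1]. *)
Definition ext1 p (th : 'rV[R]_p -> 'rV[R]_p) (y : 'rV[R]_p) : 'M[R]_p :=
  'J th y - ('J th y)^T.

Lemma ext1_skew p (th : 'rV[R]_p -> 'rV[R]_p) y : (ext1 th y)^T = - ext1 th y.
Proof. by rewrite /ext1 linearB /= trmxK opprB. Qed.

Lemma smooth_ext1 p (U : set 'rV[R]_p) th : open U -> smooth_on U th ->
  smooth_on U (@ext1 p th).
Proof.
move=> oU Hth; have HJ := smooth_jacobian oU Hth.
apply: (@eq_smooth _ _ _ _ (fun y => 'J th y + (-1) *: ('J th y)^T)) => //.
  by move=> y _; rewrite scaleN1r.
apply: smoothD => //; apply: smooth_scalemx => //; first exact: smooth_cst.
exact: smooth_tr.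
Qed.

(** Exterior derivatives commute with pullbacks. The Jacobian of the pulled-back
    form contains second derivatives of G; they make up a symmetric matrix,
    which disappears from the difference with the transpose. *)
Lemma ext1_natural p (U U' : set 'rV[R]_p) (G th0 th1 : 'rV[R]_p -> 'rV[R]_p) y :
  open U -> open U' -> (forall z, U z -> U' (G z)) ->
  smooth_on U G -> smooth_on U' th1 ->
  (forall z, U z -> th0 z = th1 (G z) *m ('J G z)^T) -> U y ->
  ext1 th0 y = 'J G y *m ext1 th1 (G y) *m ('J G y)^T.
Proof.
move=> oU oU' GU HG H1 E Uy.
have H1G : smooth_on U (fun z => th1 (G z)) by apply: smooth_comp H1.
have HJ := smooth_jacobian oU HG.
have H0 : smooth_on U th0.
  apply: (@eq_smooth _ _ _ _ (fun z => th1 (G z) *m ('J G z)^T)) => //.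
    by move=> z /E.
  by apply: smooth_mulmx => //; exact: smooth_tr.
have JGl z j l : U z -> 'J G z j l = 'D_(delta_mx 0 j) (fun z => G z 0 l) z.
  by move=> Uz; rewrite (jacobian_entry _ _ oU HG Uz).
(* The part of the Jacobian of th0 where G is differentiated twice. *)
pose S := \matrix_(i, j) \sum_l th1 (G y) 0 l *
  'D_(delta_mx 0 i) (fun z => 'D_(delta_mx 0 j) (fun z => G z 0 l) z) y.
have ST : S^T = S.
  apply/matrixP => i j; rewrite mxE [LHS]mxE [RHS]mxE.
  apply: eq_bigr => l _.
  exact: (congr1 (fun t => th1 (G y) 0 l * t)
            (schwarz_smooth _ _ oU (smooth_entry 0 l oU HG) Uy)).
suff J0 : 'J th0 y = 'J G y *m 'J th1 (G y) *m ('J G y)^T + S.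
  rewrite /ext1 J0 linearD /= ST !trmx_mul trmxK mulmxBr mulmxBl !mulmxA.
  by rewrite opprD addrACA subrr addr0.
apply/matrixP => i j; rewrite (jacobian_entry _ _ oU H0 Uy).
rewrite (@derive_near _ _ U _ (fun z => \sum_l th1 (G z) 0 l * 'J G z j l)) //; last first.
  by move=> z /E ->; rewrite mxE; apply: eq_bigr => l _; rewrite [X in _ * X]mxE.
rewrite (derive_sum_smooth _ oU) //; last first.
  by move=> l; apply: smoothM => //; exact: smooth_entry.
rewrite mxE mxE [S i j]mxE -big_split /=; apply: eq_bigr => l _.
rewrite (@deriveM_smooth _ U) //; [|exact: smooth_entry|exact: smooth_entry].
rewrite [RHS]addrC; congr (_ + _).
  exact: (congr1 (fun t => th1 (G y) 0 l * t)
            (derive_near (delta_mx 0 i) oU (fun z Uz => JGl z j l Uz) Uy)).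
rewrite mulrC [X in _ = _ * X]mxE; congr (_ * _).
have := jacobian_comp (smooth_differentiable oU HG Uy)
  (smooth_differentiable oU' H1 (GU _ Uy)).
move=> Jc; rewrite -[RHS](congr1 (fun A : 'M[R]_(p, p) => A i l) Jc).
by rewrite (jacobian_entry (f := th1 \o G) _ _ oU H1G Uy).
Qed.

Lemma form2_ext1 p (U : set 'rV[R]_p) th (a b : 'rV[R]_p) y :
  open U -> smooth_on U th -> U y ->
  (a *m ext1 th y *m b^T) 0 0 =
  'D_a (fun z => (th z *m b^T) 0 0) y - 'D_b (fun z => (th z *m a^T) 0 0) y.
Proof.
move=> oU Hth Uy.
have key (u v : 'rV[R]_p) : (u *m 'J th y *m v^T) 0 0 = 'D_u (fun z => (th z *m v^T) 0 0) y.
  rewrite (jacobian_derive _ oU Hth Uy) mxE.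
  rewrite (@derive_near _ _ U _ (fun z => \sum_l th z 0 l * v^T l 0)) //; last first.
    by move=> z _; rewrite mxE.
  rewrite (derive_sum_smooth _ oU) //; last first.
    by move=> l; apply: smoothM => //; [exact: smooth_entry|exact: smooth_cst].
  apply: eq_bigr => l _; rewrite (@deriveM_smooth _ U) //.
  - by rewrite derive_cst mulr0 add0r mulrC (derive_entry _ _ _ oU Hth Uy).
  - exact: smooth_entry.
  - exact: smooth_cst.
have subE (A B : 'M[R]_1) : (A - B) 0 0 = A 0 0 - B 0 0 by rewrite !mxE.
rewrite /ext1 mulmxBr mulmxBl subE key; congr (_ - _).
rewrite -key; have trE (A : 'M[R]_1) : A^T 0 0 = A 0 0 by rewrite mxE.
by rewrite -[RHS]trE !trmx_mul trmxK mulmxA.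
Qed.

(** Each mixed second derivative of the coefficients occurs twice, with opposite
    signs. *)
Lemma ext1_closed p (U : set 'rV[R]_p) th (v : 'I_3 -> 'rV[R]_p) y :
  open U -> smooth_on U th -> U y ->
  \sum_(i < 3) (-1) ^+ i *
    'D_(v i) (fun z => form2 (ext1 th z) (fun j => v (lift i j))) y = 0.
Proof.
move=> oU Hth Uy.
pose f i z := (th z *m (v i)^T) 0 0.
have Hf i : smooth_on U (f i).
  by apply: smooth_entry => //; apply: smooth_mulmx => //; exact: smooth_cst.
pose D2 (i a b : 'I_3) : R := 'D_(v i) (fun z => 'D_(v a) (f b) z) y.
have D2C i a b : D2 i a b = D2 a i b := schwarz_smooth (v a) (v i) oU (Hf b) Uy.
have E (i a b : 'I_3) : lift i (ord0 : 'I_2) = a -> lift i (ord_max : 'I_2) = b ->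
    'D_(v i) (fun z => form2 (ext1 th z) (fun j => v (lift i j))) y =
    D2 i a b - D2 i b a.
  move=> Ea Eb.
  rewrite [LHS](@derive_near _ _ U _ ((fun z => 'D_(v a) (f b) z) - (fun z => 'D_(v b)
    (f a) z))) //.
    have d c e := smooth_derivable (v:=v i) (smooth_derive (v c) (Hf e)) Uy.
    by rewrite (deriveB (d a b) (d b a)).
  by move=> z Uz; rewrite /form2 Ea Eb (form2_ext1 _ _ oU Hth Uz).
pose i0 : 'I_3 := ord0; pose i2 : 'I_3 := ord_max.
pose i1 : 'I_3 := lift ord0 ord0.
rewrite !big_ord_recl big_ord0.
rewrite (E _ i1 i2); [|exact: val_inj|exact: val_inj].
rewrite (E _ i0 i2); [|exact: val_inj|exact: val_inj].
rewrite (E _ i0 i1); [|exact: val_inj|exact: val_inj].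
have -> : lift ord0 (lift ord0 ord0) = i2 by exact: val_inj.
rewrite -/i0 -/i1 (D2C i1 i0 i2) (D2C i2 i0 i1) (D2C i2 i1 i0).
move: (D2 i0 i1 i2) (D2 i0 i2 i1) (D2 i1 i2 i0) => a b c.
rewrite /= /bump /=; ring.
Qed.

End ExteriorDerivative.

(** * Kernels of matrices depending on parameters *)

Section KernelFrame.
Context {R : fieldType} {n q k : nat}.
Implicit Types A : 'M[R]_(n, q).

(** The rows of E form a basis of the left kernel of A, F reads off coordinates in
    this basis, and L inverts A on a complement of the kernel. *)
Lemma kernel_frame_data A : (\rank A + k = n)%N ->
  exists (L : 'M[R]_(q, n)) (E : 'M[R]_(k, n)) (F : 'M[R]_(n, k)),
    A *m L + F *m E = 1%:M.
Proof.
move=> rA; have rK : \rank (kermx A) = k by rewrite mxrank_ker -{1}rA addKn.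
have [E rE KE] : exists2 E : 'M[R]_(k, n), row_free E & (kermx A <= E)%MS.
  have : exists2 E : 'M[R]_(\rank (kermx A), n), row_free E & (kermx A <= E)%MS.
    by exists (row_base (kermx A)); [exact: row_base_free|rewrite eq_row_base].
  by rewrite rK.
pose P := 1%:M - pinvmx E *m E.
have KP : kermx A *m P = 0.
  by rewrite mulmxBr mulmx1 mulmxA mulmxKpV // subrr.
have AP : A *m (pinvmx A *m P) = P.
  apply/eqP; rewrite -subr_eq0 -opprB oppr_eq0 mulmxA -{1}[P]mul1mx -mulmxBl.
  have /submxP[D ->] : (1%:M - A *m pinvmx A <= kermx A)%MS.
    by rewrite sub_kermx mulmxBl mul1mx mulmxKpV // subrr.
  by rewrite -mulmxA KP mulmx0.
by exists (pinvmx A *m P), E, (pinvmx E); rewrite AP subrK.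
Qed.

Variables (L : 'M[R]_(q, n)) (E0 : 'M[R]_(k, n)) (F : 'M[R]_(n, k)).

Definition frame_mx A : 'M[R]_n := A *m L + F *m E0.
(** If v A = 0, then v (frame_mx A) = v F E0. Hence, as long as [frame_mx A] is
    invertible, which is an open condition on A, the rows of [kernel_frame A]
    span the left kernel of A, and they are rational functions of A. *)
Definition kernel_frame A : 'M[R]_(k, n) := E0 *m invmx (frame_mx A).

Variable A : 'M[R]_(n, q).
Hypothesis rA : (\rank A + k = n)%N.
Hypothesis uA : frame_mx A \in unitmx.

Lemma kernel_frame_coord m (v : 'M[R]_(m, n)) : v *m A = 0 ->
  v = v *m F *m kernel_frame A.
Proof.
move=> vA; rewrite /kernel_frame mulmxA -[v in LHS](mulmxK uA); congr (_ *m _).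
by rewrite /frame_mx mulmxDr mulmxA vA mul0mx add0r mulmxA.
Qed.

Lemma kernel_frame_eqmx : (kernel_frame A :=: kermx A)%MS.
Proof.
have rK : \rank (kermx A) = k by rewrite mxrank_ker -{1}rA addKn.
have sub : (kermx A <= kernel_frame A)%MS.
  by rewrite (kernel_frame_coord (mulmx_ker A)) submxMl.
apply/eqmxP; rewrite sub andbT -(geq_leqif (mxrank_leqif_sup sub)) rK.
exact: rank_leq_row.
Qed.

Lemma kernel_frame_ker : kernel_frame A *m A = 0.
Proof. by apply/eqP; rewrite -sub_kermx kernel_frame_eqmx. Qed.

Lemma kernel_frameK : kernel_frame A *m F = 1%:M.
Proof.
have fE : row_free (kernel_frame A).
  by rewrite /row_free kernel_frame_eqmx mxrank_ker -{1}rA addKn.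
apply: (row_free_inj fE); rewrite mul1mx.
by rewrite -kernel_frame_coord //; exact: kernel_frame_ker.
Qed.

End KernelFrame.

(** * Forms on a manifold in the coordinates of a chart *)

Lemma rank_ker_eq (F : fieldType) n q (A B : 'M[F]_(n, q)) :
  \rank (kermx A) = \rank (kermx B) -> \rank A = \rank B.
Proof.
rewrite !mxrank_ker => E.
by rewrite -(subKn (rank_leq_row A)) E subKn // rank_leq_row.
Qed.

Section Tensors.
Context {R : realType} {n : nat} {M : manifold R n}.
Implicit Types (c : chart R n M) (m : M) (W : set M).

Definition transition c c' : 'rV[R]_n -> 'rV[R]_n := cmap c' \o cinv c.

(** Takes the coordinates of a tangent vector at m, as a row, from the chart c to
    the chart c'. Locked, because conversion should not unfold differentials. *)
Definition transition_mx c c' m : 'M[R]_n := locked ('J (transition c c') (cmap c m)).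

Lemma transition_mxE c c' m : transition_mx c c' m = 'J (transition c c') (cmap c m).
Proof. by rewrite /transition_mx -lock. Qed.

Lemma transition_smooth c c' : @atlas R n M c -> @atlas R n M c' ->
  smooth_on (cmap c @` (cdom c `&` cdom c')) (transition c c').
Proof. exact: atlas_compatible. Qed.

Lemma overlap_open c W : open W -> open (cmap c @` (cdom c `&` W)).
Proof. exact: chart_image_open. Qed.
Arguments overlap_open : clear implicits.

Lemma transition_differentiable c c' m : @atlas R n M c -> @atlas R n M c' ->
  cdom c m -> cdom c' m -> differentiable (transition c c') (cmap c m).
Proof.
move=> ac ac' mc mc'.
have Um : (cmap c @` (cdom c `&` cdom c')) (cmap c m) by exists m.
exact (smooth_differentiable (overlap_open c _ (@cdom_open _ _ _ c'))
  (transition_smooth ac ac') Um).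
Qed.

Lemma transitionE c c' m : cdom c m -> transition c c' (cmap c m) = cmap c' m.
Proof. by move=> mc; rewrite /transition /= cmapK. Qed.

Lemma transition_mx_comp c c' c'' m : @atlas R n M c -> @atlas R n M c' -> @atlas R n M c'' ->
  cdom c m -> cdom c' m -> cdom c'' m -> transition_mx c c' m *m transition_mx c' c'' m =
    transition_mx c c'' m.
Proof.
move=> ac ac' ac'' mc mc' mc''.
pose O := cmap c @` (cdom c `&` (cdom c' `&` cdom c'')).
have oO : open O by apply: overlap_open; apply: openI; exact: cdom_open.
have sO : smooth_on O (transition c c'').
  apply: smooth_sub (transition_smooth ac ac'') => _ [m' [h [h' h'']] <-].
  by exists m'.
have E y : O y -> transition c c'' y = (transition c' c'' \o transition c c') y.
  by move=> [m' [h [h' h'']] <-]; rewrite [RHS]/= !transitionE.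
have Om : O (cmap c m) by exists m.
rewrite !transition_mxE (near_eq_jacobian oO sO E Om) jacobian_comp.
- by rewrite transitionE.
- exact: transition_differentiable.
- by rewrite transitionE //; exact: transition_differentiable.
Qed.

Lemma transition_mx_id c m : @atlas R n M c -> cdom c m -> transition_mx c c m = 1%:M.
Proof.
move=> ac mc; rewrite transition_mxE.
have <- := jacobian_id (cmap c m).
apply: esym; apply: (near_eq_jacobian (@cimage_open _ _ _ c)); [exact: smooth_id| |by exists m].
by move=> _ [m' h <-]; rewrite transitionE.
Qed.

Lemma transition_mxK c c' m : @atlas R n M c -> @atlas R n M c' -> cdom c m -> cdom c' m ->
  transition_mx c c' m *m transition_mx c' c m = 1%:M.
Proof. by move=> ac ac' mc mc'; rewrite transition_mx_comp // transition_mx_id. Qed.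

(** Only the chart c is involved, since the matrices considered depend
    themselves on a choice of charts. *)
Definition smooth_in c W p q (f : M -> 'M[R]_(p, q)) :=
  smooth_on (cmap c @` (cdom c `&` W)) (f \o cinv c).

Lemma smooth_in_sub c W W' p q (f : M -> 'M[R]_(p, q)) : W `<=` W' ->
  smooth_in c W' f -> smooth_in c W f.
Proof. by move=> s; apply: smooth_sub => _ [m [h /s h'] <-]; exists m. Qed.

Lemma smooth_in_change c c' W p q (f : M -> 'M[R]_(p, q)) :
  @atlas R n M c -> @atlas R n M c' -> open W -> W `<=` cdom c' ->
  smooth_in c' W f -> smooth_in c W f.
Proof.
move=> ac ac' oW Wc' sf.
apply: (@eq_smooth _ _ _ _ (fun y => (f \o cinv c') (transition c c' y))).
- exact: overlap_open.
- by move=> _ [m [h h'] <-]; rewrite transitionE //= !cmapK //; exact: Wc'.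
apply: (smooth_comp (overlap_open c _ oW) (overlap_open c' _ oW)) sf.
  by move=> _ [m [h h'] <-]; rewrite transitionE //; exists m => //; split=> //; exact: Wc'.
apply: smooth_sub (transition_smooth ac ac') => _ [m [h h'] <-].
by exists m => //; split=> //; exact: Wc'.
Qed.

Lemma smooth_in_transition_mx c c' : @atlas R n M c -> @atlas R n M c' ->
  smooth_in c (cdom c') (transition_mx c c').
Proof.
move=> ac ac'; have oO := overlap_open c _ (@cdom_open _ _ _ c').
apply: (@eq_smooth _ _ _ _ (fun y => 'J (transition c c') y)).
- exact: oO.
- by move=> _ [m [h h'] <-]; rewrite /= transition_mxE cmapK.
- exact: (smooth_jacobian oO (transition_smooth ac ac')).
Qed.

Lemma smooth_in_mul c W p q r (f : M -> 'M[R]_(p, q)) (g : M -> 'M[R]_(q, r)) :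
  open W -> smooth_in c W f -> smooth_in c W g ->
  smooth_in c W (fun m => f m *m g m).
Proof. by move=> oW; apply: smooth_mulmx; exact: overlap_open. Qed.

Lemma smooth_in_cst c W p q (A : 'M[R]_(p, q)) : smooth_in c W (fun=> A).
Proof. exact: smooth_cst. Qed.

Lemma smooth_in_transition_mx_inv c c' W : @atlas R n M c -> @atlas R n M c' -> open W ->
  W `<=` cdom c -> W `<=` cdom c' -> smooth_in c W (transition_mx c' c).
Proof.
move=> ac ac' oW Wc Wc'; apply: (smooth_in_change ac ac') => //.
apply: smooth_in_sub (smooth_in_transition_mx ac' ac); exact: Wc.
Qed.

Section Forms.
Variables (eta : kform M 1) (omega : kform M 2).

(** The matrix of omega at m in the coordinates of c; the form itself is given in
    those of [chart_at m]. *)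
Definition omega_mx c m : 'M[R]_n :=
  locked (transition_mx c (chart_at m) m *m form2_mx (omega m)
    *m (transition_mx c (chart_at m) m)^T).

Definition eta_mx c m : 'cV[R]_n :=
  locked (transition_mx c (chart_at m) m *m form1_mx (eta m)).

Lemma omega_mxE c m : omega_mx c m =
  transition_mx c (chart_at m) m *m form2_mx (omega m) *m (transition_mx c (chart_at m) m)^T.
Proof. by rewrite /omega_mx -lock. Qed.

Lemma eta_mxE c m : eta_mx c m = transition_mx c (chart_at m) m *m form1_mx (eta m).
Proof. by rewrite /eta_mx -lock. Qed.

Lemma omega_mx_change c c' m : @atlas R n M c -> @atlas R n M c' -> cdom c m -> cdom c' m ->
  omega_mx c m = transition_mx c c' m *m omega_mx c' m *m (transition_mx c c' m)^T.
Proof.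
move=> ac ac' mc mc'; have am := chart_at_atlas m; have dm := chart_at_dom m.
by rewrite !omega_mxE -(transition_mx_comp ac ac' am mc mc' dm) trmx_mul !mulmxA.
Qed.

Lemma eta_mx_change c c' m : @atlas R n M c -> @atlas R n M c' -> cdom c m -> cdom c' m ->
  eta_mx c m = transition_mx c c' m *m eta_mx c' m.
Proof.
move=> ac ac' mc mc'; have am := chart_at_atlas m; have dm := chart_at_dom m.
by rewrite !eta_mxE -(transition_mx_comp ac ac' am mc mc' dm) !mulmxA.
Qed.

Lemma omega_mx_chart_at m : omega_mx (chart_at m) m = form2_mx (omega m).
Proof.
rewrite omega_mxE transition_mx_id; [|exact: chart_at_atlas|exact: chart_at_dom].
by rewrite trmx1 mul1mx mulmx1.
Qed.

Lemma eta_mx_chart_at m : eta_mx (chart_at m) m = form1_mx (eta m).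
Proof.
rewrite eta_mxE transition_mx_id; [|exact: chart_at_atlas|exact: chart_at_dom].
by rewrite mul1mx.
Qed.

Lemma omega_mx_skew c m : (omega_mx c m)^T = - omega_mx c m.
Proof.
have S := form2_mx_skew (@form_multilinear _ _ _ _ omega m) (@form_alternating _ _ _ _ omega m).
by rewrite omega_mxE !trmx_mul trmxK S mulNmx mulmxN mulmxA.
Qed.

Lemma chart_tangentE c y u : (cmap c @` cdom c) y ->
  chart_tangent c y u = u *m transition_mx c (chart_at (cinv c y)) (cinv c y).
Proof. by move=> cy; rewrite /chart_tangent transition_mxE cinvK // jacobianE. Qed.

Lemma local_omegaE c y v : (cmap c @` cdom c) y ->
  local_form omega c y v = form2 (omega_mx c (cinv c y)) v.
Proof.
move=> cy; rewrite /local_form.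
rewrite (form2_mxE _ (@form_multilinear _ _ _ _ omega (cinv c y))).
have -> : (fun j => chart_tangent c y (v j)) =
    (fun j => v j *m transition_mx c (chart_at (cinv c y)) (cinv c y)).
  by apply/funext => j; exact: chart_tangentE.
by rewrite form2_mul omega_mxE.
Qed.

Lemma local_etaE c y v : (cmap c @` cdom c) y ->
  local_form eta c y v = form1 (eta_mx c (cinv c y)) v.
Proof.
move=> cy; rewrite /local_form.
rewrite (form1_mxE _ (@form_multilinear _ _ _ _ eta (cinv c y))).
have -> : (fun j => chart_tangent c y (v j)) =
    (fun j => v j *m transition_mx c (chart_at (cinv c y)) (cinv c y)).
  by apply/funext => j; exact: chart_tangentE.
by rewrite form1_mul eta_mxE.
Qed.

Lemma form2_delta p (A : 'M[R]_p) i j :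
  form2 A (tnth [tuple delta_mx 0 i; delta_mx 0 j]) = A i j.
Proof. by rewrite /form2 /= trmx_delta -rowE -colE !mxE. Qed.

Lemma form1_delta p (A : 'cV[R]_p) i :
  form1 A (tnth [tuple delta_mx 0 i]) = A i 0.
Proof. by rewrite /form1 /= -rowE mxE. Qed.

Lemma smooth_omega_mx c W : @atlas R n M c -> open W -> smooth_in c W (omega_mx c).
Proof.
move=> ac oW; have oO := overlap_open c _ oW.
apply: (smooth_sub (@chart_image_sub _ _ _ c W)).
apply/(smooth_mxP _ (@cimage_open _ _ _ c)) => i j.
apply: eq_smooth (form_smooth (k:=2) omega
  (tnth [tuple delta_mx 0 i; delta_mx 0 j]) ac); first exact: cimage_open.
by move=> y cy; rewrite local_omegaE // form2_delta.
Qed.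

Lemma smooth_eta_mx c W : @atlas R n M c -> open W -> smooth_in c W (eta_mx c).
Proof.
move=> ac oW; have oO := overlap_open c _ oW.
apply: (smooth_sub (@chart_image_sub _ _ _ c W)).
apply/(smooth_mxP _ (@cimage_open _ _ _ c)) => i j.
apply: eq_smooth (form_smooth (k:=1) eta
  (tnth [tuple delta_mx 0 i]) ac); first exact: cimage_open.
by move=> y cy; rewrite local_etaE // form1_delta ord1.
Qed.

(** Its left kernel is ker eta /\ ker omega in the coordinates of c. *)
Definition forms_mx c m : 'M[R]_(n, n + 1) := row_mx (omega_mx c m) (eta_mx c m).

Lemma forms_mx_ker_change c c' m p (v : 'M[R]_(p, n)) :
  @atlas R n M c -> @atlas R n M c' -> cdom c m -> cdom c' m ->
  v *m forms_mx c m = 0 -> (v *m transition_mx c c' m) *m forms_mx c' m = 0.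
Proof.
move=> ac ac' mc mc'; rewrite /forms_mx !mul_mx_row -!row_mx0 => /eq_row_mx[].
rewrite (omega_mx_change ac ac' mc mc') (eta_mx_change ac ac' mc mc') !mulmxA => v1 v2.
congr row_mx; last exact: v2.
have := congr1 (mulmx^~ (transition_mx c' c m)^T) v1.
by rewrite mul0mx -mulmxA -trmx_mul (transition_mxK ac' ac mc' mc) trmx1 mulmx1.
Qed.

Lemma forms_mx_rank c m : @atlas R n M c -> cdom c m ->
  \rank (forms_mx c m) = \rank (forms_mx (chart_at m) m).
Proof.
move=> ac mc.
have am := chart_at_atlas m; have dm := chart_at_dom m.
suff le c1 c2 : @atlas R n M c1 -> @atlas R n M c2 -> cdom c1 m -> cdom c2 m ->
    (\rank (kermx (forms_mx c1 m)) <= \rank (kermx (forms_mx c2 m)))%N.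
  have E : \rank (kermx (forms_mx c m)) = \rank (kermx (forms_mx (chart_at m) m)).
    by apply/eqP; rewrite eqn_leq; apply/andP; split; apply: le.
  exact: rank_ker_eq E.
move=> a1 a2 d1 d2.
have : (kermx (forms_mx c1 m) *m transition_mx c1 c2 m <= kermx (forms_mx c2 m))%MS.
  by rewrite sub_kermx (forms_mx_ker_change a1 a2 d1 d2) ?mulmx_ker.
move/mxrankS; apply: leq_trans.
have fJ : row_free (transition_mx c1 c2 m).
  by apply/row_freeP; exists (transition_mx c2 c1 m); exact: transition_mxK.
by rewrite mxrankMfree.
Qed.

Lemma smooth_forms_mx c W : @atlas R n M c -> open W -> smooth_in c W (forms_mx c).
Proof.
move=> ac oW; apply: smooth_row_mx; first exact: overlap_open.
- exact: smooth_omega_mx.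
- exact: smooth_eta_mx.
Qed.

End Forms.
End Tensors.

(** * The kernel bundle and a projection onto it *)

(** This and the next lemmas isolate the matrix algebra of the kernel bundle: the
    J stand for transition matrices, E for bases of the kernel and F for the
    coordinates in these bases. *)
Lemma cocycle_mx (F : fieldType) (k l n p q r : nat) (X : 'M[F]_(k, n)) (J21 : 'M[F]_(n, p))
    (F1 : 'M[F]_(p, l)) (E1 : 'M[F]_(l, p)) (J10 : 'M[F]_(p, q)) (F0 : 'M[F]_(q, r)) J20 :
  X *m J21 *m F1 *m E1 = X *m J21 -> J21 *m J10 = J20 ->
  X *m J21 *m F1 *m (E1 *m J10 *m F0) = X *m J20 *m F0.
Proof. by move=> H <-; rewrite !mulmxA H. Qed.

Lemma conj_term_mx (F : fieldType) (k n : nat) (r : F) (J01 J1s Js1 J10 J0s Js0 : 'M[F]_n)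
    (Fs : 'M[F]_(n, k)) (Es : 'M[F]_(k, n)) :
  J01 *m J1s = J0s -> Js1 *m J10 = Js0 ->
  J01 *m (r *: (J1s *m Fs *m Es *m Js1)) *m J10 = r *: (J0s *m Fs *m Es *m Js0).
Proof. by move=> <- <-; rewrite -scalemxAr -scalemxAl !mulmxA. Qed.

Lemma ker_term_mx (F : fieldType) (k n q : nat) (r : F) (J0s Js0 : 'M[F]_n)
    (Fs : 'M[F]_(n, k)) (Es : 'M[F]_(k, n)) (X : 'M[F]_(n, q)) :
  Es *m Js0 *m X = 0 -> r *: (J0s *m Fs *m Es *m Js0) *m X = 0.
Proof.
by move=> H; rewrite -scalemxAl -(mulmxA (J0s *m Fs)) -(mulmxA (J0s *m Fs)) H mulmx0 scaler0.
Qed.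

Lemma fix_term_mx (F : fieldType) (k n p : nat) (r : F) (J0s Js0 : 'M[F]_n)
    (Fs : 'M[F]_(n, k)) (Es : 'M[F]_(k, n)) (v : 'M[F]_(p, n)) :
  v *m J0s *m Fs *m Es = v *m J0s -> J0s *m Js0 = 1%:M ->
  v *m (r *: (J0s *m Fs *m Es *m Js0)) = r *: v.
Proof.
by move=> H J; rewrite -scalemxAr !mulmxA H -mulmxA J mulmx1.
Qed.

Lemma zero_term_mx (F : fieldType) (n p : nat) (v : 'M[F]_(p, n)) (X : 'M[F]_n) :
  v *m (0 *: X) = 0 *: v.
Proof. by rewrite !scale0r mulmx0. Qed.

Lemma zero_conj_mx (F : fieldType) (n : nat) (J J' X Y : 'M[F]_n) :
  J *m (0 *: X) *m J' = 0 *: Y.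
Proof. by rewrite !scale0r mulmx0 mul0mx. Qed.

Section Frames.
Context {R : realType} {n k : nat} {M : manifold R n}.
Variables (eta : kform M 1) (omega : kform M 2).
Hypothesis HK : forall m, has_dim (ker1 (eta m) `&` ker2 (omega m)) k.

Local Notation ch := (@chart_at R n M).
Local Notation AA := (forms_mx eta omega).

Lemma forms_mx_rankK c m : @atlas R n M c -> cdom c m -> (\rank (AA c m) + k = n)%N.
Proof.
move=> ac mc; rewrite (forms_mx_rank eta omega ac mc).
have -> : AA (ch m) m = pair_mx (eta m) (omega m).
  by rewrite /forms_mx omega_mx_chart_at eta_mx_chart_at.
by apply: pair_mx_rank (HK m); exact: form_multilinear.
Qed.

(** The data of [kernel_frame_data] for the forms at m, chosen for every m. *)
Lemma frames_exist : exists (L : M -> 'M[R]_(n + 1, n)) (E0 : M -> 'M[R]_(k, n))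
    (F : M -> 'M[R]_(n, k)), forall m, AA (ch m) m *m L m + F m *m E0 m = 1%:M.
Proof.
have H m : exists LEF : 'M[R]_(n + 1, n) * 'M[R]_(k, n) * 'M[R]_(n, k),
    AA (ch m) m *m LEF.1.1 + LEF.2 *m LEF.1.2 = 1%:M.
  have [L [E0 [F H]]] := kernel_frame_data (forms_mx_rankK (chart_at_atlas m) (chart_at_dom m)).
  by exists (L, E0, F).
have /choice[f fP] := H.
by exists (fun m => (f m).1.1), (fun m => (f m).1.2), (fun m => (f m).2).
Qed.

Variables (L : M -> 'M[R]_(n + 1, n)) (E0 : M -> 'M[R]_(k, n)) (F : M -> 'M[R]_(n, k)).
Hypothesis HL : forall m, AA (ch m) m *m L m + F m *m E0 m = 1%:M.

Definition frame_at m0 m : 'M[R]_n := frame_mx (L m0) (E0 m0) (F m0) (AA (ch m0) m).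

(** The points near m0 at which the data chosen at m0 still yield a basis of the
    kernel. *)
Definition frame_dom m0 : set M := cdom (ch m0) `&` [set m | frame_at m0 m \in unitmx].

Definition kernel_basis m0 m : 'M[R]_(k, n) :=
  locked (kernel_frame (L m0) (E0 m0) (F m0) (AA (ch m0) m)).

Lemma kernel_basisE m0 m : kernel_basis m0 m = kernel_frame (L m0) (E0 m0) (F m0)
  (AA (ch m0) m).
Proof. by rewrite /kernel_basis -lock. Qed.

Lemma frame_dom_sub m0 : frame_dom m0 `<=` cdom (ch m0). Proof. by move=> m []. Qed.

Lemma frame_dom_self m0 : frame_dom m0 m0.
Proof. by split; [exact: chart_at_dom|rewrite /= /frame_at /frame_mx HL unitmx1]. Qed.

Lemma smooth_frame_at m0 W : open W -> smooth_in (ch m0) W (frame_at m0).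
Proof.
move=> oW; have oO := @overlap_open R n M (ch m0) W oW.
apply: (smoothD oO); last exact: smooth_cst.
apply: (smooth_mulmx oO); last exact: smooth_cst.
exact: (smooth_forms_mx eta omega (chart_at_atlas m0) oW).
Qed.

Lemma frame_dom_open m0 : open (frame_dom m0).
Proof.
pose c := ch m0; pose O := cmap c @` cdom c.
have oO : open O := @cimage_open _ _ _ c.
have sd : smooth_on O (fun x => \det (frame_at m0 (cinv c x))).
  apply: smooth_det => //.
  apply: smooth_sub (smooth_frame_at m0 openT) => y [m h <-].
  by exists m.
have oX := open_neq0 oO (fun x Ox => smooth_continuous sd Ox).
have := preimage_open_in (@cdom_open _ _ _ c) (@cmap_continuous _ _ _ c) oX.
congr open; apply/seteqP; split=> m.
  move=> [mc [_ /= d0]]; split=> //; rewrite /= unitmxE unitfE.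
  by move: d0; rewrite cmapK.
move=> [mc /= uB]; split=> //; split; first by exists m.
by rewrite /= cmapK //; move: uB; rewrite unitmxE unitfE.
Qed.

Lemma smooth_kernel_basis m0 : smooth_in (ch m0) (frame_dom m0) (kernel_basis m0).
Proof.
have oO := @overlap_open R n M (ch m0) _ (@frame_dom_open m0).
apply: (@eq_smooth _ _ _ _ (fun y => E0 m0 *m invmx (frame_at m0 (cinv (ch m0) y)))).
- exact: oO.
- by move=> y _; rewrite /= kernel_basisE.
apply: (smooth_mulmx oO); first exact: smooth_cst.
apply: (smooth_invmx oO); last exact: (smooth_frame_at m0 (@frame_dom_open m0)).
by move=> _ [m [mc [_ Um]] <-]; rewrite /= cmapK.
Qed.

Lemma kernel_basis_coord m0 m p (v : 'M[R]_(p, n)) : frame_dom m0 m -> v *m AA (ch m0) m = 0 ->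
  v *m F m0 *m kernel_basis m0 m = v.
Proof. by move=> [_ uB] vA; rewrite kernel_basisE -(kernel_frame_coord uB vA). Qed.

Lemma kernel_basis_ker m0 m : frame_dom m0 m -> kernel_basis m0 m *m AA (ch m0) m = 0.
Proof.
move=> [mc uB]; rewrite kernel_basisE; apply: kernel_frame_ker uB.
exact: forms_mx_rankK (chart_at_atlas m0) mc.
Qed.

Lemma kernel_basisK m0 m : frame_dom m0 m -> kernel_basis m0 m *m F m0 = 1%:M.
Proof.
move=> [mc uB]; rewrite kernel_basisE; apply: kernel_frameK uB.
exact: forms_mx_rankK (chart_at_atlas m0) mc.
Qed.

(** If C expresses the basis of the kernel chosen at m1 in terms of the one chosen
    at m0, then the coordinates of a linear form on the kernel, as a row, are
    multiplied by the transpose of C. *)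
Definition dual_cocycle m0 m1 m : 'M[R]_k :=
  (kernel_basis m1 m *m transition_mx (ch m1) (ch m0) m *m F m0)^T.

Lemma dual_cocycle_id m0 m : frame_dom m0 m -> dual_cocycle m0 m0 m = 1%:M.
Proof.
move=> Um; rewrite /dual_cocycle transition_mx_id;
  [|exact: chart_at_atlas|exact: frame_dom_sub].
by rewrite mulmx1 kernel_basisK // trmx1.
Qed.

Lemma kernel_basis_change_ker m0 m1 m : frame_dom m0 m -> frame_dom m1 m ->
  kernel_basis m1 m *m transition_mx (ch m1) (ch m0) m *m AA (ch m0) m = 0.
Proof.
move=> U0 U1; apply: forms_mx_ker_change; try exact: chart_at_atlas; try exact: frame_dom_sub.
exact: kernel_basis_ker.
Qed.

Lemma dual_cocycle_comp m0 m1 m2 m : frame_dom m0 m -> frame_dom m1 m -> frame_dom m2 m ->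
  dual_cocycle m0 m1 m *m dual_cocycle m1 m2 m = dual_cocycle m0 m2 m.
Proof.
move=> U0 U1 U2; rewrite /dual_cocycle -trmx_mul; congr trmx.
have a := @chart_at_atlas R n M.
have J := transition_mx_comp (a m2) (a m1) (a m0) (frame_dom_sub U2) (frame_dom_sub U1)
  (frame_dom_sub U0).
have EJ := kernel_basis_coord U1 (kernel_basis_change_ker U1 U2).
exact: cocycle_mx EJ J.
Qed.

Lemma smooth_dual_cocycle m0 m1 : smooth_in (ch m0) (frame_dom m0 `&` frame_dom m1)
  (dual_cocycle m0 m1).
Proof.
have oW : open (frame_dom m0 `&` frame_dom m1) by apply: openI; exact: frame_dom_open.
have a0 := chart_at_atlas m0; have a1 := chart_at_atlas m1.
have W0 : frame_dom m0 `&` frame_dom m1 `<=` cdom (ch m0) by move=> m [/frame_dom_sub].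
have W1 : frame_dom m0 `&` frame_dom m1 `<=` cdom (ch m1) by move=> m [_ /frame_dom_sub].
have S1 : smooth_in (ch m0) (frame_dom m0 `&` frame_dom m1) (kernel_basis m1).
  apply: (smooth_in_change a0 a1 oW W1).
  by apply: smooth_in_sub (smooth_kernel_basis m1) => m [].
have S2 := smooth_in_mul oW S1 (smooth_in_transition_mx_inv a0 a1 oW W0 W1).
have S3 := smooth_in_mul oW S2 (smooth_in_cst (ch m0) (frame_dom m0 `&` frame_dom m1) (F m0)).
exact: (smooth_tr (@overlap_open R n M (ch m0) _ oW) S3).
Qed.

Section Projection.
Variables (s : nat -> M) (rho : nat -> M -> R) (C : nat -> set M) (idx : M -> nat).
Hypothesis rho_smooth : forall j, smooth_fun (rho j).
Hypothesis C_closed : forall j, closed (C j) /\ C j `<=` frame_dom (s j).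
Hypothesis rho_out : forall j m, ~ C j m -> rho j m = 0.
Hypothesis idxP : forall m, exists V : set M, [/\ open V, V m & forall m', V m' ->
  (forall j, (idx m <= j)%N -> rho j m' = 0) /\ \sum_(j < idx m) rho j m' = 1].

(** On [frame_dom (s j)] the matrix F E is a projection onto the kernel in the
    chart at s j; here it is carried over to the chart c and cut off by
    [rho j]. *)
Definition proj_term c j m : 'M[R]_n := rho j m *:
  (transition_mx c (ch (s j)) m *m F (s j) *m kernel_basis (s j)
    m *m transition_mx (ch (s j)) c m).

(** An affine combination of projections onto the same subspace is a projection
    onto this subspace. *)
Definition kernel_proj c m : 'M[R]_n := \sum_(j < idx m) proj_term c j m.

(** The bound [idx m] of the sum varies with m; near m it can be kept constant,
    which makes the sum smooth and reduces it to one finite sum. *)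
Lemma kernel_proj_near m m' V : (forall m', V m' ->
  (forall j, (idx m <= j)%N -> rho j m' = 0) /\ \sum_(j < idx m) rho j m' = 1) ->
  V m' -> forall c, kernel_proj c m' = \sum_(j < idx m) proj_term c j m'.
Proof.
move=> HV Vm' c; have [z1 _] := HV _ Vm'.
have [V' [_ /[swap] /[apply]]] := idxP m' => -[z2 _].
rewrite /kernel_proj -!(big_mkord xpredT (fun j => proj_term c j m')).
have T a b : (a <= b)%N -> (forall j, (a <= j)%N -> rho j m' = 0) ->
    \sum_(0 <= j < a) proj_term c j m' = \sum_(0 <= j < b) proj_term c j m'.
  move=> ab z; rewrite [RHS](big_cat_nat (leq0n a) ab) /=.
  rewrite [X in _ = _ + X]big_nat_cond [X in _ = _ + X]big1 ?addr0 // => j.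
  by rewrite andbT => /andP[aj _]; rewrite /proj_term z // scale0r.
by case: (leqP (idx m') (idx m)) => [h|/ltnW h]; [exact: T|rewrite (T _ _ h)].
Qed.

Lemma proj_term_cases c j m (P : 'M[R]_n -> Prop) : P 0 ->
  (frame_dom (s j) m -> P (proj_term c j m)) -> P (proj_term c j m).
Proof.
move=> P0 PU; have [Cm|nC] := pselect (C j m).
  by apply: PU; exact: (C_closed j).2.
by rewrite /proj_term rho_out // scale0r.
Qed.

(** Either a product of smooth maps, on the frame domain, or zero, off the support
    C j of [rho j]: two open sets that cover the chart. *)
Lemma smooth_proj_term c j : @atlas R n M c -> smooth_in c (cdom c) (proj_term c j).
Proof.
move=> ac; have aj := chart_at_atlas (s j).
apply: smooth_cover => y [m [mc _] <-].
have [Cm|nC] := pselect (C j m).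
  have oW : open (cdom c `&` frame_dom (s j)) by apply: openI;
    [exact: cdom_open|exact: frame_dom_open].
  have Wc : cdom c `&` frame_dom (s j) `<=` cdom c by move=> ? [].
  have Wj : cdom c `&` frame_dom (s j) `<=` cdom (ch (s j)) by move=> ? [_ /frame_dom_sub].
  have oO := @overlap_open R n M c _ oW.
  exists (cmap c @` (cdom c `&` (cdom c `&` frame_dom (s j)))).
    by exists m => //; split=> //; split=> //; exact: (C_closed j).2.
  have Sr : smooth_on (cmap c @` (cdom c `&` (cdom c `&` frame_dom (s j)))) (rho j \o cinv c).
    by apply: smooth_sub (rho_smooth j ac) => _ [m' [h _] <-]; exists m'.
  have S1 : smooth_in c (cdom c `&` frame_dom (s j)) (transition_mx c (ch (s j))).
    exact: smooth_in_sub Wj (smooth_in_transition_mx ac aj).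
  have S2 : smooth_in c (cdom c `&` frame_dom (s j)) (kernel_basis (s j)).
    apply: (smooth_in_change ac aj oW Wj).
    by apply: smooth_in_sub (smooth_kernel_basis (s j)) => m' [].
  have S3 := smooth_in_mul oW S1 (smooth_in_cst c (cdom c `&` frame_dom (s j)) (F (s j))).
  have S4 := smooth_in_mul oW S3 S2.
  have S5 := smooth_in_mul oW S4 (smooth_in_transition_mx_inv ac aj oW Wc Wj).
  exact: (smooth_scalemx oO Sr S5).
have oW : open (~` C j) by apply: closed_openC; exact: (C_closed j).1.
exists (cmap c @` (cdom c `&` ~` C j)); first by exists m.
apply: (@eq_smooth _ _ _ _ (fun=> 0)).
- exact: overlap_open.
- by move=> _ [m' [h h'] <-]; rewrite /= cmapK // /proj_term rho_out // scale0r.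
- exact: smooth_cst.
Qed.

Lemma smooth_kernel_proj c : @atlas R n M c -> smooth_in c (cdom c) (kernel_proj c).
Proof.
move=> ac; apply: smooth_cover => y [m [mc _] <-].
have [V [oV Vm HV]] := idxP m.
have oO := @overlap_open R n M c _ oV.
exists (cmap c @` (cdom c `&` V)); first by exists m.
apply: (@eq_smooth _ _ _ _ (fun y => \sum_(j < idx m) proj_term c j (cinv c y))) => //.
  by move=> _ [m' [h h'] <-]; rewrite /= cmapK // -(kernel_proj_near HV).
apply: smooth_sum => // j _.
apply: smooth_sub (smooth_proj_term j ac) => _ [m' [h _] <-]; by exists m'.
Qed.

Lemma kernel_proj_change c c' m : @atlas R n M c -> @atlas R n M c' -> cdom c m -> cdom c' m ->
  transition_mx c c' m *m kernel_proj c' m *m transition_mx c' c m = kernel_proj c m.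
Proof.
move=> ac ac' mc mc'; rewrite /kernel_proj mulmx_sumr mulmx_suml; apply: eq_bigr => j _.
have [/(C_closed j).2 Um|nC] := pselect (C j m); last first.
  by rewrite /proj_term (rho_out nC); exact: zero_conj_mx.
have aj := chart_at_atlas (s j); have dj := frame_dom_sub Um.
exact: conj_term_mx (transition_mx_comp ac ac' aj mc mc' dj)
  (transition_mx_comp aj ac' ac dj mc' mc).
Qed.

Lemma kernel_proj_ker c m : @atlas R n M c -> cdom c m -> kernel_proj c m *m AA c m = 0.
Proof.
move=> ac mc; rewrite /kernel_proj mulmx_suml; apply: big1 => j _.
apply: (@proj_term_cases c j m (fun X => X *m AA c m = 0)); first by rewrite mul0mx.
move=> Um; have aj := chart_at_atlas (s j); have dj := frame_dom_sub Um.
exact: ker_term_mx (forms_mx_ker_change aj ac dj mc (kernel_basis_ker Um)).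
Qed.

Lemma kernel_proj_id c m p (v : 'M[R]_(p, n)) : @atlas R n M c -> cdom c m ->
  v *m AA c m = 0 -> v *m kernel_proj c m = v.
Proof.
move=> ac mc vA; have [V [oV Vm HV]] := idxP m; have [_ s1] := HV _ Vm.
rewrite /kernel_proj mulmx_sumr -[RHS]scale1r -s1 scaler_suml; apply: eq_bigr => j _.
have [/(C_closed j).2 Um|nC] := pselect (C j m); last first.
  by rewrite /proj_term (rho_out nC); exact: zero_term_mx.
have aj := chart_at_atlas (s j); have dj := frame_dom_sub Um.
exact: fix_term_mx (kernel_basis_coord Um (forms_mx_ker_change ac aj mc dj vA))
  (transition_mxK ac aj mc dj).
Qed.

End Projection.
End Frames.

(** * Families of forms and linear coordinate changes *)

Section Families.
Context {R : realType}.

Lemma wedge_pow_pullback (V W : lmodType R) (J : V -> W) (w : ('I_2 -> W) -> R) r v :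
  wedge_pow (fun u : 'I_2 -> V => w (fun i => J (u i))) r v =
  wedge_pow w r (fun i => J (v i)).
Proof.
elim: r v => [//|r IH] v.
rewrite /= /wedge; congr (_ * _); apply: eq_bigr => s _.
by rewrite IH.
Qed.

Lemma smooth_wedge (X : normedModType R) (V : lmodType R) (U : set X) p q
    (a : X -> ('I_p -> V) -> R) (b : X -> ('I_q -> V) -> R) v : open U ->
  (forall u, smooth_on U (a^~ u)) -> (forall u, smooth_on U (b^~ u)) ->
  smooth_on U (fun y => wedge (a y) (b y) v).
Proof.
move=> oU Ha Hb; apply: smoothM => //; first exact: smooth_cst.
apply: smooth_sum => // s _; apply: smoothM => //.
by apply: smoothM => //; exact: smooth_cst.
Qed.

Lemma smooth_wedge_pow (X : normedModType R) (V : lmodType R) (U : set X)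
    (w : X -> ('I_2 -> V) -> R) r v : open U ->
  (forall u, smooth_on U (w^~ u)) -> smooth_on U (fun y => wedge_pow (w y) r v).
Proof.
move=> oU Hw; elim: r v => [|r IH] v; first exact: smooth_cst.
exact: (@smooth_wedge X V U 2 r.*2 w (fun y => wedge_pow (w y) r) v oU Hw IH).
Qed.

Lemma form1_natural n m (J : 'M[R]_(m, n)) c0 c1 : c0 = J *m c1 ->
  form1 c0 = (fun u => form1 c1 (fun i => u i *m J)).
Proof. by move=> ->; apply/funext => u; rewrite form1_mul. Qed.

Lemma form2_natural n m (J : 'M[R]_(m, n)) W0 W1 : W0 = J *m W1 *m J^T ->
  form2 W0 = (fun u => form2 W1 (fun i => u i *m J)).
Proof. by move=> ->; apply/funext => u; rewrite form2_mul. Qed.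

Lemma smooth_mulmxr n m (U : set 'rV[R]_n) (Q : 'M[R]_(n, m)) : open U ->
  smooth_on U (fun y => y *m Q).
Proof.
by move=> oU; apply: smooth_mulmx => //; [exact: smooth_id|exact: smooth_cst].
Qed.

Lemma jacobian_mulmxr n m (Q : 'M[R]_(n, m)) y : 'J (fun z => z *m Q) y = Q.
Proof.
have cQ : continuous (mulmxr Q : 'rV[R]_n -> 'rV[R]_m).
  by move=> z; exact: (smooth_continuous (smooth_mulmxr Q openT)).
have D : 'd (mulmxr Q) y = mulmxr Q :> ('rV[R]_n -> 'rV[R]_m) by exact: diff_lin.
apply/row_matrixP => i; rewrite !rowE -(jacobianE (fun z => z *m Q)).
exact: (congr1 (fun f => f (delta_mx 0 i)) D).
Qed.

Lemma form1_smooth p (O : set 'rV[R]_p) (f : 'rV[R]_p -> 'cV[R]_p) v : open O ->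
  smooth_on O f -> smooth_on O (fun y => form1 (f y) v).
Proof.
move=> oO sf; apply: smooth_entry => //; apply: smooth_mulmx => //.
exact: smooth_cst.
Qed.

Lemma form2_smooth p (O : set 'rV[R]_p) (f : 'rV[R]_p -> 'M[R]_p) v : open O ->
  smooth_on O f -> smooth_on O (fun y => form2 (f y) v).
Proof.
move=> oO sf; apply: smooth_entry => //; apply: smooth_mulmx => //; last exact: smooth_cst.
by apply: smooth_mulmx => //; exact: smooth_cst.
Qed.

End Families.

Section ZeroMatrix.
Context {R : realType}.

(** At a zero of the linear factor only its own derivative contributes. *)
Lemma jacobian_mul_at_zero p q r (O : set 'rV[R]_p) (Q : 'M[R]_(p, q))
    (B : 'rV[R]_p -> 'M[R]_(q, r)) y0 : open O -> smooth_on O B -> O y0 ->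
  y0 *m Q = 0 -> 'J (fun y => y *m Q *m B y) y0 = Q *m B y0.
Proof.
move=> oO sB Oy0 z.
have sQ := smooth_mulmxr Q oO.
have sF : smooth_on O (fun y => y *m Q *m B y) by exact: smooth_mulmx.
apply/matrixP => i j; rewrite (jacobian_entry _ _ oO sF Oy0).
rewrite (@derive_near _ _ _ O _ (fun y => \sum_l (y *m Q) 0 l * B y l j)) //; last first.
  by move=> y _; rewrite mxE.
rewrite (derive_sum_smooth _ oO) //; last first.
  by move=> l; apply: smoothM => //; exact: smooth_entry.
rewrite [RHS]mxE; apply: eq_bigr => l _.
rewrite (@deriveM_smooth _ _ O) //; [|exact: smooth_entry|exact: smooth_entry].
rewrite z [X in X * _]mxE mul0r add0r mulrC; congr (_ * _).
rewrite -(jacobian_entry _ _ oO sQ Oy0).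
by rewrite jacobian_mulmxr.
Qed.

Context {n k : nat}.

Definition lproj_mx : 'M[R]_(n + k, n) := col_mx 1%:M 0.

Lemma mul_lproj_mx m (y : 'M[R]_(m, n + k)) : y *m lproj_mx = lsubmx y.
Proof.
by rewrite -[y in LHS]hsubmxK mul_row_col mulmx1 mulmx0 addr0.
Qed.

Definition rproj_mx : 'M[R]_(n + k, k) := col_mx 0 1%:M.
Definition linj_mx : 'M[R]_(n, n + k) := row_mx 1%:M 0.

Lemma mul_rproj_mx m (y : 'M[R]_(m, n + k)) : y *m rproj_mx = rsubmx y.
Proof. by rewrite -[y in LHS]hsubmxK mul_row_col mulmx1 mulmx0 add0r. Qed.

Lemma mul_linj_mx m (y : 'M[R]_(m, n)) : y *m linj_mx = row_mx y 0.
Proof. by rewrite mul_mx_row mulmx1 mulmx0. Qed.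

Lemma derive_lproj (O : set 'rV[R]_n) (f : 'rV[R]_n -> R) (x v : 'rV[R]_(n + k)) :
  open O -> smooth_on O f -> O (x *m lproj_mx) ->
  derivable (fun y => f (y *m lproj_mx)) x v /\
  'D_v (fun y => f (y *m lproj_mx)) x = 'D_(v *m lproj_mx) f (x *m lproj_mx).
Proof.
move=> oO sf Ox.
have dQ : derivable (fun z : 'rV[R]_(n + k) => z *m lproj_mx) x v.
  exact: (smooth_derivable (smooth_mulmxr lproj_mx openT) I).
have [df _] := C1_differentiable oO (sf 1%N) Ox.
have [d1 d2] := derivable_comp_dir dQ df.
split; first exact: d1.
rewrite -[LHS]/('D_v (f \o (fun z : 'rV[R]_(n + k) => z *m lproj_mx)) x) d2 -(deriveE _ df).
congr ('D_ _ _ _).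
by rewrite -(jacobian_derive v openT (smooth_mulmxr lproj_mx openT) I) jacobian_mulmxr.
Qed.

(** The matrix of the total two-form along the zero section, in the splitting of
    the tangent space into base and fibre directions; see [section_mxE]. *)
Definition section_mx (W : 'M[R]_n) (P : 'M[R]_(n, k)) : 'M[R]_(n + k) :=
  lproj_mx *m W *m lproj_mx^T + (rproj_mx *m (P^T *m lproj_mx^T)
    - (rproj_mx *m (P^T *m lproj_mx^T))^T).

Lemma section_mxE W P (v w : 'rV[R]_n) (b c : 'rV[R]_k) :
  row_mx v b *m section_mx W P *m (row_mx w c)^T =
  v *m W *m w^T + b *m P^T *m w^T - v *m P *m c^T.
Proof.
have lw : (row_mx v b) *m lproj_mx = v by rewrite mul_lproj_mx row_mxKl.
have rw : (row_mx v b) *m rproj_mx = b by rewrite mul_rproj_mx row_mxKr.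
have lc : (row_mx w c) *m lproj_mx = w by rewrite mul_lproj_mx row_mxKl.
have rc : (row_mx w c) *m rproj_mx = c by rewrite mul_rproj_mx row_mxKr.
move: (row_mx v b) (row_mx w c) lw rw lc rc => x y <- <- <- <-.
rewrite /section_mx !trmx_mul !trmxK mulmxDr mulmxDl mulmxBr mulmxBl.
by rewrite !mulmxA addrA.
Qed.

End ZeroMatrix.

(** * The dual of the kernel bundle and its forms *)

Section TotalSpace.
Context {R : realType} {n k : nat} {M : manifold R n}.
Variables (eta : kform M 1) (omega : kform M 2).
Local Notation ch := (@chart_at R n M).
Variables (U : M -> set M) (g : M -> M -> M -> 'M[R]_k) (P : M -> M -> 'M[R]_(n, k)).
Hypothesis U_open : forall m, open (U m).
Hypothesis U_dom : forall m0, U m0 `<=` cdom (ch m0).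
Hypothesis U_self : forall m, U m m.
Hypothesis g_id : forall m0 m, U m0 m -> g m0 m0 m = 1%:M.
Hypothesis g_comp : forall m0 m1 m2 m, U m0 m -> U m1 m -> U m2 m ->
  g m0 m1 m *m g m1 m2 m = g m0 m2 m.
Hypothesis smooth_g : forall m0 m1, smooth_in (ch m0) (U m0 `&` U m1) (g m0 m1).
Hypothesis smooth_P : forall m0, smooth_in (ch m0) (U m0) (P m0).
Hypothesis P_change : forall m0 m1 m, U m0 m -> U m1 m ->
  P m0 m = transition_mx (ch m0) (ch m1) m *m P m1 m *m (g m0 m1 m)^T.

Variables (r : nat) (Kb : M -> 'M[R]_(k, n)).
Hypothesis Kb_P : forall m, Kb m *m P m m = 1%:M.
Hypothesis Kb_omega : forall m, Kb m *m form2_mx (omega m) = 0.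
Hypothesis Kb_eta : forall m, Kb m *m form1_mx (eta m) = 0.
Hypothesis top : forall m, exists v, wedge (eta m) (wedge_pow (omega m) r) v != 0.
Hypothesis U_count : exists s : nat -> M, forall m, exists j, U (s j) m.
Local Notation N := (r + k)%N.

(** A point of the total space is a pair (m, a), where a are the coordinates of a
    vector of the fibre in the trivialization of index m; [triv m0] are its
    coordinates in the trivialization of index m0, defined over U m0. *)
Definition triv m0 (t : M * 'rV[R]_k) : 'rV[R]_(n + k) :=
  row_mx (cmap (ch m0) t.1) (t.2 *m g t.1 m0 t.1).

Definition triv_base m0 (y : 'rV[R]_(n + k)) : M := cinv (ch m0) (lsubmx y).

Definition triv_inv m0 (y : 'rV[R]_(n + k)) : M * 'rV[R]_k :=
  (triv_base m0 y, rsubmx y *m g m0 (triv_base m0 y) (triv_base m0 y)).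

(** The coordinates, in the trivialization m0, of the points that lie over U m0
    and W. *)
Definition over m0 (W : set M) : set 'rV[R]_(n + k) :=
  [set y | (cmap (ch m0) @` (cdom (ch m0) `&` (U m0 `&` W))) (lsubmx y)].

Lemma trivK m0 t : U m0 t.1 -> triv_inv m0 (triv m0 t) = t.
Proof.
case: t => m a /= Um; rewrite /triv_inv /triv /triv_base row_mxKl row_mxKr /=.
rewrite cmapK; last exact: U_dom.
by rewrite -mulmxA g_comp // g_id // mulmx1.
Qed.

Lemma overP m0 W y : over m0 W y ->
  [/\ U m0 (triv_base m0 y), W (triv_base m0 y) & cmap (ch m0) (triv_base m0 y) = lsubmx y].
Proof. by move=> [m [mc [Um Wm]] E]; rewrite /triv_base -E cmapK. Qed.

Lemma over_triv m0 W t : U m0 t.1 -> W t.1 -> over m0 W (triv m0 t).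
Proof.
move=> Ut Wt; rewrite /over /= /triv row_mxKl; exists t.1 => //.
by split; [exact: U_dom|split].
Qed.

Lemma triv_base_triv m0 t : U m0 t.1 -> triv_base m0 (triv m0 t) = t.1.
Proof. by move=> Ut; rewrite /triv_base /triv row_mxKl cmapK //; exact: U_dom. Qed.

Lemma triv_invK m0 W y : over m0 W y -> triv m0 (triv_inv m0 y) = y.
Proof.
move=> /overP[Um _ E]; rewrite /triv /triv_inv /= E -mulmxA g_comp // g_id // mulmx1.
exact: hsubmxK.
Qed.

Lemma lsub_smooth (O : set 'rV[R]_(n + k)) : open O -> smooth_on O (fun y => lsubmx y).
Proof. by move=> oO; apply: smooth_lsubmx => //; exact: smooth_id. Qed.

Lemma over_open m0 W : open W -> open (over m0 W).
Proof.
move=> oW.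
have oX : open (cmap (ch m0) @` (cdom (ch m0) `&` (U m0 `&` W))).
  by apply: overlap_open; exact: openI.
have := @preimage_open_in _ _ (fun y : 'rV[R]_(n + k) => lsubmx y) setT _ openT
  (fun y _ => smooth_continuous (lsub_smooth openT) I) oX.
by rewrite setTI.
Qed.

Lemma over_sub m0 W W' : W `<=` W' -> over m0 W `<=` over m0 W'.
Proof.
by move=> s y [m [mc [Um Wm]] E]; exists m => //; split=> //; split=> //; exact: s.
Qed.

Lemma smooth_triv_base p q m0 W (f : M -> 'M[R]_(p, q)) : open W ->
  smooth_in (ch m0) (U m0 `&` W) f -> smooth_on (over m0 W) (fun y => f (triv_base m0 y)).
Proof.
move=> oW sf.
have oX : open (cmap (ch m0) @` (cdom (ch m0) `&` (U m0 `&` W))).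
  by apply: overlap_open; exact: openI.
have oB := @over_open m0 W oW.
exact (smooth_comp (f := fun y => lsubmx y) oB oX (fun y By => By) (lsub_smooth oB) sf).
Qed.

Definition triv_change m0 m1 (y : 'rV[R]_(n + k)) := triv m1 (triv_inv m0 y).

Lemma triv_changeE m0 m1 y : over m0 (U m1) y ->
  triv_change m0 m1 y = row_mx (transition (ch m0) (ch m1) (lsubmx y))
    (rsubmx y *m g m0 m1 (triv_base m0 y)).
Proof.
move=> /overP[U0 U1 E]; rewrite /triv_change /triv /triv_inv /= -mulmxA g_comp //.
Qed.

Lemma smooth_triv_change m0 m1 : smooth_on (over m0 (U m1)) (triv_change m0 m1).
Proof.
have oB := @over_open m0 _ (@U_open m1).
apply: (@eq_smooth _ _ _ _ (fun y => row_mx (transition (ch m0) (ch m1) (lsubmx y))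
   (rsubmx y *m g m0 m1 (triv_base m0 y)))) => //.
  by move=> y /triv_changeE ->.
apply: smooth_row_mx => //.
  pose O := cmap (ch m0) @` (cdom (ch m0) `&` cdom (ch m1)).
  have oO : open O by apply: overlap_open; exact: cdom_open.
  apply: (smooth_comp oB oO _ (lsub_smooth oB)).
    by move=> y [m [mc [Um U1]] <-]; exists m => //; split=> //; exact: U_dom.
  exact: (transition_smooth (chart_at_atlas m0) (chart_at_atlas m1)).
apply: smooth_mulmx => //.
  by apply: smooth_rsubmx => //; exact: smooth_id.
exact: (smooth_triv_base (@U_open m1) (smooth_g m0 m1)).
Qed.

Lemma over_triv_change m0 m1 W y : over m0 (U m1 `&` W) y -> over m1 W (triv_change m0 m1 y).
Proof. by move=> /overP[U0 [U1 Wm] _]; apply: over_triv. Qed.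

Lemma over_triv_changeT m0 m1 y : over m0 (U m1) y -> over m1 setT (triv_change m0 m1 y).
Proof. by move=> B; apply: over_triv_change; rewrite setIT. Qed.

Lemma triv_base_change m0 m1 y : over m0 (U m1) y -> triv_base m1 (triv_change m0 m1 y) =
  triv_base m0 y.
Proof. by move=> /overP[U0 U1 _]; rewrite /triv_change triv_base_triv. Qed.

Lemma rsub_triv_change m0 m1 y : over m0 (U m1) y ->
  rsubmx (triv_change m0 m1 y) = rsubmx y *m g m0 m1 (triv_base m0 y).
Proof. by move=> /triv_changeE ->; rewrite row_mxKr. Qed.

(** Changes of trivialization cover changes of charts of the base. *)
Lemma triv_change_jacobian m0 m1 y : over m0 (U m1) y ->
  'J (triv_change m0 m1) y *m lproj_mx = lproj_mx *m transition_mx (ch m0) (ch m1)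
    (triv_base m0 y).
Proof.
move=> By; have oB := @over_open m0 _ (@U_open m1).
have [U0 U1 E] := overP By.
have dG := smooth_differentiable oB (smooth_triv_change m0 m1) By.
have dQ z : differentiable (fun z : 'rV[R]_(n + k) => z *m lproj_mx) z.
  exact: (smooth_differentiable openT (smooth_mulmxr lproj_mx openT) I).
have J1 := jacobian_comp dG (dQ (triv_change m0 m1 y)).
rewrite jacobian_mulmxr in J1; rewrite -J1.
have dt : differentiable (transition (ch m0) (ch m1)) (y *m lproj_mx).
  rewrite mul_lproj_mx -E; apply: transition_differentiable; try exact: chart_at_atlas;
    exact: U_dom.
have J2 := jacobian_comp (dQ y) dt.
rewrite jacobian_mulmxr in J2; rewrite transition_mxE E -mul_lproj_mx -J2.
have sG : smooth_on (over m0 (U m1)) ((fun z => z *m lproj_mx) \o triv_change m0 m1).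
  apply: smooth_mulmx => //; [exact: smooth_triv_change|exact: smooth_cst].
apply: (near_eq_jacobian oB sG) By => z Bz.
by rewrite /= !mul_lproj_mx triv_changeE // row_mxKl.
Qed.

(** The one-form X |-> a (Pi (d pi X)) at the point (m, a), an analogue of the
    canonical one-form of a cotangent bundle. *)
Definition taut_form m0 (y : 'rV[R]_(n + k)) : 'rV[R]_(n + k) :=
  locked (rsubmx y *m (P m0 (triv_base m0 y))^T *m lproj_mx^T).

Lemma taut_formE m0 y : taut_form m0 y = rsubmx y *m (P m0 (triv_base m0 y))^T *m lproj_mx^T.
Proof. by rewrite /taut_form -lock. Qed.

Definition total_omega m0 (y : 'rV[R]_(n + k)) : 'M[R]_(n + k) :=
  locked (lproj_mx *m omega_mx omega (ch m0) (triv_base m0 y)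
    *m lproj_mx^T + ext1 (taut_form m0) y).

Lemma total_omegaE m0 y :
  total_omega m0 y = lproj_mx *m omega_mx omega (ch m0) (triv_base m0 y)
    *m lproj_mx^T + ext1 (taut_form m0) y.
Proof. by rewrite /total_omega -lock. Qed.

Definition total_eta m0 (y : 'rV[R]_(n + k)) : 'cV[R]_(n + k) :=
  locked (lproj_mx *m eta_mx eta (ch m0) (triv_base m0 y)).

Lemma total_etaE m0 y : total_eta m0 y = lproj_mx *m eta_mx eta (ch m0) (triv_base m0 y).
Proof. by rewrite /total_eta -lock. Qed.

Lemma smooth_taut_form m0 : smooth_on (over m0 setT) (taut_form m0).
Proof.
have oB := @over_open m0 _ openT.
apply: (eq_smooth oB (fun y _ => esym (taut_formE m0 y))).
apply: smooth_mulmx => //; last exact: smooth_cst.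
apply: smooth_mulmx => //.
  by apply: smooth_rsubmx => //; exact: smooth_id.
apply: smooth_tr => //; apply: (smooth_triv_base openT).
by rewrite setIT.
Qed.

Lemma smooth_total_omega m0 : smooth_on (over m0 setT) (total_omega m0).
Proof.
have oB := @over_open m0 _ openT.
apply: (eq_smooth oB (fun y _ => esym (total_omegaE m0 y))).
apply: smoothD => //; last exact: smooth_ext1 (smooth_taut_form m0).
apply: smooth_mulmx => //; last exact: smooth_cst.
apply: smooth_mulmx => //; first exact: smooth_cst.
apply: (smooth_triv_base openT).
by apply: smooth_omega_mx; [exact: chart_at_atlas|rewrite setIT].
Qed.

Lemma smooth_total_eta m0 : smooth_on (over m0 setT) (total_eta m0).
Proof.
have oB := @over_open m0 _ openT.
apply: (eq_smooth oB (fun y _ => esym (total_etaE m0 y))).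
apply: smooth_mulmx => //; first exact: smooth_cst.
apply: (smooth_triv_base openT).
by apply: smooth_eta_mx; [exact: chart_at_atlas|rewrite setIT].
Qed.

Lemma total_omega_skew m0 y : (total_omega m0 y)^T = - total_omega m0 y.
Proof.
rewrite total_omegaE linearD /= ext1_skew.
have := omega_mx_skew omega (ch m0) (triv_base m0 y); move: (omega_mx _ _ _) => W S.
by rewrite !trmx_mul trmxK S mulNmx mulmxN mulmxA [RHS]opprD.
Qed.

Lemma taut_form_natural m0 m1 y : over m0 (U m1) y ->
  taut_form m0 y = taut_form m1 (triv_change m0 m1 y) *m ('J (triv_change m0 m1) y)^T.
Proof.
move=> By; have [U0 U1 _] := overP By.
rewrite !taut_formE (triv_base_change By) (rsub_triv_change By)
  -[RHS]mulmxA -trmx_mul (triv_change_jacobian By) (P_change U0 U1).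
move: (transition_mx _ _ _) (P _ _) (g _ _ _) (rsubmx y) => J P1 g0 a.
by rewrite !trmx_mul trmxK !mulmxA.
Qed.

Lemma total_eta_natural m0 m1 y : over m0 (U m1) y ->
  total_eta m0 y = 'J (triv_change m0 m1) y *m total_eta m1 (triv_change m0 m1 y).
Proof.
move=> By; have [U0 U1 _] := overP By.
have C := eta_mx_change eta (chart_at_atlas m0) (chart_at_atlas m1) (U_dom U0) (U_dom U1).
have JQ := triv_change_jacobian By.
rewrite !total_etaE (triv_base_change By) C.
move: ('J _ y) (transition_mx _ _ _) (eta_mx _ _ _) JQ => JG J e JQ.
by rewrite !mulmxA JQ.
Qed.

Lemma total_omega_natural m0 m1 y : over m0 (U m1) y ->
  total_omega m0 y = 'J (triv_change m0 m1) y *m total_omega m1 (triv_change m0 m1 y)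
    *m ('J (triv_change m0 m1) y)^T.
Proof.
move=> By; have [U0 U1 _] := overP By.
have oB := @over_open m0 _ (@U_open m1).
have T := ext1_natural oB (@over_open m1 _ openT) (@over_triv_changeT m0 m1)
  (smooth_triv_change m0 m1)
   (smooth_taut_form m1) (@taut_form_natural m0 m1) By.
have C := omega_mx_change omega (chart_at_atlas m0) (chart_at_atlas m1) (U_dom U0) (U_dom U1).
have JQ := triv_change_jacobian By.
rewrite !total_omegaE (triv_base_change By) T C.
move: ('J _ y) (transition_mx _ _ _) (omega_mx _ _ _) (ext1 _ _) JQ => JG J W X JQ.
rewrite mulmxDr mulmxDl; congr (_ + _).
by rewrite !mulmxA JQ -!mulmxA -trmx_mul -[in RHS]trmx_mul JQ trmx_mul.
Qed.

Definition total_top m0 y (v : 'I_(1 + N.*2) -> 'rV[R]_(n + k)) : R :=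
  wedge (form1 (total_eta m0 y)) (wedge_pow (form2 (total_omega m0 y)) N) v.

Lemma total_top_natural m0 m1 y v : over m0 (U m1) y ->
  total_top m0 y v = total_top m1 (triv_change m0 m1 y) (fun i =>
    v i *m 'J (triv_change m0 m1) y).
Proof.
move=> By; rewrite /total_top /wedge; congr (_ * _); apply: eq_bigr => s _.
congr (_ * _ * _).
  by rewrite (form1_natural (total_eta_natural By)).
have E := form2_natural (total_omega_natural By).
have E2 := congr1 (fun w => wedge_pow w N (fun j => v (s (rshift 1 j)))) E.
have E3 := @wedge_pow_pullback R _ _ (fun u : 'rV[R]_(n + k) => u *m 'J (triv_change m0 m1) y)
  (form2 (total_omega m1 (triv_change m0 m1 y))) N (fun j => v (s (rshift 1 j))).
exact (etrans E2 E3).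
Qed.

Lemma smooth_total_top m0 v : smooth_on (over m0 setT) (fun y => total_top m0 y v).
Proof.
have oB := @over_open m0 _ openT.
have sE u : smooth_on (over m0 setT) (fun y => form1 (total_eta m0 y) u).
  apply: smooth_entry => //; apply: smooth_mulmx => //; first exact: smooth_cst.
  exact: smooth_total_eta.
have sO u : smooth_on (over m0 setT) (fun y => form2 (total_omega m0 y) u).
  apply: smooth_entry => //; apply: smooth_mulmx => //; last exact: smooth_cst.
  by apply: smooth_mulmx => //; [exact: smooth_cst|exact: smooth_total_omega].
apply: (smooth_wedge _ oB sE) => u.
exact: (smooth_wedge_pow _ oB sO).
Qed.

(** Tested in the trivialization of index t.1; by [nondegenerateE] any other one
    around t gives the same condition. *)
Definition nondegenerate (t : M * 'rV[R]_k) := exists v, total_top t.1 (triv t.1 t) v != 0.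

Definition nondeg_at m0 := [set y | exists v, total_top m0 y v != 0].

Lemma nondegenerateE m0 t : U m0 t.1 -> nondegenerate t <-> nondeg_at m0 (triv m0 t).
Proof.
move=> Ut; have step m1 m2 : U m1 t.1 -> U m2 t.1 ->
    nondeg_at m1 (triv m1 t) -> nondeg_at m2 (triv m2 t).
  move=> U1 U2 [v v0]; exists (fun i => v i *m 'J (triv_change m1 m2) (triv m1 t)).
  have B : over m1 (U m2) (triv m1 t) by exact: over_triv.
  by move: v0; rewrite (total_top_natural _ B) {1}/triv_change trivK.
by split; exact: step.
Qed.

Lemma nondeg_at_open m0 W : open W -> open (over m0 W `&` nondeg_at m0).
Proof.
move=> oW; have -> : over m0 W `&` nondeg_at m0 =
    \bigcup_v (over m0 W `&` [set y | total_top m0 y v != 0]).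
  apply/seteqP; split=> [y [By [v v0]]|y [v _ [By v0]]]; first by exists v.
  by split=> //; exists v.
apply: bigcup_open => v _; apply: open_neq0; first exact: over_open.
move=> y By; apply: (smooth_continuous (smooth_total_top m0 v)).
exact: over_sub By.
Qed.

(** * Nondegeneracy along the zero section *)

Lemma triv_zero i m : triv i (m, 0) = row_mx (cmap (ch i) m) 0.
Proof. by rewrite /triv /= mul0mx. Qed.

Lemma triv_base_zero m : triv_base m (row_mx (cmap (ch m) m) 0 : 'rV[R]_(n + k)) = m.
Proof. by rewrite /triv_base row_mxKl cmapK //; exact: chart_at_dom. Qed.

Lemma over_zero m : over m setT (row_mx (cmap (ch m) m) 0).
Proof.
rewrite /over /= row_mxKl; exists m => //; split; first exact: chart_at_dom.
by split.
Qed.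

Lemma total_eta_zero m : total_eta m (row_mx (cmap (ch m) m) 0 : 'rV[R]_(n + k)) =
  lproj_mx *m form1_mx (eta m).
Proof. by rewrite total_etaE triv_base_zero eta_mx_chart_at. Qed.

Lemma total_omega_zero m : total_omega m (row_mx (cmap (ch m) m) 0) =
  section_mx (form2_mx (omega m)) (P m m).
Proof.
have oB : open (over m setT) := @over_open m setT openT.
have By := over_zero m; set y0 := row_mx _ _ in By *.
pose B (y : 'rV[R]_(n + k)) : 'M[R]_(k, n + k) := (P m (triv_base m y))^T *m lproj_mx^T.
have sB : smooth_on (over m setT) B.
  apply: smooth_mulmx => //; last exact: smooth_cst.
  apply: smooth_tr => //; apply: (smooth_triv_base openT).
  by rewrite setIT; exact: smooth_P.
have E y : over m setT y -> taut_form m y = y *m rproj_mx *m B y.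
  by move=> _; rewrite taut_formE mul_rproj_mx /B mulmxA.
have J : 'J (taut_form m) y0 = rproj_mx *m ((P m m)^T *m lproj_mx^T).
  have := near_eq_jacobian oB (smooth_taut_form m) E By.
  move=> ->; rewrite (jacobian_mul_at_zero oB sB By).
    by rewrite /B triv_base_zero.
  by rewrite mul_rproj_mx row_mxKr.
by rewrite total_omegaE /ext1 J triv_base_zero omega_mx_chart_at.
Qed.

(** The coordinate directions of the fibre and the basis [Kb m] of the kernel form
    k hyperbolic pairs, and the kernel is orthogonal to the directions of M. *)
Lemma zero_nondegenerate m : nondegenerate (m, 0).
Proof.
have [u u0] := top m; rewrite /nondegenerate /total_top /= triv_zero total_omega_zero
  total_eta_zero.
set W := form2_mx (omega m); set c := form1_mx (eta m).
have WT : W^T = - W by apply: form2_mx_skew; [exact: form_multilinear|exact: form_alternating].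
have wE (v w : 'rV[R]_n) (b d : 'rV[R]_k) :
    form2 (section_mx W (P m m)) (tnth [tuple row_mx v b; row_mx w d]) =
    (v *m W *m w^T + b *m (P m m)^T *m w^T - v *m P m m *m d^T) 0 0.
  by rewrite -section_mxE.
have WE j : W *m (row j (Kb m))^T = 0.
  apply: trmx_inj; rewrite trmx_mul trmxK WT mulmxN -row_mul Kb_omega.
  by rewrite row0 oppr0 trmx0.
have zT p : (0 : 'rV[R]_p)^T = 0 by rewrite trmx0.
apply: (@wedge_hyperbolic_iter R _ _ _ r k (fun i => row_mx (u i) 0)
  (fun j => row_mx 0 (delta_mx 0 j)) (fun j => row_mx (row j (Kb m)) 0)).
- move=> A B; apply: form2_skew; rewrite /section_mx linearD /= linearB /= trmxK.
  by rewrite !trmx_mul trmxK WT mulNmx mulmxN mulmxA opprD opprB.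
- move=> j; rewrite /form1 /= mulmxA mul_lproj_mx row_mxKl -row_mul Kb_eta row0.
  by rewrite mxE.
- move=> i j; rewrite wE zT !mul0mx ?mulmx0 add0r subr0.
  have -> : (delta_mx 0 i : 'rV[R]_k) *m (P m m)^T *m (row j (Kb m))^T =
      (row j (Kb m *m P m m) *m (delta_mx 0 i : 'rV[R]_k)^T)^T.
    by rewrite trmx_mul trmxK row_mul trmx_mul mulmxA.
  rewrite Kb_P row1 trmx_delta mul_delta_mx_cond eq_sym.
  by case: eqP => _; rewrite ?mulr0n ?mulr1n !mxE.
- move=> i j; rewrite wE zT !mul0mx ?mulmx0 addr0 subr0.
  by rewrite -mulmxA WE mulmx0 mxE.
- move=> i j; rewrite wE zT !mul0mx ?mulmx0 addr0 subr0.
  by rewrite -mulmxA WE mulmx0 mxE.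
have eE : (fun u : 'I_1 -> 'rV[R]_n => form1 (lproj_mx *m c) (fun i => row_mx (u i) (0 :
  'rV[R]_k))) = eta m.
  apply/funext => v; rewrite [RHS]form1_mxE; last exact: form_multilinear.
  by rewrite /form1 mulmxA mul_lproj_mx row_mxKl.
have oE : (fun u : 'I_2 -> 'rV[R]_n => form2 (section_mx W (P m m)) (fun i => row_mx (u i)
  (0 : 'rV[R]_k))) = omega m.
  apply/funext => v; rewrite [RHS]form2_mxE; last exact: form_multilinear.
  by rewrite /form2 section_mxE zT !mul0mx ?mulmx0 addr0 subr0.
have pE : wedge (form1 (lproj_mx *m c)) (wedge_pow (form2 (section_mx W (P m m))) r)
  (fun i => row_mx (u i) 0) =
   wedge (eta m) (wedge_pow (omega m) r) u.
  rewrite -eE -oE /wedge; congr (_ * _); apply: eq_bigr => s _; congr (_ * _).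
  apply: esym.
  exact: (@wedge_pow_pullback R _ _ (fun v : 'rV[R]_n => row_mx v (0 : 'rV[R]_k))).
by rewrite pE.
Qed.

(** * The nondegenerate thickening *)

Definition tpt := {t : M * 'rV[R]_k | nondegenerate t}.
Definition tzero m : tpt := exist _ (m, 0) (zero_nondegenerate m).
Definition tbase (t : tpt) : M := (sval t).1.
Definition tmap i (t : tpt) : 'rV[R]_(n + k) := triv i (sval t).
Definition tdom i : set tpt := [set t | U i (tbase t)].
(** Outside the image of the trivialization the zero section supplies a default
    value. *)
Definition tinv i (y : 'rV[R]_(n + k)) : tpt :=
  if pselect (nondegenerate (triv_inv i y)) is left h then exist _ (triv_inv i y)
    h else tzero i.

Lemma tinvE i y : nondegenerate (triv_inv i y) -> sval (tinv i y) = triv_inv i y.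
Proof. by rewrite /tinv; case: pselect. Qed.

Lemma sval_inj_tpt (t t' : tpt) : sval t = sval t' -> t = t'.
Proof.
case: t t' => [t h] [t' h'] /= E; subst t'; congr exist; exact: Prop_irrelevance.
Qed.

Lemma tmapK i t : tdom i t -> tinv i (tmap i t) = t.
Proof.
move=> Ut; apply: sval_inj_tpt.
have E : triv_inv i (triv i (sval t)) = sval t by exact: (trivK).
by rewrite tinvE /tmap E //; exact: (svalP t).
Qed.

Lemma nondegenerate_triv_inv i W y : over i W y -> nondegenerate (triv_inv i y)
  <-> nondeg_at i y.
Proof.
move=> By; have [Ui _ _] := overP By.
have := nondegenerateE
  (t := triv_inv i y) Ui.
by rewrite (triv_invK By).
Qed.

Lemma timage i W : tmap i @` (tdom i `&` [set t | W (tbase t)]) = over i W `&` nondeg_at i.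
Proof.
apply/seteqP; split=> [_ [t [Ut Wt] <-]|y [By Ny]].
  split; first exact: (over_triv (t := sval t)).
  have Ut' : U i (sval t).1 := Ut.
  exact ((nondegenerateE Ut').1 (svalP t)).
have Gy : nondegenerate (triv_inv i y) := (nondegenerate_triv_inv By).2 Ny.
have [Ui Wy _] := overP By.
exists (tinv i y); last by rewrite /tmap tinvE // (triv_invK By).
by rewrite /tdom /tbase /= tinvE.
Qed.

Lemma timage_open i W : open W ->
  open (tmap i @` (tdom i `&` [set t | W (tbase t)])).
Proof. by move=> oW; rewrite timage; exact: nondeg_at_open. Qed.

Lemma ttransition i j :
  smooth_on (tmap i @` (tdom i `&` tdom j)) (tmap j \o tinv i).
Proof.
have := @timage_open i _ (@U_open j); rewrite -/(tdom j) => oO.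
apply: (eq_smooth (f := triv_change i j) oO).
  move=> y; rewrite (timage i (U j)) => -[By Ny].
  by rewrite /= /tmap (tinvE ((nondegenerate_triv_inv By).2 Ny)).
apply: smooth_sub (smooth_triv_change i j).
by rewrite (timage i (U j)) => y [].
Qed.

(** Points over distinct points of M are separated by open sets of M. *)
Lemma tseparated (s t : tpt) : s <> t -> (exists i, tdom i s /\ tdom i t) \/
    (exists A B : set tpt, [/\ forall i, open (tmap i @` (tdom i `&` A)),
       forall i, open (tmap i @` (tdom i `&` B)), A s, B t & A `&` B = set0]).
Proof.
move=> st; have [E|/eqP E] := pselect (tbase s = tbase t).
  by left; exists (tbase s); rewrite /tdom /= -E; split; exact: U_self.
right; have := @manifold_hausdorff R n M; rewrite open_hausdorff => /(_ _ _ E).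
move=> [[A B] /= [/set_mem As /set_mem Bt] [oA oB /eqP AB]].
exists [set u | A (tbase u)], [set u | B (tbase u)]; split=> //.
- by move=> i; exact: timage_open.
- by move=> i; exact: timage_open.
- rewrite -subset0 => u [Au Bu].
  have : (A `&` B) (tbase u) by split.
  by rewrite AB.
Qed.

Lemma tcount : exists s : nat -> M, forall t, exists j, tdom (s j) t.
Proof. by have [s sP] := U_count; exists s => t; exact: sP. Qed.

Definition thickening_gluing : @gluing R (n + k) :=
  @Gluing R (n + k) tpt M tdom tmap tinv tbase (fun t => U_self (tbase t))
    tmapK (fun i j => @timage_open i _ (@U_open j)) ttransition tseparated tcount.

Definition thickening : manifold R (n + k) := glued_manifold thickening_gluing.

Definition tchart (i : M) : chart R (n + k) thickening := @glued_chart R (n + k)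
  thickening_gluing i.

Lemma tchart_image i : cmap (tchart i) @` cdom (tchart i) = over i setT `&` nondeg_at i.
Proof. by rewrite -timage; congr (_ @` _); apply/seteqP; split=> t //= []. Qed.

Lemma tchart_image_open i : open (over i setT `&` nondeg_at i).
Proof. exact: nondeg_at_open openT. Qed.

(** The preferred chart at a point of the thickening is the trivialization of
    index its base point. *)
Lemma tchart_tangent i y u : (over i setT `&` nondeg_at i) y ->
  chart_tangent (tchart i) y u = u *m 'J (triv_change i (triv_base i y)) y.
Proof.
move=> [By Ny]; have [Ui _ _] := overP By.
have Gy : nondegenerate (triv_inv i y) := (nondegenerate_triv_inv By).2 Ny.
have bE : tbase (tinv i y) = triv_base i y by rewrite /tbase tinvE.
have oB := nondeg_at_open (m0 := i) (@U_open (triv_base i y)).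
have sG : smooth_on (over i (U (triv_base i y)) `&` nondeg_at i)
  (triv_change i (triv_base i y)).
  apply: smooth_sub (smooth_triv_change i (triv_base i y)).
  by move=> z [].
have Oy : (over i (U (triv_base i y)) `&` nondeg_at i) y.
  split=> //; case: By => m [mc [Um _]] E; exists m => //; split=> //; split=> //.
  by rewrite /triv_base -E cmapK.
have changeE z : (over i (U (triv_base i y)) `&` nondeg_at i) z ->
    triv_change i (triv_base i y) z = (tmap (triv_base i y) \o tinv i) z.
  by move=> [Bz Nz]; rewrite /= /tmap (tinvE ((nondegenerate_triv_inv Bz).2 Nz)).
have J := near_eq_jacobian oB sG changeE Oy.
rewrite J -[RHS](jacobianE (tmap (triv_base i y) \o tinv i) y u) -bE.
reflexivity.
Qed.

Definition eta_val (t : thickening) (v : 'I_1 -> tangent t) : R :=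
  form1 (total_eta (tbase t) (tmap (tbase t) t)) v.

Definition omega_val (t : thickening) (v : 'I_2 -> tangent t) : R :=
  form2 (total_omega (tbase t) (tmap (tbase t) t)) v.

Lemma over_self i y : over i setT y -> over i (U (triv_base i y)) y.
Proof.
move=> [m [mc [Um _]] E]; exists m => //; split=> //; split=> //.
by rewrite /triv_base -E cmapK.
Qed.

Lemma tmap_tinv i y : (over i setT `&` nondeg_at i) y ->
  tbase (tinv i y) = triv_base i y /\
  tmap (tbase (tinv i y)) (tinv i y) = triv_change i (triv_base i y) y.
Proof.
move=> [By Ny]; have Gy : nondegenerate (triv_inv i y) := (nondegenerate_triv_inv By).2 Ny.
by rewrite /tbase /tmap tinvE.
Qed.

Lemma local_eta_val i y v : (over i setT `&` nondeg_at i) y ->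
  local_form eta_val (tchart i) y v = form1 (total_eta i y) v.
Proof.
move=> Oy; have [bE mE] := tmap_tinv Oy.
rewrite /local_form /eta_val.
have -> : (fun j => chart_tangent (tchart i) y (v j)) =
    (fun j => v j *m 'J (triv_change i (triv_base i y)) y).
  by apply/funext => j; exact: tchart_tangent.
rewrite -[cinv (tchart i) y]/(tinv i y) mE bE.
have T := total_eta_natural (over_self Oy.1).
exact (esym (congr1 (fun f => f v) (form1_natural T))).
Qed.

Lemma local_omega_val i y v : (over i setT `&` nondeg_at i) y ->
  local_form omega_val (tchart i) y v = form2 (total_omega i y) v.
Proof.
move=> Oy; have [bE mE] := tmap_tinv Oy.
rewrite /local_form /omega_val.
have -> : (fun j => chart_tangent (tchart i) y (v j)) =
    (fun j => v j *m 'J (triv_change i (triv_base i y)) y).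
  by apply/funext => j; exact: tchart_tangent.
rewrite -[cinv (tchart i) y]/(tinv i y) mE bE.
have T := total_omega_natural (over_self Oy.1).
exact (esym (congr1 (fun f => f v) (form2_natural T))).
Qed.

Lemma eta_val_smooth (c : chart R (n + k) thickening) (v : 'I_1 -> 'rV[R]_(n + k)) : atlas c ->
  smooth_on (cmap c @` cdom c) (fun y => local_form eta_val c y v).
Proof.
move=> [i _ <-]; rewrite -/(tchart i) tchart_image.
have oO := @tchart_image_open i.
apply: (eq_smooth (f := fun y => form1 (total_eta i y) v) oO).
  by move=> y Oy; rewrite local_eta_val.
apply: form1_smooth => //.
by apply: smooth_sub (smooth_total_eta i) => y [].
Qed.

Lemma omega_val_smooth (c : chart R (n + k) thickening) (v : 'I_2 -> 'rV[R]_(n + k)) :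
  atlas c ->
  smooth_on (cmap c @` cdom c) (fun y => local_form omega_val c y v).
Proof.
move=> [i _ <-]; rewrite -/(tchart i) tchart_image.
have oO := @tchart_image_open i.
apply: (eq_smooth (f := fun y => form2 (total_omega i y) v) oO).
  by move=> y Oy; rewrite local_omega_val.
apply: form2_smooth => //.
by apply: smooth_sub (smooth_total_omega i) => y [].
Qed.

Definition eta_t : kform thickening 1 :=
  @Kform R (n + k) thickening 1 eta_val (fun t => form1_multilinear _)
    (fun t => form1_alternating _) eta_val_smooth.

Definition omega_t : kform thickening 2 :=
  @Kform R (n + k) thickening 2 omega_val (fun t => form2_multilinear _)
    (fun t => form2_alternating (total_omega_skew _ _)) omega_val_smooth.

Lemma total_eta_base i y v : over i setT y ->
  form1 (total_eta i y) v = local_form eta (ch i) (y *m lproj_mx) (fun j => v j *m lproj_mx).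
Proof.
move=> [m [mc [Um _]] E]; rewrite mul_lproj_mx local_etaE; last by exists m.
by rewrite total_etaE /triv_base /form1 mulmxA.
Qed.

Lemma total_omega_base i y v : over i setT y ->
  form2 (total_omega i y) v =
  local_form omega (ch i) (y *m lproj_mx) (fun j => v j *m lproj_mx)
    + form2 (ext1 (taut_form i) y) v.
Proof.
move=> [m [mc [Um _]] E]; rewrite mul_lproj_mx local_omegaE; last by exists m.
rewrite total_omegaE /triv_base; move: (omega_mx _ _ _) (ext1 _ _) => W X.
by rewrite form2_mul /form2 mulmxDr mulmxDl mxE.
Qed.

Lemma tbox (t : thickening) : (over (tbase t) setT `&` nondeg_at (tbase t)) (tmap (tbase t) t).
Proof. by rewrite -tchart_image; exists t => //; exact: U_self. Qed.

Lemma tmap_lproj (t : thickening) : tmap (tbase t) t *m lproj_mx = cmap (ch (tbase t))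
  (tbase t).
Proof. by rewrite mul_lproj_mx row_mxKl. Qed.

Lemma eta_t_closed : closed_form eta -> closed_form eta_t.
Proof.
move=> ce t v; rewrite -[RHS](ce (tbase t) (fun j => v j *m lproj_mx)) /ext_d.
apply: eq_bigr => i _; congr (_ * _).
have oI := @cimage_open _ _ _ (ch (tbase t)).
have Ox : (cmap (ch (tbase t)) @` cdom (ch (tbase t))) (tmap (tbase t) t *m lproj_mx).
  by rewrite tmap_lproj; exists (tbase t) => //; exact: chart_at_dom.
have [d dE] := derive_lproj (v i) oI (@form_smooth _ _ _ _ eta (ch (tbase t))
  (fun j => v (lift i j) *m lproj_mx) (chart_at_atlas (tbase t))) Ox.
rewrite -[in RHS]tmap_lproj -dE.
apply: (derive_near (U := over (tbase t) setT `&` nondeg_at (tbase t))).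
- exact: tchart_image_open.
- move=> y Oy; exact (etrans (local_eta_val _ Oy) (total_eta_base _ Oy.1)).
- exact: tbox.
Qed.

(** The pullback of omega and the exterior derivative of [taut_form] are closed
    separately. *)
Lemma omega_t_closed : closed_form omega -> closed_form omega_t.
Proof.
move=> ce t v; pose b := tbase t; pose y0 := tmap b t.
have oI := @cimage_open _ _ _ (ch b).
have oB : open (over b setT) := @over_open b setT openT.
have sth := smooth_taut_form b.
have By0 : over b setT y0 by have [] := tbox t.
have sX (i : 'I_3) : smooth_on (over b setT) (fun y => form2 (ext1 (taut_form b) y)
  (fun j => v (lift i j))).
  by apply: form2_smooth => //; exact: smooth_ext1.
transitivity (ext_d omega (m:=b) (fun j => v j *m lproj_mx) +
  \sum_(i < 3) (-1) ^+ i * 'D_(v i) (fun z => form2 (ext1 (taut_form b) z) (fun j =>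
    v (lift i j))) y0).
  rewrite /ext_d -big_split /=; apply: eq_bigr => i _; rewrite -mulrDr; congr (_ * _).
  have Ox : (cmap (ch b) @` cdom (ch b)) (y0 *m lproj_mx).
    by rewrite tmap_lproj; exists b => //; exact: chart_at_dom.
  have [d dE] := derive_lproj (v i) oI (@form_smooth _ _ _ _ omega (ch b)
    (fun j => v (lift i j) *m lproj_mx) (chart_at_atlas b)) Ox.
  rewrite -[in X in _ = X + _]tmap_lproj -dE.
  rewrite -(deriveD d (smooth_derivable (v := v i) (sX i) By0)).
  apply: (derive_near (U := over b setT `&` nondeg_at b)).
  - exact: tchart_image_open.
  - move=> y Oy; exact (etrans (local_omega_val _ Oy) (total_omega_base _ Oy.1)).
  - exact: tbox.
by rewrite ce add0r (ext1_closed _ oB sth By0).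
Qed.

Lemma thickening_top (t : thickening) : exists v : 'I_(1 + N.*2) -> tangent t,
  wedge (eta_t t) (wedge_pow (omega_t t) N) v != 0.
Proof. by have [v v0] := svalP t; exists v. Qed.

(** * The zero section *)

Definition zsec (m : M) : thickening := tzero m.

Lemma tmap_zsec i m : tmap i (zsec m) = row_mx (cmap (ch i) m) 0.
Proof. exact: triv_zero. Qed.

Lemma zsec_continuous : continuous zsec.
Proof.
apply/continuousP => A oA.
have -> : zsec @^-1` A = \bigcup_i (U i `&`
    cmap (ch i) @^-1` ((fun y => row_mx y 0) @^-1` (tmap i @` (tdom i `&` A)))).
  apply/seteqP; split=> [m Am|m [i _ [Um [t [Ut At] E']]]].
    exists m => //; split; first exact: U_self.
    exists (zsec m); last exact: tmap_zsec.
    by split=> //; exact: U_self.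
  change (A (zsec m)); suff -> : zsec m = t by [].
  rewrite -(tmapK (i := i) (t := zsec m) Um).
  rewrite tmap_zsec -E'; exact: (tmapK Ut).
apply: bigcup_open => i _; apply: preimage_open_in; first exact: U_open.
  by move=> m /U_dom; exact: cmap_continuous.
have c0 : continuous (fun y : 'rV[R]_n => row_mx y (0 : 'rV[R]_k)).
  move=> y; apply: (smooth_continuous (U := setT)) => //.
  by apply: smooth_row_mx; [exact: openT|exact: smooth_id|exact: smooth_cst].
by move/continuousP: c0 => /(_ _ (oA i)).
Qed.

Lemma zsec_smooth : smooth_map zsec.
Proof.
split; first exact: zsec_continuous.
move=> c c' ac [i _ <-].
have -> : cdom c `&` zsec @^-1` (cdom (tchart i)) = cdom c `&` U i by [].
have oO := @overlap_open R n M c _ (@U_open i).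
apply: (@eq_smooth _ _ _ _ (fun y => row_mx (transition c (ch i) y) 0)) => //.
  by move=> y _; rewrite -[RHS]/(tmap i (zsec (cinv c y))) tmap_zsec.
apply: smooth_row_mx => //; last exact: smooth_cst.
apply: smooth_sub (transition_smooth ac (chart_at_atlas i)) => _ [m [mc Um] <-].
by exists m => //; split=> //; exact: U_dom.
Qed.

Lemma zsec_inj : injective zsec.
Proof. by move=> m m' /(congr1 (fun t => (sval t).1)). Qed.

Lemma tangent_zsec m v : tangent_map zsec m v = row_mx v 0.
Proof.
have oO : open (cmap (ch m) @` cdom (ch m)) := @cimage_open _ _ _ (ch m).
have sQ := smooth_mulmxr (linj_mx : 'M[R]_(n, n + k)) oO.
have EQ y : (cmap (ch m) @` cdom (ch m)) y -> y *m linj_mx = (tmap m \o zsec \o cinv (ch m)) y.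
  by move=> [m' h <-]; rewrite /= tmap_zsec cmapK // mul_linj_mx.
have mO : (cmap (ch m) @` cdom (ch m)) (cmap (ch m) m).
  by exists m => //; exact: chart_at_dom.
have J := near_eq_jacobian oO sQ EQ mO.
rewrite jacobian_mulmxr in J.
rewrite -[LHS]/('d (tmap m \o zsec \o cinv (ch m)) (cmap (ch m) m) v).
by rewrite jacobianE -J mul_linj_mx.
Qed.

Lemma zsec_embedding : embedding zsec.
Proof.
split; [exact: zsec_smooth|exact: zsec_inj| |].
- move=> m v w; rewrite !tangent_zsec => /eq_row_mx[] //.
- move=> W oW; exists [set t : thickening | W (tbase t)] => //.
  move=> i; exact: (timage_open oW).
Qed.

Lemma pullback_eta m (v : 'I_1 -> tangent m) : pullback zsec eta_t v = eta m v.
Proof.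
rewrite [RHS]form1_mxE; last exact: form_multilinear.
have -> : pullback zsec eta_t v =
    form1 (total_eta m (tmap m (zsec m))) (fun j => tangent_map zsec m (v j)) by [].
by rewrite tmap_zsec total_eta_zero /form1 tangent_zsec mulmxA mul_lproj_mx row_mxKl.
Qed.

Lemma omega_zsecE m (x y : 'rV[R]_(n + k)) :
  omega_t (zsec m) (tnth [tuple x; y]) =
  (x *m section_mx (form2_mx (omega m)) (P m m) *m y^T) 0 0.
Proof.
have -> : omega_t (zsec m) (tnth [tuple x; y]) =
    form2 (total_omega m (tmap m (zsec m))) (tnth [tuple x; y]) by [].
by rewrite tmap_zsec (total_omega_zero).
Qed.

Lemma pullback_omega m (v : 'I_2 -> tangent m) : pullback zsec omega_t v = omega m v.
Proof.
rewrite [RHS]form2_mxE; last exact: form_multilinear.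
rewrite /pullback (tnth2E (fun j => tangent_map zsec m (v j))) omega_zsecE.
by rewrite !tangent_zsec section_mxE trmx0 mul0mx mul0mx mulmx0 addr0 subr0.
Qed.

(** Pairing (v, b) with a vector w of the kernel gives b (w), since omega (v, w)
    vanishes; as the kernel is spanned by [Kb m], orthogonality forces b = 0. *)
Lemma zsec_coisotropic : coisotropic_image eta_t omega_t zsec.
Proof.
move=> m X [_ HX]; exists (lsubmx (X : 'rV[R]_(n + k))) => //.
rewrite tangent_zsec -[RHS](hsubmxK (X : 'rV[R]_(n + k))); congr row_mx.
apply: esym; set b := rsubmx _; set v := lsubmx (X : 'rV[R]_(n + k)).
have H (w : 'rV[R]_n) : (v *m form2_mx (omega m) *m w^T + b *m (P m m)^T *m w^T) 0 0 = 0.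
  have := section_mxE (form2_mx (omega m)) (P m m) v w b 0.
  rewrite trmx0 mulmx0 subr0 => <-; rewrite hsubmxK -omega_zsecE.
  by apply: HX; exists w => //; rewrite tangent_zsec.
have WT : (form2_mx (omega m))^T = - form2_mx (omega m).
  by apply: form2_mx_skew; [exact: form_multilinear|exact: form_alternating].
have b0 : b *m ((P m m)^T *m (Kb m)^T) = 0.
  apply/rowP => j; rewrite [RHS]mxE; have := H (row j (Kb m)).
  have -> : v *m form2_mx (omega m) *m (row j (Kb m))^T = 0.
    rewrite -mulmxA; have -> : form2_mx (omega m) *m (row j (Kb m))^T = 0.
      apply: trmx_inj; rewrite trmx_mul trmxK WT mulmxN -row_mul Kb_omega.
      by rewrite row0 oppr0 trmx0.
    by rewrite mulmx0.
  by rewrite add0r tr_row -mulmxA !colE mulmxA mulmxA -!colE mxE mulmxA.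
by move: b0; rewrite -trmx_mul Kb_P trmx1 mulmx1.
Qed.

Lemma coisotropic_thickening : closed_form eta -> closed_form omega ->
  exists (T : manifold R (n + k)) (eta' : kform T 1) (omega' : kform T 2) (f : M -> T),
    [/\ [/\ closed_form eta', closed_form omega' &
          nowhere_zero (fun t => wedge (eta' t) (wedge_pow (omega' t) N))],
        embedding f,
        forall (m : M) (v : 'I_1 -> tangent m), pullback f eta' v = eta m v,
        forall (m : M) (v : 'I_2 -> tangent m), pullback f omega' v = omega m v &
        coisotropic_image eta' omega' f].
Proof.
move=> ce co; exists thickening, eta_t, omega_t, zsec; split.
- split; [exact: eta_t_closed|exact: omega_t_closed|exact: thickening_top].
- exact: zsec_embedding.
- exact: pullback_eta.
- exact: pullback_omega.
- exact: zsec_coisotropic.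
Qed.

End TotalSpace.

(** * The coisotropic embedding *)

Lemma change_term_mx (F : fieldType) (n k l : nat) (Pi0 Pi1 J01 J10 : 'M[F]_n)
    (F1 : 'M[F]_(n, l)) (E1 : 'M[F]_(l, n)) (F0 : 'M[F]_(n, k)) :
  J01 *m Pi1 *m J10 = Pi0 -> Pi1 *m F1 *m E1 = Pi1 ->
  Pi0 *m F0 = J01 *m (Pi1 *m F1) *m ((E1 *m J10 *m F0)^T)^T.
Proof. by move=> <- H; rewrite -{1}H trmxK !mulmxA. Qed.

Lemma coisotropic_embedding (R : realType) (n k r : nat) (M : manifold R n)
    (eta : kform M 1) (omega : kform M 2) (m0 : M) :
  closed_form eta -> closed_form omega ->
  (forall m, exists v, wedge (eta m) (wedge_pow (omega m) r) v != 0) ->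
  (forall m, has_dim (ker1 (eta m) `&` ker2 (omega m)) k) ->
  exists (T : manifold R (n + k)) (eta' : kform T 1) (omega' : kform T 2) (f : M -> T),
    [/\ [/\ closed_form eta', closed_form omega' &
          nowhere_zero (fun t => wedge (eta' t) (wedge_pow (omega' t) (r + k)))],
        embedding f,
        forall (m : M) (v : 'I_1 -> tangent m), pullback f eta' v = eta m v,
        forall (m : M) (v : 'I_2 -> tangent m), pullback f omega' v = omega m v &
        coisotropic_image eta' omega' f].
Proof.
move=> ce co top HK.
have [L [E0 [F HL]]] := frames_exist HK.
pose U := frame_dom eta omega L E0 F.
have oU : forall m, open (U m) := frame_dom_open eta omega L E0 F.
have dU : forall m, U m `<=` cdom (chart_at m) := @frame_dom_sub _ _ _ _ eta omega L E0 F.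
have sU : forall m, U m m := frame_dom_self HL.
have [s [rho [C [rs HC ro /choice[idx HI]]]]] := @partition_of_unity R n M U m0
  (fun m => And3 (oU m) (sU m) (@dU m)).
have at_ := @chart_at_atlas R n M.
pose Pr := kernel_proj eta omega L E0 F s rho idx.
pose P i m : 'M[R]_(n, k) := Pr (chart_at i) m *m F i.
pose g := dual_cocycle eta omega L E0 F.
pose E m : 'M[R]_(k, n) := kernel_basis eta omega L E0 F m m.
have g_id : forall i m, U i m -> g i i m = 1%:M.
  by move=> i m; exact: (dual_cocycle_id HK).
have g_comp : forall i j l m, U i m -> U j m -> U l m ->
    g i j m *m g j l m = g i l m.
  by move=> i j l m; exact: (dual_cocycle_comp HK).
have sg : forall i j, smooth_in (chart_at i) (U i `&` U j) (g i j).
  exact: smooth_dual_cocycle.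
have sP : forall i, smooth_in (chart_at i) (U i) (P i).
  move=> i; apply: (smooth_in_mul (oU i)); last exact: smooth_in_cst.
  apply: smooth_in_sub (dU i) _.
  exact: (smooth_kernel_proj rs HC ro HI (at_ i)).
have Pc : forall i j m, U i m -> U j m -> P i m =
    transition_mx (chart_at i) (chart_at j) m *m P j m *m (g i j m)^T.
  move=> i j m Ui Uj; have di := dU i m Ui; have dj := dU j m Uj.
  have C1 := kernel_proj_change idx HC ro (at_ i) (at_ j) di dj.
  have C2 := kernel_basis_coord Uj (kernel_proj_ker HK idx HC ro (at_ j) dj).
  exact (change_term_mx (F i) C1 C2).
have E_P m : E m *m P m m = 1%:M.
  have K := kernel_proj_id HC ro HI (at_ m) (chart_at_dom m) (kernel_basis_ker HK (sU m)).
  have E1 := kernel_basisK HK (sU m).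
  by rewrite /E /P mulmxA K.
have Ek m : E m *m form2_mx (omega m) = 0 /\ E m *m form1_mx (eta m) = 0.
  have := kernel_basis_ker HK (sU m); rewrite -/(E m)
    /forms_mx omega_mx_chart_at eta_mx_chart_at.
  by rewrite mul_mx_row -row_mx0 => /eq_row_mx.
have Uc : exists s : nat -> M, forall m, exists j, U (s j) m.
  by apply: (countable_subcover m0) => m; split; [exact: oU|exact: sU].
exact (coisotropic_thickening oU dU sU g_id g_comp sg sP Pc E_P
  (fun m => (Ek m).1) (fun m => (Ek m).2) top Uc ce co).
Qed.

Theorem theorem4p12 (R : realType) (d r : nat) (M : manifold R (2 * d).+1)
    (eta : kform M 1) (omega : kform M 2) :
  pre_cosymplectic r eta omega ->
  exists (n : nat) (N : manifold R (2 * n).+1)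
    (eta' : kform N 1) (omega' : kform N 2) (f : M -> N),
    [/\ cosymplectic eta' omega',
        embedding f,
        forall (m : M) (v : 'I_1 -> tangent m), pullback f eta' v = eta m v,
        forall (m : M) (v : 'I_2 -> tangent m), pullback f omega' v = omega m v &
        coisotropic_image eta' omega' f].
Proof.
move=> [[ce co] _ rk top [k HK]].
(* The countable cover of M by frame domains is indexed from a point of M; an
   empty M is its own cosymplectic manifold. *)
have [[m0]|noM] := pselect (inhabited M); last first.
  have void (m : M) : False by apply: noM; exists.
  exists d, M, eta, omega, id; split; try by move=> m; case: (void m).
  - by split=> // m; case: (void m).
  - split; try by move=> m; case: (void m).
      split=> [m|c c' _ _]; first by case: (void m).
      have -> : cmap c @` (cdom c `&` id @^-1` cdom c') = set0.
        by apply/seteqP; split=> // y [m]; case: (void m).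
      exact: smooth_set0.
    by move=> W oW; exists W.
have dimE : ((2 * d).+1 + k = (2 * (r + k)).+1)%N.
  have := presymplectic_dim (@form_multilinear _ _ _ _ eta m0)
    (@form_multilinear _ _ _ _ omega m0) (rk m0)
    (@form_alternating _ _ _ _ omega m0) (top m0) (HK m0).
  lia.
exists (r + k)%N; rewrite /cosymplectic -dimE.
exact: (coisotropic_embedding m0 ce co top HK).
Qed.
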